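(* Let $N\in\mathbb N$ and $L_1,L_2\in2\mathbb N$. Let $N_1=\sigma_1N\in2\mathbb N$ with $\sigma_1>1$, let $m_1\in\mathbb N\setminus\{1\}$ with $2m_1<N_1$, let $N_2=\sigma_2(N_1+2m_1)\in2\mathbb N$ with $\sigma_2>1$, and let $m_2\in\mathbb N\setminus\{1\}$ with $2m_2\le\big(1-\frac1{\sigma_1}\big)N_2$. Let $\omega_j\in\Omega(m_j,\sigma_j)$ and $\varphi_j(t)=\omega_j\big(\frac{N_jt}{m_j}\big)$ for $j=1,2$. Let $a_k,b_\ell\in[-\frac12,\frac12]$, $k\in\mathcal I_{L_1}$, $\ell\in\mathcal I_{L_2}$, be arbitrary points, let $c_k\in\mathbb C$, $k\in\mathcal I_{L_1}$, be arbitrary coefficients, and let $a=1+\frac{2m_1}{N_1}$. Let $C=\frac{\pi(\mathrm e^2-1)}{2\mathrm e}$. For a given $\varepsilon>0$ let $n=2^t$, $t\in\mathbb N\setminus\{1\}$, be chosen such that, with $\nu=n/N$, $$\frac{36\,(1+\mathrm e^{-2CN})}{35\,(\mathrm e^2-1)}\,\mathrm e^{-N(\nu-C)}<\varepsilon,\qquad\nu>C.$$ Let $h(b_\ell)=\sum_{k\in\mathcal I_{L_1}}c_k\,\mathrm{sinc}\big(N\pi(b_\ell-a_k)\big)$ and let $\tilde h_\ell$, $\ell\in\mathcal I_{L_2}$, be the output of the fast $\mathrm{sinc}$ transform. Then $$\max_{\ell\in\mathcal I_{L_2}}|h(b_\ell)-\tilde h_\ell|\le\Big(\varepsilon+2\Big[E_{\sigma_1}(\varphi_1)+\frac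 a{\hat\varphi_1(\frac N2)}E_{\sigma_2}(\varphi_2)\Big]+\Big[E_{\sigma_1}(\varphi_1)+\frac a{\hat\varphi_1(\frac N2)}E_{\sigma_2}(\varphi_2)\Big]^2\Big)\sum_{k\in\mathcal I_{L_1}}|c_k|.$$ If in addition $$E_{\sigma_1}(\varphi_1)+\frac a{\hat\varphi_1(\frac N2)}E_{\sigma_2}(\varphi_2)\le1,$$ then $$\max_{\ell\in\mathcal I_{L_2}}|h(b_\ell)-\tilde h_\ell|\le\Big(\varepsilon+3E_{\sigma_1}(\varphi_1)+\frac{3a}{\hat\varphi_1(\frac N2)}E_{\sigma_2}(\varphi_2)\Big)\sum_{k\in\mathcal I_{L_1}}|c_k|.$$
   Context: $\mathbb N$ is the set of positive integers. For $M\in2\mathbb N$, $\mathcal I_M=\{-\frac M2,1-\frac M2,\dots,\frac M2-1\}$. $\mathrm{sinc}(y)=\frac{\sin y}y$ for $y\ne0$, $\mathrm{sinc}(0)=1$. The Fourier transform is $\hat g(v)=\int_{\mathbb R}g(x)\mathrm e^{-2\pi\mathrm ivx}\,\mathrm dx$. For $m\in\mathbb N\setminus\{1\}$ and $\sigma>1$, $\Omega(m,\sigma)$ is the set of functions $\omega:\mathbb R\to[0,1]$ such that: $\omega$ is even, has support $[-1,1]$ and is continuous on $\mathbb R$; $\omega|_{[0,1]}$ is decreasing with $\omega(0)=1$; $\hat\omega$ is positive and decreasing on $[0,\frac m{2\sigma}]$. General error constant: for $\omega\in\Omega(m,\sigma)$ and $K\in\mathbb N$ with $\sigma K\in2\mathbb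 N$, put $\varphi^{[K]}(t)=\omega\big(\frac{\sigma Kt}m\big)$ and $$E_{\sigma,K}(\varphi)=\max_{v\in[-K/2,K/2]}\Big\|\sum_{r\in\mathbb Z\setminus\{0\}}\frac{\widehat{\varphi^{[K]}}(v+r\sigma K)}{\widehat{\varphi^{[K]}}(v)}\mathrm e^{2\pi\mathrm ir\sigma K\,\cdot}\Big\|_{C(\mathbb T)},\qquad E_\sigma(\varphi)=\sup_KE_{\sigma,K}(\varphi),$$ the supremum being over all $K\in\mathbb N$ with $\sigma K\in 2\mathbb N$. Here $\|g\|_{C(\mathbb T)}=\max_{x\in[-1/2,1/2]}|g(x)|$ for continuous 1-periodic $g$, and Fourier series are limits of symmetric partial sums. $E_{\sigma_1}(\varphi_1)$ is formed with $(\omega_1,m_1,\sigma_1)$ (so $\varphi_1=\varphi^{[N]}$), and $E_{\sigma_2}(\varphi_2)$ with $(\omega_2,m_2,\sigma_2)$ (so $\varphi_2=\varphi^{[N_1+2m_1]}$). NNFFT: for a finite family of coefficients $f_k\in\mathbb C$ and frequencies $v_k\in[-\frac12,\frac12]$, set $$g^*_\ell=\frac1{N_1}\sum_kf_k\,\varphi_1\Big(\frac\ell{N_1}-v_k\Big)\quad(\ell\in\mathcal I_{N_1+2m_1}),\qquad h^*_s=\frac1{N_2}\sum_{\ell\in\mathcal I_{N_1+2m_1}}\frac{g^*_\ell}{\hat\varphi_2(\ell)}\mathrm e^{-2\pi\mathrm i\ell s/N_2}\quad(s\in\mathcal I_{N_2}),$$ $$s_1(Nx)=\sum_{s\in\mathcal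 I_{N_2}}h^*_s\,\varphi_2\Big(\frac x{\sigma_1}-\frac s{N_2}\Big),\qquad x\in[-\tfrac12,\tfrac12].$$ The NNFFT value at $x\in[-\frac12,\frac12]$ is $s_1(Nx)/\hat\varphi_1(Nx)$; it approximates $\sum_kf_k\mathrm e^{-2\pi\mathrm iNv_kx}$. Fast $\mathrm{sinc}$ transform: let $z_j=\cos\frac{j\pi}n$, $j=0,\dots,n$, and (for even $n$) $$w_k=\frac1n\,\varepsilon_n(k)^2\sum_{j=0}^{n/2}\varepsilon_n(2j)^2\,\frac2{1-4j^2}\cos\frac{2jk\pi}n,\quad k=0,\dots,n,\qquad\varepsilon_n(0)=\varepsilon_n(n)=\tfrac{\sqrt2}2,\ \varepsilon_n(j)=1\ (1\le j\le n-1).$$ Step 1: for $j=0,\dots,n$ let $\tilde g_j$ be the NNFFT value approximating $g_j=\sum_{k\in\mathcal I_{L_1}}c_k\mathrm e^{-\pi\mathrm iNz_ja_k}$ (coefficients $c_k$, frequencies $v_k=a_k$, node $x=z_j/2$). Step 2: $\alpha_j=w_j\tilde g_j$. Step 3: for $\ell\in\mathcal I_{L_2}$ let $\tilde h_\ell$ be the NNFFT value approximating $\hat h_\ell=\sum_{j=0}^n\alpha_j\mathrm e^{\pi\mathrm iNz_jb_\ell}$ (coefficients $\alpha_j$, frequencies $-z_j/2$, node $x=b_\ell$). Both steps use the same $N,N_1,N_2,m_1,m_2,\varphi_1,\varphi_2$. The output is $(\tilde h_\ell)_{\ell\in\mathcal I_{L_2}}$. *)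

(* Defs.v *)
From HB Require Import structures.
From mathcomp Require Export all_boot all_order all_algebra.
From mathcomp Require Export complex.
From mathcomp Require Export all_classical all_reals all_analysis.
Export Order.TTheory GRing.Theory Num.Theory numFieldNormedType.Exports.

Set Implicit Arguments.
Unset Strict Implicit.
Unset Printing Implicit Defensive.

Local Open Scope classical_set_scope.
Local Open Scope ring_scope.
Local Open Scope complex_scope.

Definition posEven (M : nat) : bool := (0 < M)%N && ~~ odd M.

(* I_M = {-M/2, ..., M/2 - 1}, for even M *)
Definition Iset (M : nat) : seq int :=
  [seq (i%:Z - (M./2)%:Z)%R | i <- iota 0 M].

Definition sinc (R : realType) (y : R) : R :=
  if y == 0 then 1 else sin y / y.

Definition expi (R : realType) (t : R) : R[i] := Complex (cos t) (sin t).

(* The modulus as an element of R; the norm `|z| of R[i] lives in R[i]. *)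
Definition cabs (R : realType) (z : R[i]) : R := complex.Re `|z|.

Definition cintegral (R : realType) (f : R -> R[i]) : R[i] :=
  Complex (\int[@lebesgue_measure R]_x complex.Re (f x))
          (\int[@lebesgue_measure R]_x complex.Im (f x)).

Definition fourier (R : realType) (g : R -> R) (v : R) : R[i] :=
  cintegral (fun x => (g x)%:C * expi (- (2 * pi * v * x))).

(* The class Omega(m, sigma).  The order on R[i] is the partial order in which
   z <= w means that w - z is a nonnegative real number, so the last two
   clauses include the fact that the transform is real on the interval.
   "Decreasing" is taken in the wide sense. *)
Definition Omega (R : realType) (m : nat) (sigma : R) (w : R -> R) : Prop :=
  [/\ forall t, 0 <= w t <= 1,
      forall t, w (- t) = w t,
      closure [set t | w t != 0] = `[(-1 : R), 1]%classic & continuous w] /\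
  [/\ forall x y, 0 <= x -> x <= y -> y <= 1 -> w y <= w x,
      w 0 = 1,
      forall v, 0 <= v -> v <= m%:R / (2 * sigma) -> 0 < fourier w v &
      forall u v, 0 <= u -> u <= v -> v <= m%:R / (2 * sigma) ->
        fourier w v <= fourier w u].

(* t |-> w (M t / m) *)
Definition window (R : realType) (w : R -> R) (m : nat) (M : R) : R -> R :=
  fun t => w (M * t / m%:R).

(* sum over r in Z \ {0}, as the limit of the symmetric partial sums *)
Definition sum_nonzero (R : realType) (F : int -> R[i]) : R[i] :=
  limn (fun n : nat =>
    (\sum_(1 <= r < n.+1) (F r%:Z + F (- r%:Z)) : R[i]^o)).

Definition normCT (R : realType) (g : R -> R[i]) : R :=
  sup [set cabs (g x) | x in `[(- 2^-1 : R), 2^-1]%classic].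

(* [sup] of an unbounded set of reals is 0 by convention; for w in
   Omega(m, sigma) this case does not arise below: the norms for (K, K u) and
   (K', K' u) coincide, and for a fixed K they depend continuously on
   v in [-K/2, K/2]. *)
Definition EsigmaK (R : realType) (w : R -> R) (m : nat) (sigma : R)
    (K : nat) : R :=
  let phi := window w m (sigma * K%:R) in
  sup [set normCT (fun x => sum_nonzero (fun r =>
         fourier phi (v + r%:~R * (sigma * K%:R)) / fourier phi v
         * expi (2 * pi * r%:~R * (sigma * K%:R) * x)))
      | v in `[(- (K%:R / 2) : R), K%:R / 2]%classic].

Definition Esigma (R : realType) (w : R -> R) (m : nat) (sigma : R) : R :=
  sup [set EsigmaK w m sigma K | K in
         [set K : nat | (0 < K)%N /\
            exists2 M : nat, posEven M & sigma * K%:R = M%:R]].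

Section NNFFT.
Variables (R : realType) (N N1 N2 m1 : nat) (sigma1 : R) (phi1 phi2 : R -> R).
Variables (T : Type) (s : seq T) (f : T -> R[i]) (v : T -> R).

Definition nnfft_g (l : int) : R[i] :=
  N1%:R^-1 * \sum_(k <- s) f k * (phi1 (l%:~R / N1%:R - v k))%:C.

Definition nnfft_h (q : int) : R[i] :=
  N2%:R^-1 * \sum_(l <- Iset (N1 + 2 * m1))
    nnfft_g l / fourier phi2 l%:~R
    * expi (- (2 * pi * l%:~R * q%:~R / N2%:R)).

(* s_1(N x) *)
Definition nnfft_s1 (x : R) : R[i] :=
  \sum_(q <- Iset N2) nnfft_h q * (phi2 (x / sigma1 - q%:~R / N2%:R))%:C.

Definition nnfft (x : R) : R[i] := nnfft_s1 x / fourier phi1 (N%:R * x).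
End NNFFT.

Definition cheb (R : realType) (n j : nat) : R := cos (j%:R * pi / n%:R).

Definition cc_eps (R : realType) (n j : nat) : R :=
  if (j == 0) || (j == n) then Num.sqrt 2 / 2 else 1.

Definition cc_weight (R : realType) (n k : nat) : R :=
  n%:R^-1 * cc_eps R n k ^+ 2 *
  \sum_(0 <= j < (n./2).+1)
    cc_eps R n (2 * j) ^+ 2 * (2 / (1 - 4 * j%:R ^+ 2))
    * cos (2 * j%:R * k%:R * pi / n%:R).

Section FastSinc.
Variables (R : realType) (N N1 N2 m1 : nat) (sigma1 : R) (phi1 phi2 : R -> R).
Variables (n L1 : nat) (c : int -> R[i]) (a b : int -> R).

Let nnfftv := nnfft N N1 N2 m1 sigma1 phi1 phi2.

Definition fsinc_g (j : nat) : R[i] := nnfftv (Iset L1) c a (cheb R n j / 2).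

Definition fsinc_alpha (j : nat) : R[i] := (cc_weight R n j)%:C * fsinc_g j.

Definition fast_sinc (l : int) : R[i] :=
  nnfftv (iota 0 n.+1) fsinc_alpha (fun j => - (cheb R n j / 2)) (b l).
End FastSinc.

(* h(y) = sum_k c_k sinc(N pi (y - a_k)) *)
Definition sinc_sum (R : realType) (N L1 : nat) (c : int -> R[i])
    (a : int -> R) (y : R) : R[i] :=
  \sum_(k <- Iset L1) c k * (sinc (N%:R * pi * (y - a k)))%:C.

(* Main.v *)
Require Import Defs.
From mathcomp Require Import ring lra zify measurable_realfun.

(** The function sinc x is the mean over z in [-1, 1] of exp (i x z). Hence
    h(b) is the mean over z of the sum of c_k exp (i pi N z (b - a_k)), and the
    fast transform discretizes this mean by Clenshaw-Curtis quadrature at the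
    nodes z_j, then evaluates the two families of exponential sums that appear
    by NNFFTs. With E = E1 + a E2 / phi1hat, the error has three parts.

    Quadrature: at most eps times the sum of the |c_k|. The rule is exact on
    the Chebyshev polynomials T_k with k odd or k <= n, and for even k > n it
    sees T_k as a T_f with f <= n, so that it is wrong by at most
    1 + 1/35 ([cc_cos_even], [cc_cos_odd]). The Chebyshev coefficients of
    z |-> cos (x z) decay like exp (- k) times the maximum of this function on
    the ellipse with foci -1, 1 and half-axes cosh 1, sinh 1, which is at most
    cosh (|x| sinh 1); for |x| <= pi N this is cosh (C N). Contour integrals
    are avoided: exp (i x z) is replaced by the polynomial (1 + i x z / P)^P,
    whose coefficients are exact averages over roots of unity
    ([laurent_coef_bound]), and P tends to infinity at the end
    ([quadrature_linpow], [quadrature_sinc]).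

    First NNFFT: every g_j is wrong by at most E times the sum of the |c_k|
    ([nnfft_error]). The weights w_j are nonnegative with sum 1
    ([cc_weight_ge0], [cc_weight_sum]), so the quadrature averages these errors
    and does not amplify them.

    Second NNFFT: at most E times the sum of the |alpha_j|, which is at most
    1 + E times the sum of the |c_k|, again because the weights average.

    Altogether eps + E + E (1 + E).

    The NNFFT bound itself is Poisson summation: the samples of a window phi
    reproduce its transform at v up to a factor 1 + [alias], where [alias] is
    the series whose norm defines the error constant. Two points need care.
    The transform of phi need not be summable, and the series converges only
    in the symmetric sense; its partial sums are integrals of phi against
    Dirichlet kernels. Since phi is continuous, even and decreasing on the half
    line, its superlevel sets are intervals, and integrating over the levels
    reduces the convergence to that of Dirichlet integrals over intervals
    ([dirichlet_jordan], [window_poisson]). Moreover the error constant is an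
    iterated supremum, which is an upper bound only if it is taken over bounded
    sets; the finitely many nonzero samples give the uniform bound
    ([le_alias]). *)

Set Implicit Arguments.
Unset Strict Implicit.
Unset Printing Implicit Defensive.

Local Open Scope ring_scope.

(** * Modulus and exponential *)

Section ComplexBasics.
Local Open Scope complex_scope.
Variable R : realType.
Implicit Types (z w : R[i]) (x y : R).

Lemma normE z : `|z| = (cabs z)%:C.
Proof. by rewrite /cabs normc_def. Qed.

Lemma cabs_ge0 z : 0 <= cabs z.
Proof. by rewrite -ler0c -normE. Qed.

Lemma cabs0 : cabs (0 : R[i]) = 0.
Proof. by rewrite /cabs normr0. Qed.

Lemma cabsM z w : cabs (z * w) = cabs z * cabs w.
Proof. by apply: complexI; rewrite rmorphM -!normE normrM. Qed.

Lemma cabsV z : cabs z^-1 = (cabs z)^-1.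
Proof. by apply: complexI; rewrite fmorphV -!normE normfV. Qed.

Lemma cabsD z w : cabs (z + w) <= cabs z + cabs w.
Proof. by rewrite -lecR rmorphD -!normE ler_normD. Qed.

Lemma cabsN z : cabs (- z) = cabs z.
Proof. by rewrite /cabs normrN. Qed.

Lemma cabs_sum (I : Type) (r : seq I) (P : pred I) (F : I -> R[i]) :
  cabs (\sum_(i <- r | P i) F i) <= \sum_(i <- r | P i) cabs (F i).
Proof.
elim/big_rec2: _ => [|i y z _ h]; first by rewrite cabs0.
by rewrite (le_trans (cabsD _ _)) // lerD2l.
Qed.

Lemma cabsR x : cabs x%:C = `|x|.
Proof. by rewrite /cabs normc_def /= expr0n /= addr0 sqrtr_sqr. Qed.

Lemma cabs1 : cabs (1 : R[i]) = 1.
Proof. by rewrite -(rmorph1 (real_complex R)) cabsR normr1. Qed.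

Lemma cabsX z n : cabs (z ^+ n) = cabs z ^+ n.
Proof. by elim: n => [|n IH]; rewrite ?expr0 ?cabs1 // !exprS cabsM IH. Qed.

Lemma cabs_Complex x y : cabs (Complex x y) = Num.sqrt (x ^+ 2 + y ^+ 2).
Proof. by rewrite /cabs normc_def. Qed.

Lemma cabs_le_ReIm z : cabs z <= `|complex.Re z| + `|complex.Im z|.
Proof.
case: z => a b; rewrite cabs_Complex /=.
rewrite -[leRHS]ger0_norm ?addr_ge0 // -sqrtr_sqr ler_wsqrtr //.
rewrite sqrrD !real_normK ?num_real //.
by rewrite -addrA lerD2l lerDr mulrn_wge0 ?mulr_ge0.
Qed.

Lemma expi0 : expi 0 = 1 :> R[i].
Proof. by rewrite /expi cos0 sin0. Qed.

Lemma expiD x y : expi (x + y) = expi x * expi y :> R[i].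
Proof.
rewrite /expi cosD sinD; apply/eqP; rewrite eq_complex /=.
by apply/andP; split; apply/eqP; ring.
Qed.

Lemma cabs_expi x : cabs (expi x) = 1.
Proof. by rewrite cabs_Complex cos2Dsin2 sqrtr1. Qed.

Lemma expi_neq0 x : expi x != 0 :> R[i].
Proof.
apply/eqP => h; have := cabs_expi x; rewrite h cabs0 => /esym/eqP.
by rewrite oner_eq0.
Qed.

Lemma expiN x : expi (- x) = (expi x)^-1 :> R[i].
Proof.
by apply: (mulfI (expi_neq0 x)); rewrite -expiD subrr expi0 mulfV ?expi_neq0.
Qed.

Lemma expiMn x n : expi (x * n%:R) = expi x ^+ n :> R[i].
Proof.
elim: n => [|n IH]; first by rewrite mulr0 expi0 expr0.
by rewrite -natr1 mulrDr mulr1 expiD IH exprSr.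
Qed.

Lemma RexM x z : complex.Re (x%:C * z) = x * complex.Re z.
Proof. by case: z => a b /=; rewrite mul0r subr0. Qed.

Lemma ImxM x z : complex.Im (x%:C * z) = x * complex.Im z.
Proof. by case: z => a b /=; rewrite mul0r addr0. Qed.

Lemma ReD z w : complex.Re (z + w) = complex.Re z + complex.Re w.
Proof. by case: z w => [a b] [c d]. Qed.

Lemma ImD z w : complex.Im (z + w) = complex.Im z + complex.Im w.
Proof. by case: z w => [a b] [c d]. Qed.

Lemma Re_sum (I : Type) (r : seq I) (P : pred I) (F : I -> R[i]) :
  complex.Re (\sum_(i <- r | P i) F i) = \sum_(i <- r | P i) complex.Re (F i).
Proof. by apply: (big_morph _ ReD). Qed.

Lemma Im_sum (I : Type) (r : seq I) (P : pred I) (F : I -> R[i]) :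
  complex.Im (\sum_(i <- r | P i) F i) = \sum_(i <- r | P i) complex.Im (F i).
Proof. by apply: (big_morph _ ImD). Qed.

Lemma cplx_eq z w : complex.Re z = complex.Re w -> complex.Im z = complex.Im w ->
  z = w.
Proof. by case: z w => [a b] [c d] /= -> ->. Qed.

End ComplexBasics.

(** * The Dirichlet kernel and its antiderivative *)

Section Kernel.
Local Open Scope classical_set_scope.
Variable R : realType.
Implicit Types (x y u : R) (n r : nat).

Definition dirichlet n y : R :=
  1 + 2 * \sum_(1 <= r < n.+1) cos (2 * pi * r%:R * y).

(** The sum is a partial Fourier sum of floor y + 1/2 - y, so that the whole
    tends to floor y + 1/2 off the integers. *)
Definition dirichlet_prim n y : R :=
  y + \sum_(1 <= r < n.+1) sin (2 * pi * r%:R * y) / (pi * r%:R).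

Lemma pi_neq0 : pi != 0 :> R. Proof. by rewrite gt_eqF ?pi_gt0. Qed.

Lemma dirichletS n y :
  dirichlet n.+1 y = dirichlet n y + 2 * cos (2 * pi * n.+1%:R * y).
Proof. by rewrite /dirichlet big_nat_recr //= mulrDr addrA. Qed.

Lemma dirichlet_primS n y : dirichlet_prim n.+1 y =
  dirichlet_prim n y + sin (2 * pi * n.+1%:R * y) / (pi * n.+1%:R).
Proof. by rewrite /dirichlet_prim big_nat_recr //= addrA. Qed.

Lemma dirichlet0 y : dirichlet 0 y = 1.
Proof. by rewrite /dirichlet big_geq // mulr0 addr0. Qed.

Lemma dirichlet_prim0 y : dirichlet_prim 0 y = y.
Proof. by rewrite /dirichlet_prim big_geq // addr0. Qed.

Lemma is_derive_dirichlet_prim n y :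
  is_derive y 1 (dirichlet_prim n) (dirichlet n y).
Proof.
elim: n => [|n IH].
  rewrite dirichlet0; have -> : dirichlet_prim 0 = id.
    by apply/funext => z; rewrite dirichlet_prim0.
  exact: is_derive_id.
have -> : dirichlet_prim n.+1 = (fun y => dirichlet_prim n y +
    sin (2 * pi * n.+1%:R * y) / (pi * n.+1%:R)).
  by apply/funext => z; rewrite dirichlet_primS.
rewrite dirichletS; apply: is_deriveD.
apply: is_derive_eq.
rewrite /GRing.scale /=; set c := cos _; have := pi_neq0.
rewrite -natr1; move: (pi) => p p0; have : n%:R + 1 != 0 :> R.
  by rewrite natr1 pnatr_eq0.
by move=> n0; field; apply/andP.
Qed.

(** Written as a product, the closed form of the kernel also holds at the
    integers. *)
Lemma sin_dirichlet n y :
  sin (pi * y) * dirichlet n y = sin ((2 * n%:R + 1) * (pi * y)).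
Proof.
elim: n => [|n IH]; first by rewrite dirichlet0 mulr0 add0r mul1r mulr1.
rewrite dirichletS mulrDr IH; set s := pi * y.
have -> : 2 * pi * n.+1%:R * y = (2 * n%:R + 2) * s.
  by rewrite /s -natr1; ring.
have -> : (2 * n%:R + 1) * s = (2 * n%:R + 2) * s - s by ring.
have -> : (2 * n.+1%:R + 1) * s = (2 * n%:R + 2) * s + s.
  by rewrite -natr1; ring.
by rewrite sinB sinD; ring.
Qed.

Lemma dirichlet_primN n y : dirichlet_prim n (- y) = - dirichlet_prim n y.
Proof.
elim: n => [|n IH]; first by rewrite !dirichlet_prim0.
by rewrite !dirichlet_primS IH (mulrN (2 * pi * _)) sinN mulNr [RHS]opprD.
Qed.

Lemma cos_2pin k (x : R) : cos (x + 2 * pi * k%:R) = cos x.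
Proof.
have -> : 2 * pi * k%:R = (pi *+ 2 *+ k) :> R.
  by rewrite -[RHS]mulr_natr -[pi *+ 2]mulr_natr; ring.
exact: (periodicn (@cosD2pi R)).
Qed.

Lemma sin_2pin k (x : R) : sin (x + 2 * pi * k%:R) = sin x.
Proof.
have -> : 2 * pi * k%:R = (pi *+ 2 *+ k) :> R.
  by rewrite -[RHS]mulr_natr -[pi *+ 2]mulr_natr; ring.
exact: (periodicn (@sinD2pi R)).
Qed.

Lemma cos_2piz (k : int) (x : R) : cos (x + 2 * pi * k%:~R) = cos x.
Proof.
case: k => k; first exact: cos_2pin.
by rewrite NegzE mulrNz mulrN -[LHS](cos_2pin k.+1) subrK.
Qed.

Lemma sin_2piz (k : int) (x : R) : sin (x + 2 * pi * k%:~R) = sin x.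
Proof.
case: k => k; first exact: sin_2pin.
by rewrite NegzE mulrNz mulrN -[LHS](sin_2pin k.+1) subrK.
Qed.

Lemma dirichlet_primDz n (k : int) y :
  dirichlet_prim n (y + k%:~R) = dirichlet_prim n y + k%:~R.
Proof.
elim: n => [|n IH]; first by rewrite !dirichlet_prim0.
rewrite !dirichlet_primS IH.
have -> : 2 * pi * n.+1%:R * (y + k%:~R)
    = 2 * pi * n.+1%:R * y + 2 * pi * (n.+1%:Z * k)%:~R.
  by rewrite intrM mulrDr; congr (_ + _); rewrite !mulrA.
by rewrite sin_2piz; ring.
Qed.

Lemma dirichlet_prim_half n : dirichlet_prim n 2^-1 = 2^-1.
Proof.
elim: n => [|n IH]; first by rewrite !dirichlet_prim0.
rewrite dirichlet_primS IH.
have -> : 2 * pi * n.+1%:R * 2^-1 = 0 + pi *+ n.+1 :> R.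
  by rewrite add0r -mulr_natr; field.
rewrite (alternatingn (@sinDpi R)) sin0 mulr0 mul0r addr0 //.
Qed.

(** A crude bound for |y| <= 1 / (2 n + 1), where it gives 1. Further from 0,
    [dirichlet_prim_tail] takes over. *)
Lemma dirichlet_prim_near0 n y : `|dirichlet_prim n y| <= (2 * n%:R + 1) * `|y|.
Proof.
have sinle (x : R) : `|sin x| <= `|x|.
  have key (z : R) : 0 <= z -> `|sin z| <= z.
    rewrite le_eqVlt => /predU1P[<-|z0]; first by rewrite sin0 normr0.
    have [w _ ] := @MVT R sin cos 0 z z0 (fun x _ => is_derive_sin x)
      (continuous_subspaceT (@continuous_sin R)).
    rewrite sin0 !subr0 => ->; rewrite normrM (gtr0_norm z0).
    by rewrite ler_piMl ?cos_max // ltW.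
  have [/key h|/ltW x0] := lerP 0 x; first by rewrite (le_trans h) ?ler_norm.
  by rewrite -normrN -sinN -[leRHS]normrN (le_trans (key _ _)) ?ler_norm ?oppr_ge0.
elim: n => [|n IH]; first by rewrite !dirichlet_prim0 mulr0 add0r mul1r.
rewrite dirichlet_primS (le_trans (ler_normD _ _)) //.
have h : `|sin (2 * pi * n.+1%:R * y) / (pi * n.+1%:R)| <= 2 * `|y|.
  have p0 : 0 < pi * n.+1%:R :> R by rewrite mulr_gt0 ?pi_gt0 ?ltr0n.
  rewrite normrM normfV (gtr0_norm p0) ler_pdivrMr // (le_trans (sinle _)) //.
  rewrite -(mulrA 2) normrM normrM (gtr0_norm p0) (@ger0_norm _ 2) //.
  by rewrite mulrAC.
rewrite (le_trans (lerD IH h)) // -natr1; lra.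
Qed.

Lemma derive_ge0_le (f f' : R -> R) (a b : R) : a <= b ->
  (forall x, a <= x <= b -> is_derive x 1 f (f' x)) ->
  (forall x, a <= x <= b -> 0 <= f' x) -> f a <= f b.
Proof.
move=> ab df f'0; rewrite -subr_ge0.
have [||c + ->] := @MVT_segment R f f' a b ab.
- by move=> x /andP[ax xb]; apply: df; rewrite !ltW.
- apply: derivable_within_continuous => x; rewrite in_itv /= => xab.
  by have [] := df x xab.
- by rewrite in_itv /= => acb; rewrite mulr_ge0 ?subr_ge0 // f'0.
Qed.

Lemma is_derive_invf (f : R -> R) (x df : R) : f x != 0 ->
  is_derive x 1 f df -> is_derive x 1 (fun y => (f y)^-1) (- (f x) ^- 2 * df).
Proof.
move=> f0 fdf; have dx : derivable f x 1 by [].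
by apply: (DeriveDef (derivableV f0 dx)); rewrite (deriveV f0 dx) derive_val.
Qed.

(** Jordan's inequality: sin x / x decreases on (0, pi / 2]. *)
Lemma sin_ge_jordan (x : R) : 0 < x -> x <= pi / 2 -> 2 / pi * x <= sin x.
Proof.
move=> x0 xpi.
have sge (z : R) : 0 <= z -> z <= pi / 2 -> 0 <= sin z.
  move=> z0 zp; apply: sin_ge0_pi; rewrite z0 (le_trans zp) //.
  by rewrite ler_pdivrMr // ler_peMr ?pi_ge0 // ler1n.
have h1 (z : R) : 0 <= z -> z <= pi / 2 -> 0 <= sin z - z * cos z.
  move=> z0 zp; have := @derive_ge0_le (fun z => sin z - z * cos z)
    (fun z => z * sin z) 0 z z0.
  rewrite sin0 mul0r subr0; apply.
    move=> w _; apply: is_derive_eq; rewrite /GRing.scale /=; ring.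
  by move=> w /andP[w0 wz]; rewrite mulr_ge0 // sge // (le_trans wz).
have := @derive_ge0_le (fun z => - (sin z / z))
  (fun z => (sin z - z * cos z) / z ^+ 2) x (pi / 2) xpi.
rewrite lerNl opprK sin_pihalf mul1r invf_div => h.
rewrite -ler_pdivlMr //; apply: h.
  move=> w /andP[w0 wp]; have w1 : w != 0 by rewrite gt_eqF // (lt_le_trans x0).
  have dV := @is_derive_invf id w 1 w1 (is_derive_id w 1).
  by apply: is_derive_eq; rewrite /GRing.scale /=; field.
move=> w /andP[w0 wp]; have w1 : 0 <= w by rewrite (le_trans (ltW x0)).
by rewrite divr_ge0 ?exprn_ge0 // h1.
Qed.

(** Let c = (2 n + 1) pi and g z = 1 / (c sin (pi z)). Adding cos (c z) g z to
    the difference cancels the oscillating main term: the sum r has derivative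
    g' z cos (c z), whereas g' <= 0, so that r - g and - (r + g) increase. Both
    are compared with their values at 1/2, where the difference vanishes. *)
Lemma dirichlet_prim_tail n y : 0 < y -> y <= 2^-1 ->
  `|dirichlet_prim n y - 2^-1| <= 2 / ((2 * n%:R + 1) * pi * sin (pi * y)).
Proof.
move=> y0 y2; set c := (2 * n%:R + 1) * pi.
have c0 : 0 < c by rewrite mulr_gt0 ?pi_gt0 // ltr_wpDl // mulr_ge0.
have s0 z : y <= z <= 2^-1 -> 0 < sin (pi * z).
  move=> /andP[yz z2]; apply: sin_gt0_pi.
  rewrite mulr_gt0 ?pi_gt0 ?(lt_le_trans y0) //= gtr_pMr ?pi_gt0 //.
  by rewrite (le_lt_trans z2) // invf_lt1 // ltr1n.
have co0 z : y <= z <= 2^-1 -> 0 <= cos (pi * z).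
  move=> /andP[yz z2]; apply: cos_ge0_pihalf.
  have pz : 0 <= pi * z by rewrite mulr_ge0 ?pi_ge0 ?(le_trans (ltW y0)).
  rewrite (le_trans _ pz) ?oppr_le0 ?divr_ge0 ?pi_ge0 //=.
  by rewrite ler_wpM2l ?pi_ge0.
pose g z : R := 1 / (c * sin (pi * z)).
pose r z : R := dirichlet_prim n z - 2^-1 + cos (c * z) * g z.
have dg z : y <= z <= 2^-1 ->
    is_derive z 1 g (- (pi * cos (pi * z) / (c * sin (pi * z) ^+ 2))).
  move=> hz; have sz := s0 _ hz.
  have cs : c * sin (pi * z) != 0 by rewrite mulf_neq0 ?gt_eqF.
  have dV : is_derive z 1 (fun z => (c * sin (pi * z))^-1)
      (- (c * sin (pi * z)) ^- 2 * (c * (pi * cos (pi * z)))).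
    apply: is_derive_invf => //; apply: is_derive_eq.
    by rewrite /GRing.scale /=; ring.
  have -> : g = (fun z => (c * sin (pi * z))^-1) by apply/funext => w; rewrite /g mul1r.
  apply: is_derive_eq.
  by field; rewrite !gt_eqF.
have dr z : y <= z <= 2^-1 ->
    is_derive z 1 r (- (pi * cos (pi * z) / (c * sin (pi * z) ^+ 2)) * cos (c * z)).
  move=> hz; have sz := s0 _ hz; have dgz := dg _ hz.
  have dB := is_derive_dirichlet_prim n z.
  rewrite /r; apply: is_derive_eq; rewrite /GRing.scale /=.
  have -> : dirichlet n z = sin (c * z) / sin (pi * z).
    apply: (mulfI (lt0r_neq0 sz)); rewrite sin_dirichlet [RHS]mulrC divfK ?gt_eqF //.
    by rewrite /c mulrA.
  rewrite /g; by field; rewrite !gt_eqF.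
have g'0 z : y <= z <= 2^-1 -> 0 <= pi * cos (pi * z) / (c * sin (pi * z) ^+ 2).
  move=> hz; apply: divr_ge0; apply: mulr_ge0; rewrite ?pi_ge0 ?co0 ?(ltW c0) //.
  by rewrite exprn_ge0 // ltW // s0.
have hi : r y - g y <= r 2^-1 - g 2^-1.
  apply: (@derive_ge0_le (fun z => r z - g z) (fun z =>
    pi * cos (pi * z) / (c * sin (pi * z) ^+ 2) * (1 - cos (c * z)))) => // z hz.
    have := dr _ hz; have := dg _ hz => dgz drz.
    by apply: is_derive_eq; ring.
  by rewrite mulr_ge0 ?g'0 // subr_ge0 cos_le1.
have lo : - (r y + g y) <= - (r 2^-1 + g 2^-1).
  apply: (@derive_ge0_le (fun z => - (r z + g z)) (fun z =>
    pi * cos (pi * z) / (c * sin (pi * z) ^+ 2) * (1 + cos (c * z)))) => // z hz.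
    have := dr _ hz; have := dg _ hz => dgz drz.
    by apply: is_derive_eq; ring.
  by rewrite mulr_ge0 ?g'0 // -lerBlDl sub0r cos_geN1.
have g0 z : y <= z <= 2^-1 -> 0 <= g z.
  by move=> hz; rewrite divr_ge0 // mulr_ge0 ?(ltW c0) // ltW // s0.
have hy : y <= y <= 2^-1 by rewrite lexx y2.
have h2 : is_true ((y <= 2^-1) && ((2^-1 : R) <= 2^-1)) by rewrite y2 lexx.
have r2 : r 2^-1 = cos (c * 2^-1) * g 2^-1.
  by rewrite /r dirichlet_prim_half subrr add0r.
have bnd (u w : R) : 0 <= w -> - w <= cos u * w <= w.
  move=> w0; have := cos_le1 u; have := cos_geN1 u; move: (cos u) => t *; nra.
have := bnd (c * 2^-1) _ (g0 _ h2); have := bnd (c * y) _ (g0 _ hy).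
rewrite -r2 => /andP[b1 b2] /andP[b3 b4].
rewrite -[2 in leRHS]mulr1 -mulrA -/(g y).
have ry : dirichlet_prim n y - 2^-1 = r y - cos (c * y) * g y.
  by rewrite /r addrK.
rewrite ry ler_norml; move: hi lo b1 b2 b3 b4.
move: (cos (c * y) * g y) (g y) (r y) (r 2^-1) (g 2^-1) => a1 a2 a3 a4 a5.
by move=> *; apply/andP; split; lra.
Qed.

(** The uniformity in n is what dominated convergence asks for. On [0, 1/2] the
    two previous bounds meet at 1 / (2 n + 1); parity and the shift rule
    [dirichlet_primDz] do the rest. *)
Lemma dirichlet_prim_bound n y : `|dirichlet_prim n y| <= `|y| + 3.
Proof.
have half (z : R) : 0 <= z -> z <= 2^-1 -> `|dirichlet_prim n z| <= 3 / 2.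
  move=> z0 z2; have n0 : 0 < 2 * n%:R + 1 :> R by rewrite ltr_wpDl // mulr_ge0.
  have [h|h] := lerP z (2 * n%:R + 1)^-1.
    rewrite (le_trans (dirichlet_prim_near0 _ _)) // ger0_norm //.
    rewrite (le_trans (ler_wpM2l (ltW n0) h)) // mulfV ?gt_eqF //; lra.
  have z0' : 0 < z by rewrite (lt_trans _ h) // invr_gt0.
  have := dirichlet_prim_tail n z0' z2.
  have p0 := pi_gt0 R; have := pi_ge2 R => pi2.
  have /(sin_ge_jordan (mulr_gt0 p0 z0')) : pi * z <= pi / 2 by rewrite ler_wpM2l ?pi_ge0.
  rewrite mulrA divfK ?gt_eqF // => sz h1.
  have s1 : 2 <= (2 * n%:R + 1) * pi * sin (pi * z).
    have h3 : 1 <= (2 * n%:R + 1) * z.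
      by rewrite -ler_pdivrMl // mulr1 ltW.
    have : (2 * n%:R + 1) * z * 2 * pi <= (2 * n%:R + 1) * pi * sin (pi * z).
      rewrite -!mulrA ler_wpM2l ?(ltW n0) //.
      have -> : z * (2 * pi) = pi * (2 * z) by ring.
      by rewrite ler_wpM2l ?pi_ge0.
    move=> h4; nra.
  have h5 : `|dirichlet_prim n z - 2^-1| <= 1.
    rewrite (le_trans h1) // ler_pdivrMr ?mul1r //.
    by rewrite (lt_le_trans _ s1).
  move: h5; rewrite !ler_norml => /andP[? ?]; apply/andP; split; lra.
have unit (z : R) : 0 <= z -> z <= 1 -> `|dirichlet_prim n z| <= 3.
  move=> z0 z1; have [/(half _ z0) h|h] := lerP z 2^-1; first by lra.
  have -> : z = - (1 - z) + 1%:~R by rewrite opprB subrK.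
  rewrite dirichlet_primDz dirichlet_primN.
  have := half (1 - z); rewrite subr_ge0 z1 => /(_ isT) h2.
  have /h2 : 1 - z <= 2^-1 by lra.
  by rewrite !ler_norml => /andP[? ?]; apply/andP; split; lra.
have key (z : R) : 0 <= z -> `|dirichlet_prim n z| <= z + 3.
  move=> z0; set k := Num.floor z.
  have -> : z = (z - k%:~R) + k%:~R by rewrite subrK.
  rewrite dirichlet_primDz.
  have /andP[k1 k2] := floor_itv z.
  have /unit h : 0 <= z - k%:~R by rewrite subr_ge0.
  have /h : z - k%:~R <= 1 by rewrite lerBlDl; move: k2; rewrite intrD => /ltW.
  have k0 : 0 <= k%:~R :> R by rewrite ler0z floor_ge0.
  move: k1; rewrite -/k => k1.
  by rewrite !ler_norml => /andP[? ?]; apply/andP; split; lra.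
have [y0|/ltW y0] := lerP 0 y; first by rewrite (le_trans (key _ y0)) // lerD2r ler_norm.
rewrite -normrN -dirichlet_primN (le_trans (key _ _)) ?oppr_ge0 //.
by rewrite lerD2r -normrN ler_norm.
Qed.

(** On (0, 1/2] the tail bound is O (1/n); reflection at 1/2 and integer shifts
    cover all other non-integers. *)
Lemma dirichlet_prim_cvg y : y != (Num.floor y)%:~R ->
  dirichlet_prim n y @[n --> \oo] --> ((Num.floor y)%:~R + 2^-1 : R).
Proof.
have half (z : R) : 0 < z -> z <= 2^-1 -> dirichlet_prim n z @[n --> \oo] --> (2^-1 : R).
  move=> z0 z2; have p0 := pi_gt0 R.
  have sz : 0 < sin (pi * z).
    have pz : pi * z <= pi / 2 by rewrite ler_wpM2l ?pi_ge0.
    rewrite (lt_le_trans _ (sin_ge_jordan (mulr_gt0 p0 z0) pz)) //.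
    by rewrite !mulr_gt0 ?invr_gt0.
  apply/cvgrPdist_le => /= e e0; near=> n.
  rewrite distrC (le_trans (dirichlet_prim_tail n z0 z2)) //.
  have n0 : 0 < 2 * n%:R + 1 :> R by rewrite ltr_wpDl // mulr_ge0.
  rewrite ler_pdivrMr ?mulr_gt0 //.
  have : 2 / (e * pi * sin (pi * z)) <= n%:R by near: n; exact: nbhs_infty_ger.
  rewrite ler_pdivrMr ?mulr_gt0 // => h.
  have : 0 < e * pi * sin (pi * z) by rewrite !mulr_gt0.
  have n1 : 0 <= n%:R :> R by [].
  move: h; rewrite !mulrA (mulrC e) -!mulrA; move: (e * _) => t; nra.
have unit (z : R) : 0 < z -> z < 1 -> dirichlet_prim n z @[n --> \oo] --> (2^-1 : R).
  move=> z0 z1; have [/(half _ z0) //|h] := lerP z 2^-1.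
  have -> : (fun n => dirichlet_prim n z) = (fun n => 1 - dirichlet_prim n (1 - z)).
    apply/funext => m; have := dirichlet_primDz m 1 (- (1 - z)).
    by rewrite dirichlet_primN opprB subrK addrC.
  have -> : 2^-1 = 1 - 2^-1 :> R by lra.
  apply: cvgB; first exact: cvg_cst.
  by apply: half; lra.
move=> yn; set k := Num.floor y.
have -> : (fun n => dirichlet_prim n y) = (fun n => dirichlet_prim n (y - k%:~R) + k%:~R).
  by apply/funext => n; rewrite -dirichlet_primDz subrK.
rewrite (addrC k%:~R); apply: cvgD; last exact: cvg_cst.
have /andP[k1 k2] := floor_itv y.
apply: unit; first by rewrite subr_gt0 lt_neqAle eq_sym yn.
by rewrite ltrBlDl; move: k2; rewrite intrD.
Unshelve. all: end_near. Qed.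

End Kernel.

(** * Real integrals: parts, primitives, dominated convergence *)

Section RealIntegration.
Local Open Scope classical_set_scope.
Variable R : realType.
Notation mu := (@lebesgue_measure R).

Lemma is_derive_continuous (F f : R -> R) :
  (forall x : R, is_derive x 1 F (f x)) -> continuous F.
Proof.
move=> dF x; apply: differentiable_continuous; apply/derivable1_diffP.
by have [] := dF x.
Qed.

Lemma is_derive_LRcontinuous (F f : R -> R) (a b : R) :
  (forall x : R, is_derive x 1 F (f x)) -> derivable_oo_LRcontinuous F a b.
Proof.
move=> dF; have cF := is_derive_continuous dF; split.
- by move=> x _; have [] := dF x.
- by apply: cvg_at_right_filter; exact: cF.
- by apply: cvg_at_left_filter; exact: cF.
Qed.

Lemma continuous_integrable_cc (f : R -> R) (a b : R) : continuous f ->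
  mu.-integrable `[a, b] (EFin \o f).
Proof.
move=> cf; apply: continuous_compact_integrable; first exact: segment_compact.
exact: continuous_subspaceT.
Qed.

Lemma Rint_parts (F f G g : R -> R) (a b : R) : a < b ->
  (forall x : R, is_derive x 1 F (f x)) -> continuous f ->
  (forall x : R, is_derive x 1 G (g x)) -> continuous g ->
  \int[mu]_(x in `[a, b]) (F x * g x) = (F b * G b - F a * G a) -
  \int[mu]_(x in `[a, b]) (f x * G x).
Proof.
move=> ab dF cf dG cg; apply: Rintegration_by_parts => //.
- exact: continuous_subspaceT.
- exact: is_derive_LRcontinuous dF.
- by move=> x _; rewrite derive1E derive_val.
- exact: continuous_subspaceT.
- exact: is_derive_LRcontinuous dG.
- by move=> x _; rewrite derive1E derive_val.
Qed.

Lemma Rint_FTC2 (F f : R -> R) (a b : R) : a <= b ->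
  (forall x : R, is_derive x 1 F (f x)) -> continuous f ->
  \int[mu]_(x in `[a, b]) f x = F b - F a.
Proof.
rewrite le_eqVlt => /predU1P[-> _ _|ab dF cf].
  by rewrite set_itv1 Rintegral_set1 subrr.
rewrite /Rintegral (@continuous_FTC2 _ f F) //=.
- exact: continuous_subspaceT.
- exact: is_derive_LRcontinuous dF.
- by move=> x _; rewrite derive1E derive_val.
Qed.

Lemma dominated_Rintegral (D : set R) (f_ : nat -> R -> R) (f g : R -> R) :
  measurable D -> (forall n, measurable_fun D (f_ n)) -> measurable_fun D f ->
  {ae mu, forall x, D x -> f_ n x @[n --> \oo] --> f x} ->
  mu.-integrable D (EFin \o g) ->
  (forall n x, D x -> `|f_ n x| <= g x) ->
  \int[mu]_(x in D) f_ n x @[n --> \oo] --> \int[mu]_(x in D) f x.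
Proof.
move=> mD mf_ mf f_f ig fg.
have ml n : measurable_fun D (EFin \o f_ n) by apply/measurable_EFinP.
have m2 : measurable_fun D (EFin \o f) by apply/measurable_EFinP.
have ae1 : {ae mu, forall x, D x ->
    (fun n => (EFin \o f_ n) x) @ \oo --> (EFin \o f) x}.
  move: f_f; apply: filterS; first exact: (ae_filter_ringOfSetsType mu).
  move=> x + Dx => /(_ Dx) cx.
  by apply: cvg_EFin => //; exact: nearW.
have ae2 : {ae mu, forall x n, D x -> (`|(EFin \o f_ n) x| <= (EFin \o g) x)%E}.
  by apply: aeW => x n Dx /=; rewrite lee_fin fg.
have [if_ _ cv] := @dominated_convergence _ _ R mu D mD (fun n => EFin \o f_ n) (EFin \o f) (EFin \o g) ml m2 ae1 ig ae2.
by apply: fine_cvg; rewrite fineK; last exact: integrable_fin_num.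
Qed.

(** A unit jump at c only keeps the part of [a, b] to the right of c; min and
    max clip c to the interval. *)
Lemma Rint_step (F f : R -> R) (a b c : R) : a <= b ->
  (forall x : R, is_derive x 1 F (f x)) -> continuous f ->
  \int[mu]_(x in `[a, b]) (f x * (c <= x)%R%:R) = F b - F (Num.min b (Num.max a c)).
Proof.
move=> ab dF cf; set d := Num.min _ _.
have ad : a <= d by rewrite le_min ab le_max lexx.
have db : d <= b by rewrite ge_min lexx.
transitivity (\int[mu]_(x in `[a, b] `&` `[c, +oo[) f x).
  rewrite Rintegral_mkcondr; apply: eq_Rintegral => x _; rewrite patchE.
  rewrite mem_setE in_itv /= andbT; case: ifP => _; rewrite ?mulr1 ?mulr0 //.
have [bc|cb] := ltP b c.
  have -> : d = b by rewrite /d max_r ?(le_trans ab) ?min_l // ltW.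
  rewrite subrr (_ : _ `&` _ = set0) ?Rintegral_set0 // -subset0 => x /=.
  rewrite !in_itv /= andbT => -[/andP[_ xb] cx].
  by move: (lt_le_trans bc cx); rewrite ltNge xb.
have dE : d = Num.max a c by rewrite /d min_r // ge_max ab.
rewrite -(Rint_FTC2 db dF cf) dE; congr Rintegral.
rewrite eqEsubset; split => x /=; rewrite !in_itv /= andbT ge_max.
  by move=> [/andP[-> ->] ->].
by move=> /andP[/andP[-> ->] ->].
Qed.

End RealIntegration.

(** * Dirichlet integrals over an interval *)

Section KernelIntegral.
Local Open Scope classical_set_scope.
Variable R : realType.
Notation mu := (@lebesgue_measure R).

Lemma continuous_dirichlet n : continuous (@dirichlet R n).
Proof.
elim: n => [|n IH] x.
  have -> : @dirichlet R 0 = cst 1 by apply/funext => z; rewrite dirichlet0.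
  exact: cvg_cst.
have -> : @dirichlet R n.+1 =
    (fun y => dirichlet n y + 2 * cos (2 * pi * n.+1%:R * y)).
  by apply/funext => z; rewrite dirichletS.
apply: cvgD; first exact: IH.
apply: cvgM; first exact: cvg_cst.
apply: continuous_comp; last exact: continuous_cos.
by apply: cvgM; [exact: cvg_cst | exact: cvg_id].
Qed.

Lemma measure_cc (p q : R) : p <= q -> mu `[p, q] = (q - p)%:E.
Proof.
move=> pq; transitivity (if (p%:E < q%:E)%E then (q%:E - p%:E)%E else 0%E).
  exact: (lebesgue_measure_itv `[p, q]%R).
by rewrite lte_fin; case: ltgtP pq => // -> _; rewrite subrr.
Qed.

Lemma Rintegral_bound (f : R -> R) (C p q : R) : p <= q -> continuous f ->
  (forall x, p <= x <= q -> `|f x| <= C) ->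
  `|\int[mu]_(x in `[p, q]) f x| <= C * (q - p).
Proof.
move=> pq cf fC; have fi := continuous_integrable_cc p q cf.
rewrite (le_trans (le_normr_Rintegral _ fi)) //.
have -> : C * (q - p) = \int[mu]_(x in `[p, q]) C.
  rewrite Rintegral_cst //; congr (_ * _); rewrite -[LHS]/(fine (q - p)%:E).
  by congr fine; exact/esym/measure_cc.
apply: le_Rintegral => //.
- exact: (integrable_norm fi).
- by apply: continuous_integrable_cc => x; exact: cvg_cst.
Qed.

Variables (h h' : R -> R) (H H' : R).
Hypothesis dh : forall x : R, is_derive x 1 h (h' x).
Hypothesis ch' : continuous h'.
Hypothesis hH : forall x, `|h x| <= H.
Hypothesis hH' : forall x, `|h' x| <= H'.

Let ch : continuous h := is_derive_continuous dh.
Let cB n : continuous (@dirichlet_prim R n) :=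
  is_derive_continuous (@is_derive_dirichlet_prim R n).

Lemma continuousM_fun (f g : R -> R) : continuous f -> continuous g ->
  continuous (fun x => f x * g x).
Proof. by move=> cf cg x; apply: cvgM; [exact: cf | exact: cg]. Qed.

(** Trades the kernels, which are unbounded in n, for their antiderivatives,
    which are not. *)
Lemma kernel_int_parts n (p q : R) : p <= q ->
  \int[mu]_(x in `[p, q]) (h x * dirichlet n x) =
  (h q * dirichlet_prim n q - h p * dirichlet_prim n p) -
  \int[mu]_(x in `[p, q]) (h' x * dirichlet_prim n x).
Proof.
rewrite le_eqVlt => /predU1P[->|pq].
  by rewrite set_itv1 !Rintegral_set1 !subrr.
apply: Rint_parts => // x; [exact: is_derive_dirichlet_prim|exact: continuous_dirichlet].
Qed.

(** As the bound depends neither on n nor on the interval inside [-L, L], it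
    dominates the integrals over all superlevel sets of a function at once. *)
Lemma kernel_int_bound n (L p q : R) : - L <= p -> p <= q -> q <= L ->
  `|\int[mu]_(x in `[p, q]) (h x * dirichlet n x)|
    <= 2 * H * (L + 3) + 2 * L * (H' * (L + 3)).
Proof.
move=> Lp pq qL; rewrite kernel_int_parts //.
have H0 : 0 <= H by rewrite (le_trans _ (hH 0)).
have H'0 : 0 <= H' by rewrite (le_trans _ (hH' 0)).
have Bx x : - L <= x -> x <= L -> `|dirichlet_prim n x| <= L + 3.
  move=> Lx xL; rewrite (le_trans (dirichlet_prim_bound _ _)) // lerD2r.
  by rewrite ler_norml Lx.
have L3 : 0 <= L + 3 by have := Lp; have := qL; lra.
have b1 x : - L <= x -> x <= L -> `|h x * dirichlet_prim n x| <= H * (L + 3).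
  by move=> Lx xL; rewrite normrM ler_pM ?Bx.
have b2 : `|\int[mu]_(x in `[p, q]) (h' x * dirichlet_prim n x)|
    <= H' * (L + 3) * (q - p).
  apply: Rintegral_bound => // [|x /andP[px xq]].
    exact: continuousM_fun.
  by rewrite normrM ler_pM // Bx // ?(le_trans Lp) ?(le_trans _ qL).
have b3 : H' * (L + 3) * (q - p) <= H' * (L + 3) * (2 * L).
  by apply: ler_wpM2l; [rewrite mulr_ge0 | lra].
have bq : `|h q * dirichlet_prim n q| <= H * (L + 3) by rewrite b1 ?(le_trans Lp).
have bp : `|h p * dirichlet_prim n p| <= H * (L + 3) by rewrite b1 ?(le_trans pq).
rewrite (le_trans (ler_normB _ _)) // (le_trans (lerD (ler_normB _ _) b2)) //.
lra.
Qed.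

(** The limit floor y + 1/2 of [dirichlet_prim] on [-L, L], as a sum of unit
    jumps that can be integrated one at a time. *)
Definition steps (L : nat) (y : R) : R :=
  2^-1 - L%:R + \sum_(1 <= i < (2 * L).+1) (i%:R - L%:R <= y)%R%:R.

Lemma steps_floor (L : nat) (y : R) : - L%:R <= y -> y <= L%:R ->
  y != (Num.floor y)%:~R -> steps L y = (Num.floor y)%:~R + 2^-1.
Proof.
move=> Ly yL yn; rewrite /steps.
have sm k N : (\sum_(1 <= i < N.+1) (i <= k)%N)%N = minn N k.
  elim: N => [|N IH]; first by rewrite big_geq // min0n.
  by rewrite big_nat_recr //= IH; case: leqP; lia.
have k0 : 0 <= Num.floor y + L%:Z.
  have : - L%:Z <= Num.floor y by rewrite floor_ge_int mulrNz.
  lia.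
case E : (Num.floor y + L%:Z) k0 => [k|k] // _.
have kE : Num.floor y = k%:Z - L%:Z by rewrite -E addrK.
have kL : (k <= 2 * L)%N.
  have : Num.floor y <= L%:Z by rewrite -(ler_int R) (le_trans (ge_floor _)).
  by rewrite kE; lia.
have -> : \sum_(1 <= i < (2 * L).+1) (i%:R - L%:R <= y)%R%:R = k%:R :> R.
  rewrite -[in RHS](minn_idPr kL) -sm natr_sum; apply: eq_bigr => i _.
  congr (nat_of_bool _)%:R.
  have -> : i%:R - L%:R = (i%:Z - L%:Z)%:~R :> R by rewrite intrB.
  by rewrite -floor_ge_int kE; lia.
by rewrite kE intrB; ring.
Qed.

Lemma measurable_step (c : R) D : measurable_fun D (fun y : R => (c <= y)%R%:R : R).
Proof.
have -> : (fun y : R => (c <= y)%R%:R) = \1_(`[c, +oo[) :> (R -> R).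
  by apply/funext => y; rewrite indicE mem_setE in_itv /= andbT.
apply: measurable_indic; exact: measurable_itv.
Qed.

Lemma measurable_steps L D : measurable_fun D (steps L).
Proof.
apply: measurable_funD; first exact: measurable_cst.
apply: (@measurable_sum _ _ R D nat (index_iota 1 (2 * L).+1)
  (fun i (y : R) => ((i%:R - L%:R <= y)%R%:R : R))) => i.
exact: measurable_step.
Qed.

Lemma ae_nonint : {ae mu, forall x : R, x != (Num.floor x)%:~R}.
Proof.
exists (range (fun k : int => (k%:~R : R))); split.
- apply: countable_measurable; first exact: measurable_set1.
  exact: (sub_countable (card_image_le _ _) (countableP _)).
- apply: countable_lebesgue_measure0.
  exact: (sub_countable (card_image_le _ _) (countableP _)).
- move=> x /= /negP; rewrite negbK => /eqP ->; by exists (Num.floor x).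
Qed.

(** After integration by parts the antiderivatives of the kernels converge
    boundedly to [steps]; integrating the jumps of [steps] back by parts leaves
    the values of h at the integers between p and q. At an integer endpoint
    only half of the value would appear, so p and q avoid the integers. *)
Lemma kernel_int_cvg (L : nat) (p q : R) : - L%:R <= p -> p <= q -> q <= L%:R ->
  p != (Num.floor p)%:~R -> q != (Num.floor q)%:~R ->
  \int[mu]_(x in `[p, q]) (h x * dirichlet n x) @[n --> \oo] -->
  \sum_(1 <= i < (2 * L).+1)
    h (i%:R - L%:R) * (p < i%:R - L%:R < q)%R%:R.
Proof.
move=> Lp pq qL pn qn.
have cvB x : - L%:R <= x -> x <= L%:R -> x != (Num.floor x)%:~R ->
    dirichlet_prim n x @[n --> \oo] --> steps L x.
  by move=> *; rewrite steps_floor //; exact: dirichlet_prim_cvg.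
have H'0 : 0 <= H' by rewrite (le_trans _ (hH' 0)).
have ci : \int[mu]_(x in `[p, q]) (h' x * dirichlet_prim n x) @[n --> \oo] -->
    \int[mu]_(x in `[p, q]) (h' x * steps L x).
  apply: (@dominated_Rintegral _ _ _ _ (fun=> H' * (L%:R + 3))) => //.
  - move=> n; apply: measurable_funTS; apply: continuous_measurable_fun.
    exact: continuousM_fun.
  - apply: measurable_funM; last exact: measurable_steps.
    by apply: measurable_funTS; apply: continuous_measurable_fun.
  - have := ae_nonint; apply: filterS; first exact: (ae_filter_ringOfSetsType mu).
    move=> x xn /=; rewrite in_itv /= => /andP[px xq].
    apply: cvgM; first exact: cvg_cst.
    by apply: cvB => //; [exact: le_trans px | exact: le_trans qL].
  - by apply: continuous_integrable_cc => x; exact: cvg_cst.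
  - move=> n x /=; rewrite in_itv /= => /andP[px xq].
    rewrite normrM ler_pM // (le_trans (dirichlet_prim_bound _ _)) // lerD2r.
    by rewrite ler_norml (le_trans Lp) // (le_trans xq).
have -> : \sum_(1 <= i < (2 * L).+1) h (i%:R - L%:R) * (p < i%:R - L%:R < q)%R%:R =
    (h q * steps L q - h p * steps L p) -
    \int[mu]_(x in `[p, q]) (h' x * steps L x).
  have -> : \int[mu]_(x in `[p, q]) (h' x * steps L x) =
      (2^-1 - L%:R) * (h q - h p) +
      \sum_(1 <= i < (2 * L).+1)
         (h q - h (Num.min q (Num.max p (i%:R - L%:R)))).
    have ist (c : R) : mu.-integrable `[p, q] (EFin \o (fun x => h' x * (c <= x)%R%:R)).
      apply: (@le_integrable _ _ R mu `[p, q]%classic _ _ (EFin \o (fun=> H'))) => //.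
      - apply/measurable_EFinP; apply: measurable_funM.
          by apply: measurable_funTS; apply: continuous_measurable_fun.
        exact: measurable_step.
      - move=> x _ /=; rewrite lee_fin normrM (ger0_norm H'0).
        by rewrite (le_trans _ (hH' x)) // ler_piMr //; case: (c <= x); rewrite ?normr1 ?normr0.
      - by apply: continuous_integrable_cc => x; exact: cvg_cst.
    have isum N : mu.-integrable `[p, q] (EFin \o (fun x =>
        h' x * \sum_(1 <= i < N.+1) (i%:R - L%:R <= x)%R%:R)) /\
      \int[mu]_(x in `[p, q]) (h' x * \sum_(1 <= i < N.+1) (i%:R - L%:R <= x)%R%:R)
      = \sum_(1 <= i < N.+1) (h q - h (Num.min q (Num.max p (i%:R - L%:R)))).
      elim: N => [|N [iN IH]].
        have -> : (fun x => h' x * \sum_(1 <= i < 1) (i%:R - L%:R <= x)%R%:R) = (fun=> 0).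
          by apply/funext => x; rewrite big_geq // mulr0.
        rewrite big_geq //.
        split; first by apply: continuous_integrable_cc => x; exact: cvg_cst.
        by rewrite Rintegral_cst // mul0r.
      have -> : (fun x => h' x * \sum_(1 <= i < N.+2) (i%:R - L%:R <= x)%R%:R) =
        (fun x => h' x * (\sum_(1 <= i < N.+1) (i%:R - L%:R <= x)%R%:R) +
           h' x * (N.+1%:R - L%:R <= x)%R%:R).
        by apply/funext => x; rewrite big_nat_recr //= mulrDr.
      split; first exact: (integrableD _ iN (ist (N.+1%:R - L%:R))).
      by rewrite RintegralD // IH (Rint_step _ pq dh ch') [RHS]big_nat_recr.
    rewrite /steps.
    under eq_Rintegral do rewrite mulrDr.
    have [i2L e2L] := isum (2 * L)%N.
    rewrite RintegralD //; last first.
      by apply: continuous_integrable_cc; apply: continuousM_fun => // x; exact: cvg_cst.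
    rewrite e2L; congr (_ + _).
    rewrite RintegralZr //; last exact: continuous_integrable_cc.
    by rewrite (Rint_FTC2 pq dh ch') mulrC.
  have nonint (x : R) (i : nat) : x != (Num.floor x)%:~R -> x != i%:R - L%:R.
    apply: contra_neq => ->.
    have -> : i%:R - L%:R = (i%:Z - L%:Z)%:~R :> R by rewrite intrB.
    by rewrite intrKfloor.
  set A := 2^-1 - L%:R.
  have -> : forall S T U : R, h q * (A + S) - h p * (A + T) - (A * (h q - h p) + U) =
     h q * S - h p * T - U by move=> *; ring.
  rewrite !mulr_sumr -!sumrB; apply: eq_bigr => i _.
  have := nonint _ i pn; have := nonint _ i qn; set c := i%:R - L%:R.
  have [pc|cp|->] := ltgtP p c; have [qc|cq|->] := ltgtP q c;
    rewrite ?eqxx // => _ _.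
  all: rewrite ?(max_r (ltW pc)) ?(max_l (ltW cp)) ?(min_l (ltW qc)) ?(min_r (ltW cq)) ?(min_r pq) /=.
  all: try ring.
  by move: (lt_trans qc cp); rewrite ltNge pq.
under eq_fun do rewrite kernel_int_parts //.
by apply: cvgB ci; apply: cvgB; apply: cvgM; (try exact: cvg_cst);
  apply: cvB => //; [exact: le_trans pq | exact: le_trans qL].
Qed.

End KernelIntegral.

(** * Integration over levels *)

Section LayerCake.
Local Open Scope classical_set_scope.
Variable R : realType.
Notation mu := (@lebesgue_measure R).

Lemma measure_oo (p q : R) : p <= q -> mu `]p, q[ = (q - p)%:E.
Proof.
move=> pq; transitivity (if (p%:E < q%:E)%E then (q%:E - p%:E)%E else 0%E).
  exact: (lebesgue_measure_itv `]p, q[%R).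
by rewrite lte_fin; case: ltgtP pq => // -> _; rewrite subrr.
Qed.

Lemma continuous_integrable_supp (g : R -> R) (L : R) : continuous g ->
  (forall y, L <= `|y| -> g y = 0) -> mu.-integrable setT (EFin \o g).
Proof.
move=> cg g0; have -> : EFin \o g = (EFin \o g) \_ `[- L, L].
  apply/funext => y; rewrite patchE mem_setE in_itv /= -ler_norml.
  by case: lerP => // /ltW/g0 /= ->.
by apply/integrable_restrict => //; rewrite setTI; exact: continuous_integrable_cc.
Qed.

Lemma integral_height (c r : R) : 0 <= r ->
  (\int[mu]_u (c * (0 < u < r)%R%:R)%:E)%E = (c * r)%:E.
Proof.
move=> r0.
have -> : (fun u : R => (c * (0 < u < r)%R%:R)%:E) =
    (fun u => (c%:E * (\1_(`]0, r[) u)%:E)%E).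
  by apply/funext => u; rewrite indicE mem_setE in_itv /= EFinM.
rewrite integralZl //; last first.
  exact: (@integrable_indic_itv R 0 r false true).
rewrite integral_indic // setIT EFinM; congr (_ * _)%E.
by rewrite -[in RHS](subr0 r); exact: measure_oo.
Qed.

Lemma measurable_fun_bool_nat d (T : measurableType d) (D : set T) (f : T -> bool) :
  measurable_fun D f -> measurable_fun D (fun x => (f x)%:R : R).
Proof.
move=> mf.
have -> : (fun x => (f x)%:R : R) = (fun b : bool => b%:R : R) \o f by [].
apply: measurableT_comp => //.
Qed.

Variables (phi k : R -> R) (L : R).
Hypothesis cphi : continuous phi.
Hypothesis phi0 : forall y, 0 <= phi y.
Hypothesis phiL : forall y, L <= `|y| -> phi y = 0.
Hypothesis ck : continuous k.

Let f (z : R * R) : \bar R := ((0 < z.2 < phi z.1)%R%:R * k z.1)%:E.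

Let mf : measurable_fun setT f.
Proof.
apply/measurable_EFinP; apply: measurable_funM; last first.
  apply: measurableT_comp; last exact: measurable_fst.
  exact: continuous_measurable_fun.
apply: measurable_fun_bool_nat; apply: measurable_and.
  by apply: measurable_fun_ltr; [exact: measurable_cst|exact: measurable_snd].
apply: measurable_fun_ltr; first exact: measurable_snd.
apply: measurableT_comp; last exact: measurable_fst.
exact: continuous_measurable_fun.
Qed.

Let cphik (g : R -> R) : continuous g -> continuous (fun y => phi y * g y).
Proof. by move=> cg; exact: continuousM_fun. Qed.

Let if_ : (mu \x mu)%E.-integrable setT f.
Proof.
apply/integrable12ltyP => //.
have -> : (\int[mu]_y \int[mu]_u `|f (y, u)| = \int[mu]_y (phi y * `|k y|)%:E)%E.
  apply: eq_integral => y _; rewrite mulrC -(integral_height `|k y| (phi0 y)).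
  apply: eq_integral => u _; rewrite /f /= mulrC normrM; congr (_ * _)%:E.
  by case: (_ && _); rewrite ?normr1 ?normr0.
have : mu.-integrable setT (EFin \o (fun y => phi y * `|k y|)).
  apply: (@continuous_integrable_supp _ L).
    apply: cphik => y; apply: cvg_norm; exact: ck.
  by move=> y /phiL ->; rewrite mul0r.
move=> /integrableP[_]; apply: le_lt_trans.
rewrite (_ : (\int[mu]_y (phi y * `|k y|)%:E)%E =
  (\int[mu]_y `|(EFin \o (fun y => phi y * `|k y|)%R) y|)%E) //.
by apply: eq_integral => y _ /=; rewrite (ger0_norm (mulr_ge0 _ _)).
Qed.

Let G u := \int[mu]_y ((0 < u < phi y)%R%:R * k y).

Let iG u : mu.-integrable setT (EFin \o (fun y => (0 < u < phi y)%R%:R * k y)).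
Proof.
apply: (@le_integrable _ _ R mu setT measurableT _
    (EFin \o (fun y => u^-1 * (phi y * `|k y|)))) => //.
- apply/measurable_EFinP; apply: measurable_funM; last exact: continuous_measurable_fun.
  apply: measurable_fun_bool_nat; apply: measurable_and; first exact: measurable_cst.
  by apply: measurable_fun_ltr => //; exact: continuous_measurable_fun.
- move=> y _; rewrite lee_fin /= !normrM normr_id.
  have [/andP[u0 up]|_] := boolP (0 < u < phi y); last first.
    by rewrite normr0 mul0r !mulr_ge0.
  rewrite normr1 mul1r mulrA ler_peMl // normfV (gtr0_norm u0).
  by rewrite mulrC ler_pdivlMr // mul1r (ger0_norm (phi0 y)) ltW.
- apply: (@continuous_integrable_supp _ L).
    move=> y; apply: cvgM; first exact: cvg_cst.
    by apply: cphik => {}y; apply: cvg_norm; exact: ck.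
  by move=> y /phiL ->; rewrite mul0r mulr0.
Qed.

Let GE u : fubini_G mu f u = (G u)%:E.
Proof.
rewrite /fubini_G /G /Rintegral fineK //.
exact: (integrable_fin_num measurableT (iG u)).
Qed.

Lemma measurable_layer : measurable_fun setT G.
Proof.
apply/measurable_EFinP.
have <- : fubini_G mu f = EFin \o G by apply/funext => u; exact: GE.
exact: measurable_fubini_G if_.
Qed.

(** Fubini applied to phi y = int 1[0 < u < phi y] du. The factor phi
    disappears in exchange for integrals of k alone over superlevel sets. *)
Lemma layer_cake : \int[mu]_y (phi y * k y) = \int[mu]_u G u.
Proof.
rewrite /Rintegral; congr fine.
transitivity (\int[mu]_u fubini_G mu f u)%E; last by apply: eq_integral => u _; rewrite GE.
rewrite -(Fubini if_); apply: eq_integral => y _.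
rewrite mulrC -(integral_height (k y) (phi0 y)).
by apply: eq_integral => u _; rewrite /f /= mulrC.
Qed.

End LayerCake.

(** * Dirichlet integrals of quasi-concave functions *)

Section DirichletJordan.
Local Open Scope classical_set_scope.
Variable R : realType.
Notation mu := (@lebesgue_measure R).

Variables (phi h h' : R -> R) (L : nat) (H H' : R).
Hypothesis cphi : continuous phi.
Hypothesis phi01 : forall y, 0 <= phi y <= 1.
Hypothesis phiL : forall y, L%:R <= `|y| -> phi y = 0.
Hypothesis phiqc : forall a y b, a <= y -> y <= b -> Num.min (phi a) (phi b) <= phi y.
Hypothesis dh : forall x : R, is_derive x 1 h (h' x).
Hypothesis ch' : continuous h'.
Hypothesis hH : forall x, `|h x| <= H.
Hypothesis hH' : forall x, `|h' x| <= H'.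

(** Quasi-concavity makes the superlevel set an interval and continuity makes it
    open. The values at the ends serve to show that an end is an integer for
    countably many levels u only. *)
Lemma level_set (u : R) : 0 < u ->
  [set y | u < phi y] = set0 \/
  exists p q : R, [/\ - L%:R <= p, p <= q, q <= L%:R,
    [set y | u < phi y] = `]p, q[%classic & phi p = u /\ phi q = u].
Proof.
move=> u0; set E := [set y | u < phi y].
have EL y : E y -> `|y| < L%:R.
  by rewrite /E /= => uy; rewrite ltNge; apply/negP => /phiL p0; move: uy; rewrite p0 ltNge (ltW u0).
have [->|/set0P[y0 Ey0]] := eqVneq E set0; [by left|right].
have oE : open E.
  rewrite /E (_ : [set y | u < phi y] = phi @^-1` [set x | u < x]) //.
  by apply: open_comp => // *; exact: cphi.
have iE : is_interval E.
  move=> a b Ea Eb y /andP[ay yb]; rewrite /E /=.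
  by rewrite (lt_le_trans _ (phiqc ay yb)) // lt_min Ea Eb.
have lE : has_lbound E by exists (- L%:R) => y /EL; rewrite ltr_norml => /andP[/ltW].
have uE : has_ubound E by exists L%:R => y /EL; rewrite ltr_norml => /andP[_ /ltW].
have hE : E = `]inf E, sup E[%classic.
  by rewrite -[LHS](interior_id _).1 // interval_bounded_interior.
have y0E : inf E < y0 < sup E by have := Ey0; rewrite {1}hE /= in_itv.
have nE p : ~ `]inf E, sup E[%classic p -> phi p <= u.
  by rewrite -hE /E /= => /negP; rewrite -leNgt.
have /andP[iy ys] := y0E.
exists (inf E), (sup E); split=> //.
- by apply: lb_le_inf; [exists y0 | move=> y /EL; rewrite ltr_norml => /andP[/ltW]].
- exact: ltW (lt_trans iy ys).
- by apply: ge_sup; [exists y0 | move=> y /EL; rewrite ltr_norml => /andP[_ /ltW]].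
- split; apply/le_anti; rewrite nE /= ?in_itv /= ?ltxx ?andbF //.
  + have : phi x @[x --> (inf E)^'+] --> phi (inf E).
      by apply: cvg_at_right_filter; exact: cphi.
    move/cvgr_to_ge; apply.
    near=> x; suff : E x by move/ltW.
    rewrite hE /= in_itv /=; apply/andP; split; first by near: x; exact: nbhs_right_gt.
    by near: x; apply: nbhs_right_lt; exact: lt_trans ys.
  + have : phi x @[x --> (sup E)^'-] --> phi (sup E).
      by apply: cvg_at_left_filter; exact: cphi.
    move/cvgr_to_ge; apply.
    near=> x; suff : E x by move/ltW.
    rewrite hE /= in_itv /=; apply/andP; split; last by near: x; exact: nbhs_left_lt.
    by near: x; apply: nbhs_left_gt; exact: lt_trans ys.
Unshelve. all: end_near. Qed.

Let G n (u : R) := \int[mu]_y ((0 < u < phi y)%R%:R * (h y * dirichlet n y)).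
Let B := 2 * H * (L%:R + 3) + 2 * L%:R * (H' * (L%:R + 3)).

Let G_out n u : ~~ (0 < u < 1) -> G n u = 0.
Proof.
move=> nu; rewrite /G -[RHS](mul0r (fine (mu setT))) -Rintegral_cst //.
apply: eq_Rintegral => y _; have /andP[_ p1] := phi01 y.
case: (boolP (0 < u < phi y)) => [/andP[u0 up]|_]; last by rewrite mul0r.
by move: nu; rewrite u0 (lt_le_trans up p1).
Qed.

Let G_in n u p q : 0 < u -> p <= q -> [set y | u < phi y] = `]p, q[ ->
  G n u = \int[mu]_(x in `[p, q]) (h x * dirichlet n x).
Proof.
move=> u0 pq E; have ck : continuous (fun x => h x * dirichlet n x).
  apply: continuousM_fun; [exact: is_derive_continuous dh|exact: continuous_dirichlet].
transitivity (\int[mu]_(x in `]p, q[) (h x * dirichlet n x)).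
  rewrite [RHS]Rintegral_mkcond; apply: eq_Rintegral => y _.
  rewrite patchE; have -> : (y \in `]p, q[%classic) = (u < phi y).
    by rewrite -E; apply/idP/idP; rewrite inE.
  by rewrite u0 /=; case: (u < phi y); rewrite ?mul1r ?mul0r.
have ico := continuous_integrable_cc p q ck.
rewrite Rintegral_itv_obnd_cbnd; last first.
  by apply: integrableS ico => //; exact: subset_itv_oo_cc.
rewrite Rintegral_itv_bndo_bndc //.
by apply: integrableS ico => //; exact: subset_itv_co_cc.
Qed.

Let G_bound n u : `|G n u| <= B * \1_(`]0, 1[) u.
Proof.
have H0 : 0 <= H by rewrite (le_trans _ (hH 0)).
have H'0 : 0 <= H' by rewrite (le_trans _ (hH' 0)).
have B0 : 0 <= B by rewrite addr_ge0 ?mulr_ge0 ?addr_ge0.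
rewrite indicE mem_setE in_itv /=.
have [/andP[u0 u1]|nu] := boolP (0 < u < 1); last by rewrite G_out // mulr0 normr0.
rewrite mulr1; have [E|[p [q [Lp pq qL E _]]]] := level_set u0.
  by rewrite (@G_in n u 0 0) // ?set_itv1 ?Rintegral_set1 ?normr0 // set_itvoo0.
by rewrite (G_in _ u0 pq E); exact: (kernel_int_bound dh ch' hH hH').
Qed.

(** Level by level. If an end of the interval {phi > u} is an integer k, then
    u = phi k, which happens for countably many u. For all others
    [kernel_int_cvg] gives the limit, and [kernel_int_bound] dominates.
    Quasi-concavity here plays the part of bounded variation in the classical
    Dirichlet-Jordan theorem. *)
Lemma dirichlet_jordan :
  \int[mu]_y (phi y * (h y * dirichlet n y)) @[n --> \oo] -->
  \sum_(1 <= i < (2 * L).+1) phi (i%:R - L%:R) * h (i%:R - L%:R).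
Proof.
have phi0 y : 0 <= phi y by have /andP[] := phi01 y.
have ck n : continuous (fun x => h x * dirichlet n x).
  apply: continuousM_fun; [exact: is_derive_continuous dh|exact: continuous_dirichlet].
pose c i : R := i%:R - L%:R.
pose g (u : R) : R := \sum_(1 <= i < (2 * L).+1) h (c i) * (0 < u < phi (c i))%R%:R.
have ih (i : nat) : mu.-integrable setT (EFin \o (fun u : R => h (c i) * (0 < u < phi (c i))%R%:R)).
  have -> : EFin \o (fun u : R => h (c i) * (0 < u < phi (c i))%R%:R) =
      (fun u => ((h (c i))%:E * (\1_(`]0, phi (c i)[) u)%:E)%E).
    by apply/funext => u; rewrite indicE mem_setE in_itv /= EFinM.
  by apply: integrableZl => //; exact: (@integrable_indic_itv R 0 (phi (c i)) false true).
have [ig intg] : mu.-integrable setT (EFin \o g) /\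
    \int[mu]_u g u = \sum_(1 <= i < (2 * L).+1) phi (c i) * h (c i).
  rewrite /g; elim: (2 * L)%N => [|N [iN IH]].
    have -> : (fun u : R => \sum_(1 <= i < 1) h (c i) * (0 < u < phi (c i))%R%:R) = (fun=> 0).
      by apply/funext => u; rewrite big_geq.
    rewrite big_geq //; split; first exact: integrable0.
    by rewrite Rintegral_cst // mul0r.
  have -> : (fun u : R => \sum_(1 <= i < N.+2) h (c i) * (0 < u < phi (c i))%R%:R) =
      (fun u => (\sum_(1 <= i < N.+1) h (c i) * (0 < u < phi (c i))%R%:R) +
        h (c N.+1) * (0 < u < phi (c N.+1))%R%:R).
    by apply/funext => u; rewrite big_nat_recr.
  split; first exact: (integrableD _ iN (ih N.+1)).
  rewrite RintegralD // IH [RHS]big_nat_recr //=; congr (_ + _).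
  by rewrite /Rintegral integral_height //= mulrC.
rewrite -[X in _ --> X]intg.
have -> : (fun n => \int[mu]_y (phi y * (h y * dirichlet n y))) =
    (fun n => \int[mu]_u G n u).
  by apply/funext => n; rewrite (layer_cake cphi phi0 phiL (ck n)).
apply: (@dominated_Rintegral _ _ _ _ (fun u => B * \1_(`]0, 1[) u)) => //.
- by move=> n; exact: (measurable_layer cphi phi0 phiL (ck n)).
- by move/integrableP : ig => [/measurable_EFinP].
(* the exceptional levels: values of phi at integers *)
- exists (range (fun k : int => phi k%:~R)); split.
  + apply: countable_measurable; first exact: measurable_set1.
    exact: (sub_countable (card_image_le _ _) (countableP _)).
  + apply: countable_lebesgue_measure0.
    exact: (sub_countable (card_image_le _ _) (countableP _)).
  + move=> u /= nu; apply: contrapT => ru; apply: nu => _.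
    have nphi x : phi x = u -> x != (Num.floor x)%:~R.
      by move=> xu; apply/eqP => xk; apply: ru; exists (Num.floor x); rewrite -?xk.
    have [u01|nu01] := boolP (0 < u < 1); last first.
      rewrite (_ : g u = 0).
        under eq_fun do rewrite G_out //.
        exact: cvg_cst.
      rewrite /g big1 // => i _; case: (boolP (0 < u < _)) => [/andP[u0 up]|_].
        by move: nu01; rewrite u0 (lt_le_trans up) //; have /andP[] := phi01 (c i).
      by rewrite mulr0.
    have /andP[u0 u1] := u01.
    have [E|[p [q [Lp pq qL E [pu qu]]]]] := level_set u0.
      rewrite (_ : g u = 0).
        rewrite (_ : (fun n => _) = (fun=> 0)); first exact: cvg_cst.
        apply/funext => n.
        by rewrite (@G_in n u 0 0) // ?set_itv1 ?Rintegral_set1 // set_itvoo0.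
      rewrite /g big1 // => i _; case: (boolP (0 < u < _)) => [/andP[_ up]|_].
        by have : [set y | u < phi y] (c i) by []; rewrite E.
      by rewrite mulr0.
    have -> : g u = \sum_(1 <= i < (2 * L).+1) h (c i) * (p < c i < q)%R%:R.
      apply: eq_bigr => i _; congr (_ * (nat_of_bool _)%:R).
      rewrite u0 /=; have : [set y | u < phi y] (c i) = `]p, q[%classic (c i) by rewrite E.
      by rewrite /= in_itv /= => h1; apply/idP/idP; rewrite h1.
    rewrite (_ : (fun n => G n u) =
      (fun n => \int[mu]_(x in `[p, q]) (h x * dirichlet n x))); last first.
      by apply/funext => n; exact: G_in.
    by apply: (kernel_int_cvg dh ch' hH') => //; exact: nphi.
- exact: (integrableZl measurableT B (@integrable_indic_itv R 0 1 false true)).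
Qed.

End DirichletJordan.

(** * Affine change of variable *)

Section AffineSubstitution.
Local Open Scope classical_set_scope.
Local Open Scope complex_scope.
Variable R : realType.
Notation mu := (@lebesgue_measure R).

Lemma Rint_supp (g : R -> R) (a b : R) : (forall y, ~~ (a <= y <= b) -> g y = 0) ->
  \int[mu]_y g y = \int[mu]_(y in `[a, b]) g y.
Proof.
move=> g0; rewrite [RHS]Rintegral_mkcond; apply: eq_Rintegral => y _.
by rewrite patchE mem_setE in_itv /=; case: ifPn => // /g0.
Qed.

Lemma Rint_affine (g : R -> R) (L x M : R) : 0 < M -> continuous g ->
  (forall y, L <= `|y| -> g y = 0) ->
  \int[mu]_y g y = M^-1 * \int[mu]_t g (x + t / M).
Proof.
move=> M0 cg g0; set F := fun t : R => x + t / M.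
have Mn0 : M != 0 by rewrite gt_eqF.
have dF (t : R) : is_derive t 1 F M^-1.
  rewrite /F; apply: is_derive_eq; rewrite /GRing.scale /=; ring.
have F'E : F^`() = cst M^-1.
  by apply/funext => t; rewrite derive1E derive_val.
have cF : continuous F := is_derive_continuous dF.
pose A := M * (`|L| + `|x|).
have A0 : 0 <= A by rewrite mulr_ge0 ?(ltW M0) ?addr_ge0.
have FA : `|L| <= F A.
  rewrite /F /A mulrAC mulfV // mul1r addrCA lerDl.
  by have := ler_norm (- x); rewrite normrN; lra.
have FNA : F (- A) <= - `|L|.
  rewrite /F /A mulNr mulrAC mulfV // mul1r opprD addrCA gerDl.
  by have := ler_norm x; lra.
have Fhomo s t : s < t -> F s < F t.
  by move=> st; rewrite /F ltrD2l ltr_pM2r ?invr_gt0.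
have Ll := ler_norm L.
rewrite (@Rint_supp g (F (- A)) (F A)); last first.
  move=> y; rewrite negb_and -!ltNge => /orP[] yF; apply: g0; rewrite (le_trans Ll) //.
    by have := ler_norm (- y); rewrite normrN; lra.
  by have := ler_norm y; lra.
rewrite (@Rint_supp (fun t => g (x + t / M)) (- A) A); last first.
  move=> y; rewrite negb_and -!ltNge => /orP[] /Fhomo yF; apply: (g0 (F y)); rewrite (le_trans Ll) //.
    by have := ler_norm (- F y); rewrite normrN; lra.
  by have := ler_norm (F y); lra.
have cgF : continuous (fun t : R => g (x + t / M)).
  by move=> t; apply: continuous_comp; [exact: cF | exact: cg].
rewrite mulrC -RintegralZr //; last exact: continuous_integrable_cc.
rewrite /Rintegral (@integration_by_substitution_increasing R F g (- A) A) //.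
- by congr fine; apply: eq_integral => t _; rewrite /= F'E.
- by rewrite lerNl (le_trans _ A0) // oppr_le0.
- by move=> s t _ _; exact: Fhomo.
- by move=> t _; rewrite F'E; exact: cvg_cst.
- by rewrite F'E; exact: is_cvg_cst.
- by rewrite F'E; exact: is_cvg_cst.
- exact: is_derive_LRcontinuous dF.
- exact: continuous_subspaceT.
Qed.

End AffineSubstitution.

(** * The shape of window functions *)

Section OmegaFacts.
Local Open Scope classical_set_scope.
Local Open Scope complex_scope.
Variables (R : realType) (m : nat) (sigma : R) (w : R -> R).
Hypothesis Ow : Omega m sigma w.

Lemma Omega01 t : 0 <= w t <= 1. Proof. by case: Ow => -[]. Qed.
Lemma Omega_even t : w (- t) = w t. Proof. by case: Ow => -[]. Qed.
Lemma Omega_continuous : continuous w. Proof. by case: Ow => -[]. Qed.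

Lemma Omega_norm t : w `|t| = w t.
Proof. by have [|] := ger0P t => // _; rewrite Omega_even. Qed.

Lemma Omega_out t : 1 <= `|t| -> w t = 0.
Proof.
have out s : 1 < s -> w s = 0.
  move=> s1; apply/eqP; apply: contraTT s1 => ws; rewrite -leNgt.
  have : closure [set t | w t != 0] s by apply: subset_closure.
  by case: Ow => -[_ _ -> _] _; rewrite /= in_itv /= => /andP[].
rewrite -Omega_norm le_eqVlt => /predU1P[<-|/out //].
apply/le_anti; have /andP[-> _] := Omega01 1; rewrite andbT.
have : w x @[x --> 1^'+] --> w 1.
  by apply: cvg_at_right_filter; exact: Omega_continuous.
move/cvgr_to_le; apply; near=> x; rewrite out //.
Unshelve. all: end_near. Qed.

Lemma Omega_nincr x y : 0 <= x -> x <= y -> w y <= w x.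
Proof.
move=> x0 xy; have [y1|/ltW y1] := lerP y 1; first by case: Ow => _ [+ _ _ _]; apply.
rewrite (@Omega_out y); first by have /andP[] := Omega01 x.
by rewrite ger0_norm // (le_trans x0).
Qed.

(** An even function that decreases on the half line is unimodal. *)
Lemma Omega_qc a y b : a <= y -> y <= b -> Num.min (w a) (w b) <= w y.
Proof.
move=> ay yb; rewrite ge_min; have [y0|/ltW y0] := lerP 0 y.
  by rewrite (@Omega_nincr y b) ?orbT.
apply/orP; left; rewrite -(Omega_even a) -(Omega_even y) Omega_nincr ?oppr_ge0 //.
by rewrite lerN2.
Qed.

End OmegaFacts.

(** * Symmetric partial sums of translated transforms *)

Section FourierPartialSums.
Local Open Scope classical_set_scope.
Local Open Scope complex_scope.
Variable R : realType.
Notation mu := (@lebesgue_measure R).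
Variables (phi : R -> R) (L : R).
Hypothesis cphi : continuous phi.
Hypothesis phiL : forall y, L <= `|y| -> phi y = 0.

Lemma fourierE v : fourier phi v =
  Complex (\int[mu]_y (phi y * cos (2 * pi * v * y)))
          (\int[mu]_y (phi y * - sin (2 * pi * v * y))).
Proof.
rewrite /fourier /cintegral; congr Complex; apply: eq_Rintegral => y _.
  by rewrite RexM /= cosN.
by rewrite ImxM /= sinN.
Qed.

Lemma continuous_cosM (c : R) : continuous (fun y => cos (c * y)).
Proof.
move=> y; apply: continuous_comp; last exact: continuous_cos.
by apply: cvgM; [exact: cvg_cst | exact: cvg_id].
Qed.

Lemma continuous_sinM (c : R) : continuous (fun y => sin (c * y)).
Proof.
move=> y; apply: continuous_comp; last exact: continuous_sin.
by apply: cvgM; [exact: cvg_cst | exact: cvg_id].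
Qed.

Lemma integrable_supp_mul (k : R -> R) : continuous k ->
  mu.-integrable setT (EFin \o (fun y => phi y * k y)).
Proof.
move=> ck; apply: (@continuous_integrable_supp _ _ L); first exact: continuousM_fun.
by move=> y /phiL ->; rewrite mul0r.
Qed.

Lemma continuousN_fun (k : R -> R) : continuous k -> continuous (fun y => - k y).
Proof. by move=> ck y; apply: cvgN; exact: ck. Qed.

Lemma Rint_comb (k1 k2 : R -> R) (a b : R) : continuous k1 -> continuous k2 ->
  a * \int[mu]_y (phi y * k1 y) + b * \int[mu]_y (phi y * k2 y) =
  \int[mu]_y (phi y * (a * k1 y + b * k2 y)).
Proof.
move=> c1 c2; rewrite -!RintegralZl //; try exact: integrable_supp_mul.
rewrite -RintegralD //.
- by apply: eq_Rintegral => y _; ring.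
- exact: (integrableZl measurableT a (integrable_supp_mul c1)).
- exact: (integrableZl measurableT b (integrable_supp_mul c2)).
Qed.

Lemma fourier_rot v b : fourier phi v * expi b =
  Complex (\int[mu]_y (phi y * cos (2 * pi * v * y - b)))
          (\int[mu]_y (phi y * - sin (2 * pi * v * y - b))).
Proof.
have cc := @continuous_cosM (2 * pi * v).
have cs := continuousN_fun (@continuous_sinM (2 * pi * v)).
rewrite fourierE /expi; apply: cplx_eq => /=.
  rewrite mulrC (mulrC _ (sin b)) -mulNr Rint_comb //.
  by apply: eq_Rintegral => y _; rewrite cosB; congr (_ * _); ring.
rewrite mulrC (mulrC _ (cos b)) Rint_comb //.
by apply: eq_Rintegral => y _; rewrite sinB; congr (_ * _); ring.
Qed.

(** The frequencies v + s M and v - s M together carry a single cosine, which is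
    the increment of the Dirichlet kernel. *)
Lemma fourier_pair v s M x :
  fourier phi (v + s * M) * expi (2 * pi * s * M * x) +
  fourier phi (v + - s * M) * expi (2 * pi * - s * M * x) =
  Complex (\int[mu]_y (phi y * (cos (2 * pi * v * y) * (2 * cos (2 * pi * s * (M * (y - x)))))))
    (\int[mu]_y (phi y * (- sin (2 * pi * v * y) * (2 * cos (2 * pi * s * (M * (y - x))))))).
Proof.
have cc (c d : R) : continuous (fun y => cos (c * y - d)).
  move=> y; apply: continuous_comp; last exact: continuous_cos.
  by apply: cvgB; [apply: cvgM; [exact: cvg_cst | exact: cvg_id] | exact: cvg_cst].
have cs (c d : R) : continuous (fun y => - sin (c * y - d)).
  move=> y; apply: cvgN; apply: continuous_comp; last exact: continuous_sin.
  by apply: cvgB; [apply: cvgM; [exact: cvg_cst | exact: cvg_id] | exact: cvg_cst].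
rewrite !fourier_rot; apply: cplx_eq => /=.
  rewrite -[X in X + _]mul1r -[X in _ + X]mul1r Rint_comb //.
  apply: eq_Rintegral => y _; congr (_ * _); rewrite !mul1r.
  set A := 2 * pi * v * y; set B := 2 * pi * s * (M * (y - x)).
  rewrite (_ : _ - _ = A + B); last by rewrite /A /B; ring.
  rewrite (_ : 2 * pi * (v + - s * M) * y - _ = A - B); last by rewrite /A /B; ring.
  by rewrite cosD cosB; ring.
rewrite -[X in X + _]mul1r -[X in _ + X]mul1r Rint_comb //.
apply: eq_Rintegral => y _; congr (_ * _); rewrite !mul1r.
set A := 2 * pi * v * y; set B := 2 * pi * s * (M * (y - x)).
rewrite (_ : 2 * pi * (v + s * M) * y - _ = A + B); last by rewrite /A /B; ring.
rewrite (_ : 2 * pi * (v + - s * M) * y - _ = A - B); last by rewrite /A /B; ring.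
by rewrite sinD sinB; ring.
Qed.

(** Summing symmetrically produces the Dirichlet kernel. The real and the
    imaginary part are kept apart because the limit is taken on real
    integrals. *)
Lemma fourier_partial v M x n :
  fourier phi v + \sum_(1 <= r < n.+1)
    (fourier phi (v + r%:~R * M) * expi (2 * pi * r%:~R * M * x) +
     fourier phi (v + (- r%:Z)%:~R * M) * expi (2 * pi * (- r%:Z)%:~R * M * x)) =
  Complex (\int[mu]_y (phi y * (cos (2 * pi * v * y) * dirichlet n (M * (y - x)))))
    (\int[mu]_y (phi y * (- sin (2 * pi * v * y) * dirichlet n (M * (y - x))))).
Proof.
have cc := @continuous_cosM (2 * pi * v).
have cs := continuousN_fun (@continuous_sinM (2 * pi * v)).
have cD (k : nat) : continuous (fun y => dirichlet k (M * (y - x))).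
  move=> y; apply: (@continuous_comp _ _ _ (fun y : R => M * (y - x)) (dirichlet k)); last exact: continuous_dirichlet.
  by apply: cvgM; [exact: cvg_cst | apply: cvgB; [exact: cvg_id | exact: cvg_cst]].
have c2 (s : R) : continuous (fun y => 2 * cos (2 * pi * s * (M * (y - x)))).
  move=> y; apply: cvgM; first exact: cvg_cst.
  apply: continuous_comp; last exact: continuous_cos.
  apply: cvgM; first exact: cvg_cst.
  by apply: cvgM; [exact: cvg_cst | apply: cvgB; [exact: cvg_id | exact: cvg_cst]].
elim: n => [|n IH].
  rewrite big_geq // addr0 fourierE; congr Complex; apply: eq_Rintegral => y _.
    by rewrite dirichlet0 mulr1.
  by rewrite dirichlet0 mulr1.
rewrite big_nat_recr //= addrA IH mulrNz fourier_pair; apply: cplx_eq => /=.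
  rewrite -[X in X + _]mul1r -[X in _ + X]mul1r Rint_comb; try (by apply: continuousM_fun).
  by apply: eq_Rintegral => y _; congr (_ * _); rewrite dirichletS; ring.
rewrite -[X in X + _]mul1r -[X in _ + X]mul1r Rint_comb; try (by apply: continuousM_fun).
by apply: eq_Rintegral => y _; congr (_ * _); rewrite dirichletS; ring.
Qed.

End FourierPartialSums.

(** * Limits of complex sequences *)

Section ComplexLimit.
Local Open Scope classical_set_scope.
Local Open Scope complex_scope.
Variable R : realType.

Lemma ReB (z w : R[i]) : complex.Re (z - w) = complex.Re z - complex.Re w.
Proof. by case: z w => [a b] [c d]. Qed.

Lemma ImB (z w : R[i]) : complex.Im (z - w) = complex.Im z - complex.Im w.
Proof. by case: z w => [a b] [c d]. Qed.

Lemma cvg_complex (u : nat -> R[i]) (l : R[i]) :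
  (fun n => complex.Re (u n)) @ \oo --> complex.Re l ->
  (fun n => complex.Im (u n)) @ \oo --> complex.Im l ->
  (u : nat -> (R[i] : Type)^o) @ \oo --> (l : R[i]^o).
Proof.
move=> cr ci; apply/(@cvgrPdist_le _ R[i]^o) => /= e e0.
have e0' : 0 < complex.Re e by move: e0; rewrite ltcE => /andP[].
have eE : e = (complex.Re e)%:C.
  by move: e0; case: (e) => a b; rewrite ltcE /= => /andP[/eqP -> _].
move/cvgrPdist_le : cr => /(_ _ (divr_gt0 e0' (ltr0Sn _ 1))) cr.
move/cvgrPdist_le : ci => /(_ _ (divr_gt0 e0' (ltr0Sn _ 1))) ci.
near=> n.
rewrite eE normE lecR (le_trans (cabs_le_ReIm _)) //.
rewrite [leRHS](splitr (complex.Re e)) lerD //.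
  by rewrite ReB; near: n.
by rewrite ImB; near: n.
Unshelve. all: end_near. Qed.

Lemma sum_nonzero_lim (F : int -> R[i]) (l : R[i]) :
  (fun n : nat => (\sum_(1 <= r < n.+1) (F r%:Z + F (- r%:Z)) : R[i]^o)) @ \oo
    --> (l : R[i]^o) ->
  sum_nonzero F = l.
Proof. by move=> h; apply: (cvg_lim _ h); exact: norm_hausdorff. Qed.

End ComplexLimit.

(** * Poisson summation for windows *)

Lemma eq_big_supp (T : eqType) (V : nmodType) (S1 S2 : seq T) (g : T -> V) :
  uniq S1 -> uniq S2 -> (forall l, l \notin S1 -> g l = 0) ->
  (forall l, l \notin S2 -> g l = 0) ->
  \sum_(l <- S1) g l = \sum_(l <- S2) g l.
Proof.
move=> u1 u2 g1 g2.
have supp S : \sum_(l <- S) g l = \sum_(l <- [seq l <- S | g l != 0]) g l.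
  rewrite big_filter big_mkcond [RHS]big_mkcond /=; apply: eq_bigr => l _.
  by case: eqP.
rewrite supp [RHS]supp; apply: perm_big; apply: uniq_perm; rewrite ?filter_uniq //.
move=> l; rewrite !mem_filter; case: (eqVneq (g l) 0) => //= gl.
by apply/idP/idP => _; apply: contraNT gl => /[dup] ? ; [move/g2 ->|move/g1 ->].
Qed.

Section WindowPoisson.
Local Open Scope classical_set_scope.
Local Open Scope complex_scope.
Variables (R : realType) (m : nat) (sigma : R) (w : R -> R) (M : R).
Notation mu := (@lebesgue_measure R).
Hypothesis Ow : Omega m sigma w.
Hypothesis m0 : (0 < m)%N.
Hypothesis M0 : 0 < M.
Let phi := window w m M.

Let mR0 : 0 < m%:R :> R. Proof. by rewrite ltr0n. Qed.

Lemma window_continuous : continuous phi.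
Proof.
move=> t; rewrite /phi /window; apply: continuous_comp; last exact: (Omega_continuous Ow).
by apply: cvgM; [apply: cvgM; [exact: cvg_cst|exact: cvg_id]|exact: cvg_cst].
Qed.

Lemma window01 t : 0 <= phi t <= 1. Proof. exact: (Omega01 Ow). Qed.

Lemma window_even t : phi (- t) = phi t.
Proof. by rewrite /phi /window mulrN mulNr (Omega_even Ow). Qed.

Lemma window_out t : m%:R / M <= `|t| -> phi t = 0.
Proof.
move=> h; apply: (Omega_out Ow).
rewrite normrM normfV (gtr0_norm mR0) normrM (gtr0_norm M0).
by rewrite ler_pdivlMr // mul1r mulrC -ler_pdivrMr.
Qed.

Lemma window_qc a y b : a <= y -> y <= b -> Num.min (phi a) (phi b) <= phi y.
Proof.
by move=> ay yb; apply: (Omega_qc Ow); rewrite ler_pM2r ?invr_gt0 // ler_pM2l.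
Qed.

(** [dirichlet_jordan] after the substitution y = x + t / M. The index set S is
    any finite set that contains the support, so that every application can
    bring its own. *)
Lemma window_jordan (h h' : R -> R) (H' : R) (x : R) (S : seq int) :
  (forall y : R, is_derive y 1 h (h' y)) -> continuous h' ->
  (forall y, `|h y| <= 1) -> (forall y, `|h' y| <= H') ->
  uniq S -> (forall l, l \notin S -> phi (x + l%:~R / M) = 0) ->
  \int[mu]_y (phi y * (h y * dirichlet n (M * (y - x)))) @[n --> \oo] -->
  M^-1 * \sum_(l <- S) phi (x + l%:~R / M) * h (x + l%:~R / M).
Proof.
move=> dh ch' h1 hH' uS S0.
have Mn0 : M != 0 by rewrite gt_eqF.
set F := fun t : R => x + t / M.
have dF (t : R) : is_derive t 1 F M^-1.
  rewrite /F; apply: is_derive_eq; rewrite /GRing.scale /=; ring.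
have cF : continuous F := is_derive_continuous dF.
(* L bounds the support of phi in the variable t *)
have [L hL] : exists L : nat, m%:R + M * `|x| <= L%:R.
  by exists (Num.bound (m%:R + M * `|x|)); rewrite ltW // archi_boundP // addr_ge0 // mulr_ge0 // ltW.
have FL t : L%:R <= `|t| -> phi (F t) = 0.
  move=> Lt; apply: window_out; rewrite ler_pdivrMr //.
  have := lerB_normD (t / M) x; rewrite (addrC _ x) -/(F t).
  rewrite normrM normfV (gtr0_norm M0) lerBlDr => h2.
  have := ler_wpM2r (ltW M0) h2; rewrite divfK // mulrDl => h3.
  by move: (le_trans Lt h3) hL; rewrite (mulrC `|x|) ; lra.
have cphi := window_continuous.
have E n : \int[mu]_y (phi y * (h y * dirichlet n (M * (y - x)))) =
    M^-1 * \int[mu]_t (phi (F t) * (h (F t) * dirichlet n t)).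
  rewrite (@Rint_affine _ _ (m%:R / M) x M) //.
  - congr (_ * _); apply: eq_Rintegral => t _; rewrite -/(F t); congr (_ * (_ * dirichlet _ _)).
    by rewrite /F (addrC x) addrK mulrC divfK.
  - apply: continuousM_fun => //; apply: continuousM_fun; first exact: is_derive_continuous dh.
    move=> y; apply: (@continuous_comp _ _ _ (fun y : R => M * (y - x)) (dirichlet n)); last exact: continuous_dirichlet.
    by apply: cvgM; [exact: cvg_cst | apply: cvgB; [exact: cvg_id | exact: cvg_cst]].
  - by move=> y /window_out; rewrite -/phi => ->; rewrite mul0r.
under eq_fun do rewrite E.
apply: cvgM; first exact: cvg_cst.
have -> : \sum_(l <- S) phi (x + l%:~R / M) * h (x + l%:~R / M) =
    \sum_(1 <= i < (2 * L).+1) phi (F (i%:R - L%:R)) * h (F (i%:R - L%:R)).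
  transitivity (\sum_(l <- [seq i%:Z - L%:Z | i <- index_iota 1 (2 * L).+1])
      phi (F l%:~R) * h (F l%:~R)); last first.
    by rewrite big_map; apply: eq_bigr => i _; rewrite intrB.
  apply: eq_big_supp => //.
  - by rewrite map_inj_uniq ?iota_uniq // => i j /addIr [].
  - by move=> l /S0 ->; rewrite mul0r.
  - move=> /= l lS; rewrite FL ?mul0r // -[L%:R]/(L%:Z%:~R) -intr_norm ler_int.
    rewrite leNgt; apply: contra lS => lL; apply/mapP.
    have := lL; move: (l : int) => k kL.
    by exists (absz (k + L%:Z)); [rewrite mem_index_iota; lia | lia].
apply: (@dirichlet_jordan R (phi \o F) (h \o F) (fun t => h' (F t) * M^-1) L 1 (H' * M^-1)).
- by move=> t; apply: continuous_comp; [exact: cF | exact: cphi].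
- by move=> y; exact: window01.
- by move=> y; exact: FL.
- by move=> a y b ay yb; apply: window_qc; rewrite lerD2l ler_pM2r ?invr_gt0.
- apply: continuousM_fun; last by move=> t; exact: cvg_cst.
  by move=> t; apply: continuous_comp; [exact: cF | exact: ch'].
- by move=> y; exact: h1.
- by move=> y; rewrite normrM normfV (gtr0_norm M0) ler_pM2r ?invr_gt0.
Qed.

(** Poisson summation without any summability of the transform: only the
    symmetric partial sums are claimed to converge. *)
Lemma window_poisson (v x : R) (S : seq int) :
  uniq S -> (forall l, l \notin S -> phi (x + l%:~R / M) = 0) ->
  (fun n : nat => (\sum_(1 <= r < n.+1)
    (fourier phi (v + r%:~R * M) * expi (2 * pi * r%:~R * M * x) +
     fourier phi (v + (- r%:Z)%:~R * M) * expi (2 * pi * (- r%:Z)%:~R * M * x)) : R[i]^o))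
  @ \oo --> (M^-1%:C * (\sum_(l <- S) (phi (x + l%:~R / M))%:C *
    expi (- (2 * pi * v * (x + l%:~R / M)))) - fourier phi v : R[i]^o).
Proof.
move=> uS S0; set c := 2 * pi * v.
have dC (y : R) : is_derive y 1 (fun y => cos (c * y)) (- sin (c * y) * c).
  by apply: is_derive_eq; rewrite /GRing.scale /=; ring.
have dS (y : R) : is_derive y 1 (fun y => - sin (c * y)) (- cos (c * y) * c).
  by apply: is_derive_eq; rewrite /GRing.scale /=; ring.
have cC : continuous (fun y => - sin (c * y) * c).
  by apply: continuousM_fun; [apply: continuousN_fun; exact: continuous_sinM | move=> y; exact: cvg_cst].
have cS : continuous (fun y => - cos (c * y) * c).
  by apply: continuousM_fun; [apply: continuousN_fun; exact: continuous_cosM | move=> y; exact: cvg_cst].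
have bC (y : R) : `|- sin (c * y) * c| <= `|c|.
  by rewrite normrM normrN ler_piMl // sin_max.
have bS (y : R) : `|- cos (c * y) * c| <= `|c|.
  by rewrite normrM normrN ler_piMl // cos_max.
have hC := window_jordan dC cC (fun y => cos_max _) bC uS S0.
have nS (y : R) : `|- sin (c * y)| <= 1 by rewrite normrN sin_max.
have hS := window_jordan dS cS nS bS uS S0.
have part n := @fourier_partial R phi (m%:R / M) window_continuous window_out v M x n.
apply: cvg_complex.
- have -> : (fun n : nat => complex.Re (\sum_(1 <= r < n.+1)
    (fourier phi (v + r%:~R * M) * expi (2 * pi * r%:~R * M * x) +
     fourier phi (v + (- r%:Z)%:~R * M) * expi (2 * pi * (- r%:Z)%:~R * M * x)))) =
   (fun n => \int[mu]_y (phi y * (cos (c * y) * dirichlet n (M * (y - x))))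
      - complex.Re (fourier phi v)).
    by apply/funext => n; have /(congr1 (@complex.Re R)) := part n; rewrite ReD /= => <-; rewrite addrC addKr.
  rewrite ReB RexM Re_sum.
  rewrite (eq_bigr (fun l => phi (x + l%:~R / M) * cos (c * (x + l%:~R / M)))); last first.
    by move=> l _; rewrite RexM /= cosN.
  by apply: cvgB hC _; exact: cvg_cst.
- have -> : (fun n : nat => complex.Im (\sum_(1 <= r < n.+1)
    (fourier phi (v + r%:~R * M) * expi (2 * pi * r%:~R * M * x) +
     fourier phi (v + (- r%:Z)%:~R * M) * expi (2 * pi * (- r%:Z)%:~R * M * x)))) =
   (fun n => \int[mu]_y (phi y * (- sin (c * y) * dirichlet n (M * (y - x))))
      - complex.Im (fourier phi v)).
    by apply/funext => n; have /(congr1 (@complex.Im R)) := part n; rewrite ImD /= => <-; rewrite addrC addKr.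
  rewrite ImB ImxM Im_sum.
  rewrite (eq_bigr (fun l => phi (x + l%:~R / M) * - sin (c * (x + l%:~R / M)))); last first.
    by move=> l _; rewrite ImxM /= sinN.
  by apply: cvgB hS _; exact: cvg_cst.
Qed.

End WindowPoisson.

(** * The aliasing error of a window *)

Lemma window_index_out (m : nat) (k l : int) :
  l \notin [seq i%:Z - m%:Z - k | i <- iota 0 (2 * m).+1] ->
  (m%:Z + 1 <= k + l) \/ (k + l <= - m%:Z - 1).
Proof.
move=> lS; apply/orP; apply: contraNT lS; rewrite negb_or -!ltNge => /andP[h1 h2].
by apply/mapP; exists (absz (l + k + m%:Z)); [rewrite mem_iota; lia | lia].
Qed.

Section ErrorConstant.
Local Open Scope classical_set_scope.
Local Open Scope complex_scope.
Variables (R : realType) (m : nat) (sigma : R) (w : R -> R).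
Notation mu := (@lebesgue_measure R).
Hypothesis Ow : Omega m sigma w.
Hypothesis m0 : (0 < m)%N.
Hypothesis sigma0 : 0 < sigma.

Let mR0 : 0 < m%:R :> R. Proof. by rewrite ltr0n. Qed.

Section FixedM.
Variable M : R.
Hypothesis M0 : 0 < M.
Let phi := window w m M.

(** By scaling, the frequencies in [-K/2, K/2] of the window for K correspond to
    the frequencies of w in [- m / (2 sigma), m / (2 sigma)], whatever K is.
    That is why conditions on w alone control all K. *)
Lemma fourier_window v : fourier phi v = (m%:R / M)%:C * fourier w (m%:R / M * v).
Proof.
have Mn0 : M != 0 by rewrite gt_eqF.
have mn0 : m%:R != 0 :> R by rewrite gt_eqF.
have Mm0 : 0 < M / m%:R by rewrite divr_gt0.
have cp : continuous phi := window_continuous Ow.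
have step (k k' : R -> R) : continuous k -> (forall t, k (t / (M / m%:R)) = k' t) ->
    \int[mu]_y (phi y * k y) = m%:R / M * \int[mu]_y (w y * k' y).
  move=> ck kk'; rewrite (@Rint_affine _ _ (m%:R / M) 0 (M / m%:R)) //.
  - congr (_ * _); first by rewrite invf_div.
    apply: eq_Rintegral => t _; rewrite add0r kk'.
    by congr (w _ * _); field; apply/andP.
  - exact: continuousM_fun.
  - by move=> y /(window_out Ow m0 M0) h; rewrite /phi h mul0r.
rewrite !fourierE; apply: cplx_eq; rewrite ?RexM ?ImxM /=.
  apply: step; first exact: continuous_cosM.
  by move=> t; congr cos; field; apply/andP.
apply: step; first by apply: continuousN_fun; exact: continuous_sinM.
by move=> t; congr (- sin _); field; apply/andP.
Qed.

Lemma fourier_windowN v : fourier phi (- v) =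
  Complex (complex.Re (fourier phi v)) (- complex.Im (fourier phi v)).
Proof.
rewrite !fourierE; apply: cplx_eq => /=.
  by apply: eq_Rintegral => y _; rewrite mulrN mulNr cosN.
rewrite -[RHS]mulN1r -RintegralZl //; last first.
  apply: (@integrable_supp_mul _ _ (m%:R / M)).
  - exact: window_continuous Ow.
  - exact: window_out Ow m0 M0.
  - by apply: continuousN_fun; exact: continuous_sinM.
apply: eq_Rintegral => y _.
by rewrite (_ : 2 * pi * - v * y = - (2 * pi * v * y)) ?sinN; ring.
Qed.

Variable K : R.
Hypothesis K0 : 0 < K.
Hypothesis MK : sigma * K = M.

Let rng v : 0 <= v -> v <= K / 2 -> 0 <= m%:R / M * v <= m%:R / (2 * sigma).
Proof.
move=> v0 vK; rewrite mulr_ge0 ?divr_ge0 ?(ltW M0) //=.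
have -> : m%:R / (2 * sigma) = m%:R / M * (K / 2).
  by rewrite -MK; field; rewrite !gt_eqF.
by rewrite ler_wpM2l // divr_ge0 ?(ltW M0).
Qed.

Lemma fourier_window_gt0 v : 0 <= v -> v <= K / 2 -> 0 < fourier phi v.
Proof.
move=> v0 vK; have /andP[h1 h2] := rng v0 vK.
rewrite fourier_window mulr_gt0 //; first by rewrite (ltcR 0) divr_gt0.
by case: Ow => _ [_ _ + _]; apply.
Qed.

Lemma fourier_window_decr u v : 0 <= u -> u <= v -> v <= K / 2 ->
  complex.Re (fourier phi v) <= complex.Re (fourier phi u).
Proof.
move=> u0 uv vK; have /andP[h1 _] := rng u0 (le_trans uv vK).
have /andP[_ h2] := rng (le_trans u0 uv) vK.
rewrite !fourier_window !RexM ler_wpM2l ?divr_ge0 ?(ltW M0) //.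
have : fourier w (m%:R / M * v) <= fourier w (m%:R / M * u).
  case: Ow => _ [_ _ _ +]; apply => //.
  by rewrite ler_wpM2l // divr_ge0 ?(ltW M0).
by rewrite lecE => /andP[].
Qed.

Lemma fourier_window_real v : `|v| <= K / 2 ->
  fourier phi v = (complex.Re (fourier phi `|v|))%:C /\
  0 < complex.Re (fourier phi (K / 2)) <= complex.Re (fourier phi `|v|).
Proof.
move=> vK; have hp := fourier_window_gt0 (normr_ge0 v) vK.
have hr : fourier phi `|v| = (complex.Re (fourier phi `|v|))%:C.
  by move: hp; case: (fourier _ _) => a b; rewrite ltcE /= => /andP[/eqP -> _].
have K20 : 0 <= K / 2 by rewrite divr_ge0 // ltW.
have := fourier_window_gt0 K20 (lexx _); rewrite ltcE => /andP[_ dp].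
rewrite dp fourier_window_decr //; split => //.
have [v0|v0] := ger0P v; first by move: hr; rewrite ger0_norm.
move: hr; rewrite (ltr0_norm v0) => hr.
rewrite -{1}(opprK v) fourier_windowN hr /=.
by apply: cplx_eq; rewrite /= ?oppr0.
Qed.

(** The function of x whose uniform norm enters [EsigmaK]. *)
Definition alias (v x : R) : R[i] := sum_nonzero (fun r =>
  fourier phi (v + r%:~R * M) / fourier phi v * expi (2 * pi * r%:~R * M * x)).

(** Poisson summation, read as a relative error of the sampled transform. *)
Lemma alias_eq v x S : fourier phi v != 0 -> uniq S ->
  (forall l, l \notin S -> phi (x + l%:~R / M) = 0) ->
  fourier phi v * (1 + alias v x) = M^-1%:C * (\sum_(l <- S) (phi (x + l%:~R / M))%:C *
    expi (- (2 * pi * v * (x + l%:~R / M)))).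
Proof.
move=> f0 uS S0; set A := RHS.
suff -> : alias v x = (A - fourier phi v) / fourier phi v.
  by rewrite mulrDr mulr1 mulrC divfK // addrC subrK.
have h := window_poisson Ow m0 M0 (v := v) uS S0.
apply: sum_nonzero_lim.
have -> : (fun n : nat => \sum_(1 <= r < n.+1)
   (fourier phi (v + (r%:Z)%:~R * M) / fourier phi v * expi (2 * pi * (r%:Z)%:~R * M * x) +
    fourier phi (v + (- r%:Z)%:~R * M) / fourier phi v * expi (2 * pi * (- r%:Z)%:~R * M * x))
    : R[i]^o) = (fun n : nat => (\sum_(1 <= r < n.+1)
    (fourier phi (v + r%:~R * M) * expi (2 * pi * r%:~R * M * x) +
     fourier phi (v + (- r%:Z)%:~R * M) * expi (2 * pi * (- r%:Z)%:~R * M * x)) : R[i]^o)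
     * (fourier phi v)^-1).
  apply/funext => n; rewrite mulr_suml; apply: eq_bigr => r _.
  by rewrite [RHS]mulrDl; congr (_ + _); rewrite mulrAC.
by apply: (cvgM h); exact: cvg_cst.
Qed.

Let delta := complex.Re (fourier w (m%:R / (2 * sigma))).
(** Free of K, v and x, so that all suprema in [Esigma] are over bounded sets. *)
Definition alias_bound := 1 + (2 * m%:R + 1) / (m%:R * complex.Re (fourier w (m%:R / (2 * sigma)))).

(** At most 2 m + 1 of the samples are nonzero and all are at most 1, while the
    transform at v is at least its value at K / 2, a constant times 1 / M. *)
Lemma le_alias v x : `|v| <= K / 2 -> cabs (alias v x) <= alias_bound.
Proof.
move=> vK; have [fE /andP[d0 dle]] := fourier_window_real vK.
set d := complex.Re (fourier phi (K / 2)) in d0 dle.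
set f := complex.Re (fourier phi `|v|) in fE dle.
have f0 : 0 < f by rewrite (lt_le_trans d0).
have fn0 : fourier phi v != 0.
  by rewrite fE -(rmorph0 (real_complex R)) (inj_eq (@complexI _)) gt_eqF.
(* the 2 m + 1 indices l with |floor (M x) + l| <= m *)
pose S : seq int := [seq i%:Z - m%:Z - Num.floor (M * x) | i <- iota 0 (2 * m).+1].
have uS : uniq S.
  by rewrite map_inj_uniq ?iota_uniq // => i j /addIr/addIr [].
have S0 l : l \notin S -> phi (x + l%:~R / M) = 0.
  move=> lS; apply: (window_out Ow m0 M0).
  rewrite ler_pdivrMr // -{2}(gtr0_norm M0) -normrM mulrDl divfK ?gt_eqF // mulrC.
  have /andP[k1 k2] := floor_itv (M * x); set k := Num.floor (M * x) in lS k1 k2.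
  case: (window_index_out lS); rewrite -(ler_int R).
    rewrite 2!intrD => h; rewrite (le_trans _ (ler_norm _)) //.
    by move: h k1; rewrite -pmulrn; lra.
  rewrite !intrD !mulrNz => h; rewrite -normrN (le_trans _ (ler_norm _)) //.
  by move: h k2; rewrite intrD -pmulrn; lra.
have h := alias_eq fn0 uS S0.
have -> : alias v x = (fourier phi v)^-1 * (M^-1%:C * (\sum_(l <- S) (phi (x + l%:~R / M))%:C *
    expi (- (2 * pi * v * (x + l%:~R / M))))) - 1.
  by rewrite -h mulKf // addrC addKr.
rewrite (le_trans (cabsD _ _)) // cabsN cabs1 addrC lerD2l !cabsM cabsV fE !cabsR.
rewrite (gtr0_norm f0) (gtr0_norm (_ : 0 < M^-1)) ?invr_gt0 //.
have hs : cabs (\sum_(l <- S) (phi (x + l%:~R / M))%:C *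
    expi (- (2 * pi * v * (x + l%:~R / M)))) <= 2 * m%:R + 1.
  rewrite (le_trans (cabs_sum _ _ _)) //.
  apply: (@le_trans _ _ (\sum_(l <- S) 1)).
    apply: ler_sum => l _; rewrite cabsM cabs_expi mulr1 cabsR.
    by have /andP[p0 p1] := window01 M Ow (x + l%:~R / M); rewrite ger0_norm.
  rewrite big_const_seq count_predT size_map size_iota iter_addr_0.
  by rewrite -natrM -natr1 natrM.
have dE : d = m%:R / M * delta.
  rewrite /d fourier_window RexM; congr (_ * complex.Re (fourier _ _)).
  by rewrite -MK; field; rewrite !gt_eqF.
have delta0 : 0 < delta.
  by move: d0; rewrite dE pmulr_rgt0 // divr_gt0.
have -> : (2 * m%:R + 1) / (m%:R * delta) = d^-1 * (M^-1 * (2 * m%:R + 1)).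
  by rewrite dE; field; rewrite !gt_eqF.
have M1 : 0 <= M^-1 by rewrite invr_ge0 ltW.
apply: ler_pM.
- by rewrite invr_ge0 ltW.
- by rewrite mulr_ge0 // cabs_ge0.
- by rewrite lef_pV2 ?posrE.
- by rewrite ler_wpM2l.
Qed.

End FixedM.

(** The supremum of an unbounded set is 0 by convention, so each of the three
    nested suprema has to be shown bounded before it bounds anything. *)
Lemma alias_le_Esigma (K M : nat) v x : (0 < K)%N -> posEven M ->
  sigma * K%:R = M%:R -> `|v| <= K%:R / 2 -> `|x| <= 2^-1 ->
  cabs (alias M%:R v x) <= Esigma w m sigma.
Proof.
move=> K0 Me MK vK x2.
have K1 (K' : nat) : (0 < K')%N -> 0 < K'%:R :> R by rewrite ltr0n.
have nrm_ub (K' : nat) v' : (0 < K')%N -> `|v'| <= K'%:R / 2 ->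
    ubound [set cabs (alias (sigma * K'%:R) v' x0) | x0 in `[(- 2^-1 : R), 2^-1]] alias_bound.
  move=> K'0 v'K _ [x0 _ <-].
  by apply: (@le_alias _ _ K'%:R) => //; rewrite ?mulr_gt0 ?K1.
have nrm_le (K' : nat) v' : (0 < K')%N -> `|v'| <= K'%:R / 2 ->
    normCT (alias (sigma * K'%:R) v') <= alias_bound.
  move=> K'0 v'K; apply: ge_sup; last exact: nrm_ub.
  by exists (cabs (alias (sigma * K'%:R) v' 0)), 0 => //=; rewrite in_itv /= oppr_le0 invr_ge0 ler0n.
have EK_ub (K' : nat) : (0 < K')%N ->
    ubound [set normCT (alias (sigma * K'%:R) v') | v' in `[(- (K'%:R / 2) : R), K'%:R / 2]] alias_bound.
  move=> K'0 _ [v' v'K <-]; apply: nrm_le => //.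
  by move: v'K; rewrite /= in_itv /= ler_norml.
have EK_le (K' : nat) : (0 < K')%N -> EsigmaK w m sigma K' <= alias_bound.
  move=> K'0; apply: ge_sup; last exact: EK_ub.
  exists (normCT (alias (sigma * K'%:R) 0)), 0 => //=.
  by rewrite in_itv /= oppr_le0 divr_ge0 ?ler0n.
have h1 : EsigmaK w m sigma K <= Esigma w m sigma.
  apply: ub_le_sup; first by exists alias_bound => _ [K' [K'0 _] <-]; exact: EK_le.
  by exists K => //; split=> //; exists M.
apply: le_trans h1.
have h2 : normCT (alias (sigma * K%:R) v) <= EsigmaK w m sigma K.
  apply: ub_le_sup; first by exists alias_bound; exact: EK_ub.
  by exists v => //=; rewrite in_itv /= -ler_norml.
apply: le_trans h2; rewrite -MK.
apply: ub_le_sup; first by exists alias_bound; exact: nrm_ub.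
by exists x => //=; rewrite in_itv /= -ler_norml.
Qed.

(** This is [alias_eq] at x = - v, times the phase exp (- 2 pi i xi v). *)
Lemma nfft_error (K M : nat) (xi v : R) (S : seq int) :
  (0 < K)%N -> posEven M -> sigma * K%:R = M%:R ->
  `|xi| <= K%:R / 2 -> `|v| <= 2^-1 -> uniq S ->
  (forall l, l \notin S -> window w m M%:R (l%:~R / M%:R - v) = 0) ->
  cabs (M%:R^-1%:C * (\sum_(l <- S) (window w m M%:R (l%:~R / M%:R - v))%:C
      * expi (- (2 * pi * xi * (l%:~R / M%:R))))
    - fourier (window w m M%:R) xi * expi (- (2 * pi * xi * v)))
  <= complex.Re (fourier (window w m M%:R) `|xi|) * Esigma w m sigma.
Proof.
move=> K0 Me MK xiK v2 uS S0.
have M0 : 0 < M%:R :> R by case/andP: Me; rewrite ltr0n.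
have KR0 : 0 < K%:R :> R by rewrite ltr0n.
have [fE /andP[d0 dle]] := fourier_window_real M0 KR0 MK xiK.
have f0 := lt_le_trans d0 dle.
have fn0 : fourier (window w m M%:R) xi != 0.
  by rewrite fE -(rmorph0 (real_complex R)) (inj_eq (@complexI _)) gt_eqF.
have S0' l : l \notin S -> window w m M%:R (- v + l%:~R / M%:R) = 0.
  by move=> /S0; rewrite addrC.
have h := alias_eq M0 fn0 uS S0'.
have -> : \sum_(l <- S) (window w m M%:R (l%:~R / M%:R - v))%:C
      * expi (- (2 * pi * xi * (l%:~R / M%:R))) =
   (\sum_(l <- S) (window w m M%:R (- v + l%:~R / M%:R))%:C *
    expi (- (2 * pi * xi * (- v + l%:~R / M%:R)))) * expi (- (2 * pi * xi * v)).
  rewrite mulr_suml; apply: eq_bigr => l _; rewrite -[RHS]mulrA -expiD !(addrC (- v)).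
  by congr (_ * expi _); ring.
rewrite mulrA -h -mulrBl mulrDr mulr1 addrC addKr !cabsM cabs_expi mulr1 fE cabsR.
rewrite gtr0_norm // ler_pM2l //.
by apply: (alias_le_Esigma K0 Me MK xiK); rewrite normrN.
Qed.

End ErrorConstant.

(** * Symmetric index sets *)

Section Iset.
Local Open Scope complex_scope.
Lemma Iset_uniq M : uniq (Iset M).
Proof. by rewrite map_inj_uniq ?iota_uniq // => i j /addIr []. Qed.

Lemma Iset_out (R : realType) M (l : int) : ~~ odd M -> l \notin Iset M ->
  M%:R / 2 <= `|l%:~R : R|.
Proof.
move=> oM lM; have M2 : M%:R / 2 = (M./2)%:~R :> R.
  rewrite -[in LHS](odd_double_half M) (negbTE oM) add0n -muln2 natrM.
  by rewrite mulfK // pnatr_eq0.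
rewrite M2 -intr_norm ler_int leNgt; apply: contra lM => h; apply/mapP.
have := odd_double_half M; rewrite (negbTE oM) => hM.
by exists (absz (l + (M./2)%:Z)); [rewrite mem_iota; lia | lia].
Qed.

Lemma Iset_in (R : realType) M (l : int) : ~~ odd M -> l \in Iset M ->
  `|l%:~R : R| <= M%:R / 2.
Proof.
move=> oM /mapP[j]; rewrite mem_iota => jM ->; have M2 : M%:R / 2 = (M./2)%:~R :> R.
  rewrite -[in LHS](odd_double_half M) (negbTE oM) add0n -muln2 natrM.
  by rewrite mulfK // pnatr_eq0.
have := odd_double_half M; rewrite (negbTE oM) => hM.
by rewrite M2 -intr_norm ler_int; lia.
Qed.

Lemma size_Iset M : size (Iset M) = M.
Proof. by rewrite size_map size_iota. Qed.
End Iset.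

(** * The error of the NNFFT *)

Lemma Esigma_ge0 (R : realType) (w : R -> R) m sigma (K M : nat) :
  Omega m sigma w -> (0 < m)%N -> 0 < sigma -> (0 < K)%N -> posEven M ->
  sigma * K%:R = M%:R -> 0 <= Esigma w m sigma.
Proof.
move=> Ow m0 s0 K0 Me MK; rewrite (le_trans (cabs_ge0 (alias m w M%:R 0 0))) //.
by apply: (alias_le_Esigma Ow m0 s0 K0 Me MK); rewrite normr0 ?divr_ge0 ?invr_ge0.
Qed.

Section NNFFTError.
Local Open Scope complex_scope.
Variables (R : realType) (N N1 N2 m1 m2 : nat) (sigma1 sigma2 : R)
  (omega1 omega2 : R -> R).
Hypotheses (N0 : (0 < N)%N) (N1e : posEven N1) (N1E : N1%:R = sigma1 * N%:R)
  (s1 : 1 < sigma1) (m1_gt1 : (1 < m1)%N)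
  (N2e : posEven N2) (N2E : N2%:R = sigma2 * (N1 + 2 * m1)%:R) (s2 : 1 < sigma2)
  (m2_gt1 : (1 < m2)%N) (m2le : 2 * m2%:R <= (1 - sigma1^-1) * N2%:R)
  (O1 : Omega m1 sigma1 omega1) (O2 : Omega m2 sigma2 omega2).

Let phi1 := window omega1 m1 N1%:R.
Let phi2 := window omega2 m2 N2%:R.
Let a : R := 1 + 2 * m1%:R / N1%:R.
Let phi1hat := complex.Re (fourier phi1 (N%:R / 2)).
Let E1 := Esigma omega1 m1 sigma1.
Let E2 := Esigma omega2 m2 sigma2.
Let K := (N1 + 2 * m1)%N.

Let m10 : (0 < m1)%N := ltnW m1_gt1.
Let m20 : (0 < m2)%N := ltnW m2_gt1.
Let s10 : 0 < sigma1 := lt_trans ltr01 s1.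
Let s20 : 0 < sigma2 := lt_trans ltr01 s2.
Let N1_gt0 : 0 < N1%:R :> R. Proof. by case/andP: N1e; rewrite ltr0n. Qed.
Let N2_gt0 : 0 < N2%:R :> R. Proof. by case/andP: N2e; rewrite ltr0n. Qed.
Let K0 : (0 < K)%N. Proof. by case/andP: N1e => ? _; rewrite addn_gt0; apply/orP; left. Qed.
Let Ke : ~~ odd K. Proof. by case/andP: N1e => _; rewrite oddD oddM addbF. Qed.

Lemma phi1hat_gt0 : 0 < phi1hat.
Proof.
have := @fourier_window_real R m1 sigma1 omega1 O1 m10 s10 N1%:R N1_gt0 N%:R.
rewrite ltr0n N0 -N1E => /(_ isT erefl 0); rewrite normr0 divr_ge0 //.
by case=> // _ /andP[].
Qed.

Lemma E1_ge0 : 0 <= E1. Proof. exact: (Esigma_ge0 O1 m10 s10 N0 N1e (esym N1E)). Qed.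
Lemma E2_ge0 : 0 <= E2. Proof. exact: (Esigma_ge0 O2 m20 s20 K0 N2e (esym N2E)). Qed.
Lemma a_ge0 : 0 <= a. Proof. by rewrite addr_ge0 // divr_ge0 // ?mulr_ge0 // ltW. Qed.

(** Exchanging the sums isolates, for each l, an approximation of
    exp (- 2 pi i l x / sigma1) by samples of phi2, to which [nfft_error]
    applies. *)
Lemma nnfft_exchange (T : Type) (s : seq T) (f : T -> R[i]) (v : T -> R) x :
  nnfft_s1 N1 N2 m1 sigma1 phi1 phi2 s f v x =
  \sum_(l <- Iset K) nnfft_g N1 phi1 s f v l *
    ((N2%:R^-1 * \sum_(q <- Iset N2) (phi2 (x / sigma1 - q%:~R / N2%:R))%:C
      * expi (- (2 * pi * l%:~R * (q%:~R / N2%:R)))) / fourier phi2 l%:~R).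
Proof.
rewrite /nnfft_s1 /nnfft_h.
under eq_bigr => q _ do rewrite -mulrA mulr_suml mulr_sumr.
rewrite exchange_big /=; apply: eq_bigr => l _.
rewrite mulr_sumr mulr_suml mulr_sumr; apply: eq_bigr => q _.
rewrite (mulrA _ q%:~R); move: (nnfft_g _ _ _ _ _ _) (expi _) (_%:C) => A B C.
by move: (_^-1) (_^-1) => D E; ring.
Qed.

(** Two approximations of exponentials by window samples. Those of phi1 give
    exp (- 2 pi i N x v_k), up to E1, from the exponentials
    exp (- 2 pi i l x / sigma1), and those of phi2 give the latter up to E2.
    There are N1 + 2 m1 values of l, with coefficients at most 1 / N1 times the
    sum of the |f_k|, whence the factor a in front of E2. This second error is
    not relative to the transform of phi1, and the division by that transform
    costs its smallest value, the one at N / 2. *)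
Lemma nnfft_error (T : eqType) (s : seq T) (f : T -> R[i]) (v : T -> R) x :
  (forall k, k \in s -> `|v k| <= 2^-1) -> `|x| <= 2^-1 ->
  cabs (\sum_(k <- s) f k * expi (- (2 * pi * (N%:R * x) * v k)) -
        nnfft N N1 N2 m1 sigma1 phi1 phi2 s f v x)
  <= (E1 + a / phi1hat * E2) * \sum_(k <- s) cabs (f k).
Proof.
move=> v2 x2; set xi := N%:R * x; set F := \sum_(k <- s) cabs (f k).
have NR0 : 0 < N%:R :> R by rewrite ltr0n.
have xiN : `|xi| <= N%:R / 2 by rewrite /xi normrM (gtr0_norm NR0) ler_wpM2l.
have := @fourier_window_real R m1 sigma1 omega1 O1 m10 s10 N1%:R N1_gt0 N%:R NR0 (esym N1E) xi xiN.
rewrite -/phi1 -/phi1hat => -[fE /andP[d0 dle]].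
set Phi := complex.Re (fourier phi1 `|xi|) in fE dle.
have Phi0 : 0 < Phi := lt_le_trans d0 dle.
have F0 : 0 <= F by apply: sumr_ge0 => k _; exact: cabs_ge0.
have xiE l : 2 * pi * l * (x / sigma1) = 2 * pi * xi * (l / N1%:R).
  by rewrite /xi N1E; field; rewrite !gt_eqF.
pose B k : R[i] := N1%:R^-1 * \sum_(l <- Iset K) (phi1 (l%:~R / N1%:R - v k))%:C *
   expi (- (2 * pi * xi * (l%:~R / N1%:R))).
pose A l : R[i] := (N2%:R^-1 * \sum_(q <- Iset N2) (phi2 (x / sigma1 - q%:~R / N2%:R))%:C
      * expi (- (2 * pi * l%:~R * (q%:~R / N2%:R)))) / fourier phi2 l%:~R.
pose ex (l : int) : R[i] := expi (- (2 * pi * xi * (l%:~R / N1%:R))).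
have invC (k : nat) : (k%:R : R[i])^-1 = (k%:R^-1)%:C by rewrite fmorphV rmorph_nat.
(* the range of l is wide enough for all nonzero samples, as |v k| <= 1/2 *)
have vB k : k \in s -> cabs (B k - fourier phi1 xi * expi (- (2 * pi * xi * v k))) <= Phi * E1.
  move=> ks; rewrite /B invC.
  apply: (@nfft_error R m1 sigma1 omega1 O1 m10 s10 N N1 xi (v k) (Iset K) N0 N1e (esym N1E)) => //.
  - exact: v2.
  - exact: Iset_uniq.
  - move=> l lK; apply: (window_out O1 m10 N1_gt0).
    have h := Iset_out R Ke lK; have h2 := v2 k ks.
    rewrite (le_trans _ (lerB_dist _ _)) // normrM normfV (gtr0_norm N1_gt0).
    rewrite lerBrDr ler_pdivlMr // mulrDl divfK ?gt_eqF //.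
    have h3 := ler_wpM2r (ltW N1_gt0) h2; move: h; rewrite /K natrD natrM; lra.
(* here |x / sigma1| <= 1 / (2 sigma1), and the bound on m2 keeps the support of
   the shifted phi2 within [-1/2, 1/2] *)
have hA l : l \in Iset K -> cabs (A l - ex l) <= E2.
  move=> lK; have lR := Iset_in R Ke lK.
  have KR0 : 0 < K%:R :> R by rewrite ltr0n.
  have := @fourier_window_real R m2 sigma2 omega2 O2 m20 s20 N2%:R N2_gt0 K%:R KR0 (esym N2E) l%:~R lR.
  rewrite -/phi2 => -[gE /andP[g0 gle]].
  have G0 := lt_le_trans g0 gle.
  have x1 : `|x / sigma1| <= sigma1^-1 / 2.
    by rewrite normrM normfV (gtr0_norm s10) mulrC ler_wpM2l // invr_ge0 ltW.
  have s1V : sigma1^-1 <= 1 by rewrite invf_le1 // ltW.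
  have N2ev : ~~ odd N2 by case/andP: N2e.
  have h := @nfft_error R m2 sigma2 omega2 O2 m20 s20 K N2 l%:~R (x / sigma1) (Iset N2)
    K0 N2e (esym N2E) lR.
  have {h} := h (le_trans x1 _) (Iset_uniq _) _.
  rewrite -/phi2 -/E2 => h.
  have gn0 : fourier phi2 l%:~R != 0.
    by rewrite gE -(rmorph0 (real_complex R)) (inj_eq (@complexI _)) gt_eqF.
  have -> : A l - ex l = (N2%:R^-1%:C * (\sum_(q <- Iset N2) (phi2 (q%:~R / N2%:R - x / sigma1))%:C
      * expi (- (2 * pi * l%:~R * (q%:~R / N2%:R))))
    - fourier phi2 l%:~R * expi (- (2 * pi * l%:~R * (x / sigma1)))) / fourier phi2 l%:~R.
    rewrite mulrBl [X in _ = _ - X]mulrAC mulfV // mul1r /A /ex xiE invC; congr (_ * _ / _ - _).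
    apply: eq_bigr => q _; congr (_%:C * _).
    by rewrite -[RHS](window_even N2%:R O2) opprB.
  rewrite cabsM cabsV gE cabsR (gtr0_norm G0) ler_pdivrMr // [leRHS]mulrC.
  rewrite gE in h; apply: h.
  - by rewrite ler_pdivrMr // mulVf.
  - move=> q qN; apply: (window_out O2 m20 N2_gt0).
    have h := Iset_out R N2ev qN.
    rewrite (le_trans _ (lerB_dist _ _)) // normrM normfV (gtr0_norm N2_gt0).
    have h1 : 2^-1 <= `|q%:~R| / N2%:R :> R by rewrite ler_pdivlMr // mulrC.
    have h2 : m2%:R / N2%:R <= (1 - sigma1^-1) / 2.
      by rewrite ler_pdivrMr //; move: m2le; lra.
    by move: x1 h1 h2; lra.
rewrite /nnfft nnfft_exchange -/xi.
have fn0 : fourier phi1 xi != 0.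
  by rewrite fE -(rmorph0 (real_complex R)) (inj_eq (@complexI _)) gt_eqF.
set g := nnfft_g N1 phi1 s f v.
have gle l : cabs (g l) <= N1%:R^-1 * F.
  rewrite /g /nnfft_g invC cabsM cabsR ger0_norm ?invr_ge0 ?(ltW N1_gt0) //.
  rewrite ler_wpM2l ?invr_ge0 ?(ltW N1_gt0) // (le_trans (cabs_sum _ _ _)) //.
  apply: ler_sum => k _; rewrite cabsM cabsR.
  have /andP[p0 p1] := window01 N1%:R O1 (l%:~R / N1%:R - v k).
  by rewrite ger0_norm // ler_piMr // cabs_ge0.
have sumB : \sum_(l <- Iset K) g l * ex l = \sum_(k <- s) f k * B k.
  rewrite /g /nnfft_g; under eq_bigr => l _ do rewrite mulr_sumr mulr_suml.
  rewrite exchange_big /=; apply: eq_bigr => k _; rewrite /B !mulr_sumr.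
  by apply: eq_bigr => l _; rewrite /ex; ring.
have split : \sum_(k <- s) f k * expi (- (2 * pi * xi * v k)) -
    (\sum_(l <- Iset K) g l * A l) / fourier phi1 xi =
  - ((\sum_(k <- s) f k * (B k - fourier phi1 xi * expi (- (2 * pi * xi * v k)))
    + \sum_(l <- Iset K) g l * (A l - ex l)) / fourier phi1 xi).
  have -> : \sum_(k <- s) f k * (B k - fourier phi1 xi * expi (- (2 * pi * xi * v k))) =
     \sum_(k <- s) f k * B k - fourier phi1 xi * \sum_(k <- s) f k * expi (- (2 * pi * xi * v k)).
    by rewrite mulr_sumr -sumrB; apply: eq_bigr => k _; ring.
  have -> : \sum_(l <- Iset K) g l * (A l - ex l) =
     \sum_(l <- Iset K) g l * A l - \sum_(l <- Iset K) g l * ex l.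
    by rewrite -sumrB; apply: eq_bigr => l _; ring.
  by rewrite sumB; field.
rewrite [X in cabs X]split cabsN cabsM cabsV fE cabsR (gtr0_norm Phi0) ler_pdivrMr //.
rewrite (le_trans (cabsD _ _)) //.
have b1 : cabs (\sum_(k <- s) f k * (B k - Phi%:C * expi (- (2 * pi * xi * v k))))
    <= Phi * E1 * F.
  rewrite (le_trans (cabs_sum _ _ _)) // /F mulr_sumr big_seq [leRHS]big_seq.
  by apply: ler_sum => k ks; rewrite cabsM mulrC ler_wpM2r ?cabs_ge0 // -fE vB.
have b2 : cabs (\sum_(l <- Iset K) g l * (A l - ex l)) <= a * E2 * F.
  apply: (le_trans (cabs_sum _ _ _)).
  apply: (@le_trans _ _ (\sum_(l <- Iset K) N1%:R^-1 * F * E2)).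
    rewrite big_seq [leRHS]big_seq; apply: ler_sum => l lK; rewrite cabsM.
    by apply: ler_pM; rewrite ?cabs_ge0 ?gle ?hA.
  rewrite big_const_seq count_predT size_Iset iter_addr_0.
  have -> : N1%:R^-1 * F * E2 *+ K = a * E2 * F.
    by rewrite -mulr_natr /K /a natrD natrM; field; rewrite gt_eqF.
  exact: lexx.
rewrite (le_trans (lerD b1 b2)) //.
have a1 : a * E2 <= a / phi1hat * E2 * Phi.
  have hp : 1 <= Phi / phi1hat by rewrite (ler_pdivlMr _ _ d0) mul1r.
  have -> : a / phi1hat * E2 * Phi = (a * E2) * (Phi / phi1hat) by ring.
  by apply: (ler_peMr _ hp); apply: mulr_ge0; [exact: a_ge0 | exact: E2_ge0].
have -> : (E1 + a / phi1hat * E2) * F * Phi = Phi * E1 * F + a / phi1hat * E2 * Phi * F.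
  by ring.
by rewrite lerD2l; apply: ler_wpM2r.
Qed.

End NNFFTError.

(** * Clenshaw-Curtis quadrature *)

(** For j in [0, h], which of j + r and j - r vanish modulo 2 h: one of them only
    at the folded index, and both only if that index is 0 or h, which is where
    the quadrature weights are halved. *)
Lemma fold_index_cases (h j r : nat) : (j < h.+1)%N -> (r < 2 * h)%N ->
  let f := if (r <= h)%N then r else (2 * h - r)%N in
  (j == f) = ((j + r == 0)%N || (j + r == 2 * h)%N) || (j == r)%N /\
  ((j + r == 0)%N || (j + r == 2 * h)%N) && (j == r)%N =
      ((2 * j == 0)%N || (2 * j == 2 * h)%N) && (j == f).
Proof. by move=> jh rh /=; case: leqP => rh'; split; apply/idP/idP; lia. Qed.

Section ClenshawCurtis.
Variable R : realType.

Definition cc_eps2 (n k : nat) : R := if (k == 0)%N || (k == n) then 2^-1 else 1.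

Lemma cc_epsE n k : cc_eps R n k ^+ 2 = cc_eps2 n k.
Proof.
rewrite /cc_eps /cc_eps2; case: ifP => _; last by rewrite expr1n.
by rewrite expr_div_n sqr_sqrtr // expr2; field.
Qed.

Lemma sum_cc_eps2 n (g : nat -> R) : (0 < n)%N ->
  \sum_(0 <= k < n.+1) cc_eps2 n k * g k =
  2^-1 * g 0%N + \sum_(1 <= k < n.+1) g k - 2^-1 * g n.
Proof.
move=> n0; rewrite big_nat_recr //= big_ltn //.
rewrite [in RHS]big_nat_recr //= /cc_eps2 !eqxx orbT /=.
rewrite (eq_big_nat _ _ (F2 := g)); first by field.
by move=> k /andP[k0 kn]; rewrite gtn_eqF // ltn_eqF // mul1r.
Qed.

Lemma sin_pi_eq0 (y : R) : sin (pi * y) = 0 -> y = (Num.floor y)%:~R.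
Proof.
set k := Num.floor y => s0; apply/eqP; rewrite -subr_eq0; apply: contraPT s0 => yk.
have /andP[k1 k2] := floor_itv y; rewrite -/k in k1 k2.
have ->: pi * y = pi * (y - k%:~R) + pi * k%:~R by ring.
have p0 : 0 < sin (pi * (y - k%:~R)).
  have f0 : 0 < y - k%:~R by rewrite lt_neqAle eq_sym yk subr_ge0.
  have f1 : y - k%:~R < 1 by rewrite ltrBlDl; move: k2; rewrite intrD.
  by apply: sin_gt0_pi; rewrite mulr_gt0 ?pi_gt0 //= gtr_pMr ?pi_gt0.
rewrite sinD; have sk (j : nat) : sin (pi * j%:R) = 0 :> R.
  by elim: j => [|j IH]; rewrite ?mulr0 ?sin0 // -natr1 mulrDr mulr1 sinDpi IH oppr0.
have ck (j : nat) : cos (pi * j%:R) != 0 :> R.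
  elim: j => [|j IH]; first by rewrite mulr0 cos0 oner_neq0.
  by rewrite -natr1 mulrDr mulr1 cosDpi oppr_eq0.
have [ssk cck] : sin (pi * k%:~R) = 0 :> R /\ cos (pi * k%:~R) != 0 :> R.
  by case: (k) => j; rewrite ?NegzE ?mulrNz ?mulrN ?sinN ?cosN -?pmulrn sk ?oppr0 ck.
by rewrite ssk mulr0 addr0; apply/eqP; rewrite mulf_neq0 // gt_eqF.
Qed.

(** With halved ends, the trapezoidal sum is half a Dirichlet kernel minus half
    of its last cosine. As 2 n y is an integer, sin (2 pi n y) = 0 and the closed
    form of the kernel leaves nothing unless y is an integer. *)
Lemma sum_cos_trap n (y : R) : (0 < n)%N -> 2 * n%:R * y = (Num.floor (2 * n%:R * y))%:~R ->
  \sum_(0 <= k < n.+1) cc_eps2 n k * cos (2 * pi * k%:R * y) =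
  if y == (Num.floor y)%:~R then n%:R else 0.
Proof.
move=> n0 hint; rewrite (sum_cc_eps2 (fun k => cos (2 * pi * k%:R * y))) //.
rewrite mulr0 mul0r cos0 mulr1.
have -> : 2^-1 + \sum_(1 <= k < n.+1) cos (2 * pi * k%:R * y) = 2^-1 * dirichlet n y.
  by rewrite /dirichlet; field.
case: ifPn => [/eqP yE|yn].
  have h k : cos (2 * pi * k%:R * y) = 1.
    rewrite yE -[LHS](_ : cos (0 + 2 * pi * (k%:Z * Num.floor y)%:~R) = _).
      by rewrite cos_2piz cos0.
    by rewrite add0r intrM !mulrA.
  rewrite /dirichlet; under eq_bigr do rewrite h.
  by rewrite h big_const_nat iter_addr_0 subn1 /=; field.
have sn : sin (pi * y) != 0 by apply: contraNneq yn => /sin_pi_eq0/eqP.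
apply: (mulfI sn); rewrite mulr0 mulrBr mulrCA sin_dirichlet.
have -> : (2 * n%:R + 1) * (pi * y) = 2 * pi * n%:R * y + pi * y by ring.
rewrite sinD.
have -> : sin (2 * pi * n%:R * y) = 0.
  have -> : 2 * pi * n%:R * y = pi * (2 * n%:R * y) by ring.
  rewrite hint; case: (Num.floor _) => j; rewrite ?NegzE ?mulrNz ?mulrN ?sinN -?pmulrn.
    by elim: j => [|j IH]; rewrite ?mulr0 ?sin0 // -natr1 mulrDr mulr1 sinDpi IH oppr0.
  move: j.+1 => {}j; apply/eqP; rewrite oppr_eq0; apply/eqP.
  by elim: j => [|j IH]; rewrite ?mulr0 ?sin0 // -natr1 mulrDr mulr1 sinDpi IH oppr0.
ring.
Qed.

Variable h : nat.
Hypothesis h0 : (0 < h)%N.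
Let n := (2 * h)%N.
Let n0 : (0 < n)%N. Proof. by rewrite muln_gt0. Qed.
Let nR0 : 0 < n%:R :> R. Proof. by rewrite ltr0n. Qed.

Lemma cc_weightE k : cc_weight R n k = n%:R^-1 * cc_eps2 n k *
  \sum_(0 <= j < h.+1) cc_eps2 n (2 * j) * (2 / (1 - 4 * j%:R ^+ 2))
    * cos (2 * j%:R * k%:R * pi / n%:R).
Proof.
rewrite /cc_weight cc_epsE; congr (_ * _); rewrite /n mul2n doubleK.
by apply: eq_bigr => j _; rewrite cc_epsE.
Qed.

Lemma cc_weight_sym k : (k <= n)%N -> cc_weight R n (n - k) = cc_weight R n k.
Proof.
move=> kn; rewrite !cc_weightE; congr (_ * _ * _).
  rewrite /cc_eps2; have -> : (n - k == 0)%N || (n - k == n)%N = ((k == 0)%N || (k == n)) by lia.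
  by [].
apply: eq_bigr => j _; congr (_ * _).
rewrite natrB // mulrBr mulrBl mulrBl.
have -> : 2 * j%:R * n%:R * pi / n%:R = 2 * pi * j%:R :> R by field; rewrite gt_eqF.
by rewrite addrC cos_2pin cosN.
Qed.

Lemma sum_cc_rev (g : nat -> R) :
  \sum_(0 <= k < n.+1) cc_weight R n k * g k =
  \sum_(0 <= k < n.+1) cc_weight R n k * g (n - k)%N.
Proof.
rewrite big_nat_rev /=; apply: eq_big_nat => k /andP[_ kn].
by rewrite add0n subSS cc_weight_sym.
Qed.

Lemma cheb_rev k : (k <= n)%N -> cheb R n (n - k) = - cheb R n k.
Proof.
move=> kn; rewrite /cheb natrB // mulrBl mulrBl mulrAC mulfV ?gt_eqF // mul1r.
by rewrite -opprB cosN -[LHS]opprK -cosDpi subrK.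
Qed.

(** Reversing the order of the nodes changes their sign but not the weights. *)
Lemma cc_odd (g : R -> R) : (forall z, g (- z) = - g z) ->
  \sum_(0 <= k < n.+1) cc_weight R n k * g (cheb R n k) = 0.
Proof.
move=> go; set S := LHS; suff : S = - S by lra.
rewrite {1}/S sum_cc_rev -sumrN; apply: eq_big_nat => k /andP[_ kn].
by rewrite cheb_rev // go mulrN.
Qed.

(** On the grid k pi / n, the function cos (2 l theta) coincides with
    cos (2 f theta) for this index f in [0, h]. *)
Definition fold_index (l : nat) : nat :=
  if (l %% n <= h)%N then (l %% n)%N else (n - l %% n)%N.

Lemma fold_index_le l : (fold_index l <= h)%N.
Proof. by rewrite /fold_index; case: ifPn => //; rewrite -ltnNge /n; move: (_ %% _)%N => r; lia. Qed.

Lemma fold_index_small l : (l <= h)%N -> fold_index l = l.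
Proof. by move=> lh; rewrite /fold_index modn_small ?lh // /n; lia. Qed.

Lemma int_ratio (k : int) : ((k%:~R / n%:R : R) == (Num.floor (k%:~R / n%:R : R))%:~R) = (n%:Z %| k)%Z.
Proof.
apply/eqP/dvdzP => [hk|[q ->]].
  exists (Num.floor (k%:~R / n%:R : R)); apply/eqP; rewrite -(eqr_int R) intrM -hk.
  by rewrite divfK // gt_eqF.
by rewrite intrM mulfK ?gt_eqF // intrKfloor.
Qed.

(** Expanding the weights yields trapezoidal sums at the frequencies j + l and
    j - l, and only j = fold_index l survives. So the rule returns the mean of
    the Chebyshev polynomial that it confuses with the given one; for l <= h the
    two are equal and the rule is exact. *)
Lemma cc_cos_even l : \sum_(0 <= k < n.+1) cc_weight R n k * cos ((2 * l)%:R * (k%:R * pi / n%:R)) =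
  (1 - 4 * (fold_index l)%:R ^+ 2)^-1.
Proof.
have nn0 : n%:R != 0 :> R by rewrite gt_eqF.
have trap (k : int) : \sum_(0 <= i < n.+1) cc_eps2 n i * cos (2 * pi * i%:R * (k%:~R / n%:R)) =
    if (n%:Z %| k)%Z then n%:R else 0.
  rewrite sum_cos_trap ?int_ratio //.
  have -> : 2 * n%:R * (k%:~R / n%:R) = (2 * k)%:~R :> R by rewrite intrM; field.
  by rewrite intrKfloor.
transitivity (n%:R^-1 * \sum_(0 <= j < h.+1) cc_eps2 n (2 * j) * (2 / (1 - 4 * j%:R ^+ 2)) *
  (2^-1 * ((if (n%:Z %| j%:Z + l%:Z)%Z then n%:R else 0) +
     (if (n%:Z %| j%:Z - l%:Z)%Z then n%:R else 0)))).
  have step k (c : R) : cc_weight R n k * c = n%:R^-1 * \sum_(0 <= j < h.+1)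
      (cc_eps2 n k * (cc_eps2 n (2 * j) * (2 / (1 - 4 * j%:R ^+ 2))
        * cos (2 * j%:R * k%:R * pi / n%:R)) * c).
    by rewrite cc_weightE -mulr_suml -mulr_sumr !mulrA.
  under eq_bigr => k _ do rewrite step.
  rewrite -mulr_sumr; congr (_ * _).
  rewrite exchange_big /=; apply: eq_bigr => j _.
  rewrite -!trap -big_split /= !mulr_sumr; apply: eq_bigr => k _.
  have -> : 2 * pi * k%:R * ((j%:Z + l%:Z)%:~R / n%:R) =
    2 * j%:R * k%:R * pi / n%:R + (2 * l)%:R * (k%:R * pi / n%:R) :> R.
    by rewrite intrD -!pmulrn natrM; field.
  have -> : 2 * pi * k%:R * ((j%:Z - l%:Z)%:~R / n%:R) =
    2 * j%:R * k%:R * pi / n%:R - (2 * l)%:R * (k%:R * pi / n%:R) :> R.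
    by rewrite intrB -!pmulrn natrM; field.
  rewrite cosD cosB; move: (2 / _) => D; by field.
(* at j = 0 and j = h both conditions hold, which makes up for the weight 1/2 *)
have sel j : (j < h.+1)%N -> cc_eps2 n (2 * j) *
    (2^-1 * ((if (n%:Z %| j%:Z + l%:Z)%Z then n%:R else 0) +
     (if (n%:Z %| j%:Z - l%:Z)%Z then n%:R else 0))) =
   if j == fold_index l then n%:R / 2 else 0.
  move=> jh; set r := (l %% n)%N; have rn : (r < n)%N by rewrite ltn_mod.
  have lE : l%:Z = (l %/ n)%:Z * n%:Z + r%:Z by rewrite {1}(divn_eq l n) PoszD PoszM.
  have nZ0 : 0 < n%:Z by rewrite ltz_nat.
  have nh : n%:Z = 2 * h%:Z by [].
  have d1 : (n%:Z %| j%:Z + l%:Z)%Z = ((j + r == 0)%N || (j + r == n)%N).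
    apply/dvdzP/idP => [[q E]|].
      have E1 : j%:Z + r%:Z = (q - (l %/ n)%:Z) * n%:Z by rewrite mulrBl -E lE; ring.
      move: E1; move: (q - _) => t E1.
      have t0 : 0 <= t by rewrite -(pmulr_lge0 _ nZ0) -E1; lia.
      have t2 : t < 2 by rewrite -(ltr_pM2r nZ0) -E1; lia.
      have : t = 0 \/ t = 1 by lia.
      by case=> tE; move: E1; rewrite tE ?mul0r ?mul1r; lia.
    case/orP => /eqP E; [exists (l %/ n)%:Z|exists ((l %/ n)%:Z + 1)].
      by rewrite lE; lia.
    by rewrite lE mulrDl mul1r; lia.
  have d2 : (n%:Z %| j%:Z - l%:Z)%Z = (j == r)%N.
    apply/dvdzP/idP => [[q E]|/eqP ->].
      have E1 : j%:Z - r%:Z = (q + (l %/ n)%:Z) * n%:Z by rewrite mulrDl -E lE; ring.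
      move: E1; move: (q + _) => t E1.
      have t0 : -1 < t by rewrite -(ltr_pM2r nZ0) -E1; lia.
      have t2 : t < 1 by rewrite -(ltr_pM2r nZ0) -E1; lia.
      have tE : t = 0 by lia.
      by move: E1; rewrite tE mul0r; lia.
    by exists (- (l %/ n)%:Z); rewrite lE; ring.
  rewrite d1 d2 /cc_eps2.
  have nh' : n = (2 * h)%N by [].
  have [f1 f2] := @fold_index_cases h j r jh rn.
  rewrite -/n -/(fold_index l) in f1 f2.
  move: f1 f2; set b1 := ((2 * j == 0)%N || _); set b2 := ((j + r == 0)%N || _).
  case: b1; case: b2; case: (j == r)%N; case: (_ == fold_index l) => //= _ _; by field.
rewrite (eq_big_nat _ _ (F2 := fun j => if j == fold_index l then n%:R / (1 - 4 * j%:R ^+ 2) else 0)); last first.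
  move=> j /andP[_ jh]; rewrite mulrAC sel //; case: ifP => _; last by rewrite mul0r.
  by rewrite -mulrA; congr (_ * _); rewrite mulrA mulVf ?mul1r.
rewrite -big_mkcond /= big_nat1_eq ltnS fold_index_le /=.
by rewrite mulrA mulVf ?mul1r.
Qed.

Lemma cc_cos_odd l : odd l ->
  \sum_(0 <= k < n.+1) cc_weight R n k * cos (l%:R * (k%:R * pi / n%:R)) = 0.
Proof.
move=> lo; set S := LHS; suff : S = - S by lra.
rewrite {1}/S (sum_cc_rev (fun k => cos (l%:R * (k%:R * pi / n%:R)))) -sumrN.
apply: eq_big_nat => k /andP[_ kn]; rewrite -mulrN; congr (_ * _).
rewrite natrB // (_ : l%:R * _ = - (l%:R * (k%:R * pi / n%:R)) + pi * l%:R); last first.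
  by field; rewrite gt_eqF.
rewrite (_ : pi * l%:R = pi + 2 * pi * (l./2)%:R).
  by rewrite addrA cos_2pin cosDpi cosN.
by rewrite -[in LHS](odd_double_half l) lo natrD -mul2n natrM /=; ring.
Qed.

Lemma cc_weight_sum : \sum_(0 <= k < n.+1) cc_weight R n k = 1.
Proof.
have := cc_cos_even 0; rewrite fold_index_small // expr0n mulr0 subr0 invr1 => <-.
by apply: eq_bigr => k _; rewrite muln0 mul0r cos0 mulr1.
Qed.

(** The term j = 0 equals 1, and the others sum to at most
    sum 2 / (4 j^2 - 1) = 1 - 1 / (2 h + 1), a telescoping sum. *)
Lemma cc_weight_ge0 k : 0 <= cc_weight R n k.
Proof.
rewrite cc_weightE; apply: mulr_ge0.
  by rewrite mulr_ge0 ?invr_ge0 ?(ltW nR0) // /cc_eps2; case: ifP => _; rewrite ?invr_ge0.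
rewrite big_ltn //; set t0 := (X in 0 <= X + _); have -> : t0 = 1.
  rewrite /t0 /cc_eps2 muln0 eqxx /= expr0n /= !(mulr0, mul0r) subr0 cos0 divr1.
  by rewrite mulr1 mulVf.
rewrite -lerBlDl sub0r.
(* the terms are 1 / (2 j - 1) - 1 / (2 j + 1) *)
have tele H : \sum_(1 <= j < H.+1) (2 / (4 * j%:R ^+ 2 - 1)) = 1 - (2 * H%:R + 1)^-1 :> R.
  elim: H => [|H IH]; first by rewrite big_geq // mulr0 add0r invr1 subrr.
  rewrite big_nat_recr //= IH -natr1.
  have H0 : 0 <= H%:R :> R by [].
  by field; rewrite !lt0r_neq0 //; nra.
apply: (@le_trans _ _ (- (1 - (2 * h%:R + 1)^-1))).
  by rewrite lerN2 gerBl invr_ge0 addr_ge0 // mulr_ge0.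
rewrite -tele -sumrN; apply: ler_sum_nat => j /andP[j0 _].
have j1 : 1 <= j%:R :> R by rewrite ler1n.
have d0 : 0 < 4 * j%:R ^+ 2 - 1 :> R by nra.
have -> : 2 / (1 - 4 * j%:R ^+ 2) = - (2 / (4 * j%:R ^+ 2 - 1)) :> R.
  by rewrite -opprB invrN mulrN.
set D := 2 / _; have D0 : 0 <= D by rewrite divr_ge0 // ltW.
have e01 : 0 <= cc_eps2 n (2 * j) <= 1.
  by rewrite /cc_eps2; case: ifP => _; apply/andP; split; lra.
have /andP[e0 e1] := e01.
have := @cos_le1 R (2 * j%:R * k%:R * pi / n%:R).
move: (cos _) (cc_eps2 _ _) e0 e1 => x y y0 y1 x2.
rewrite mulrN mulNr lerN2 mulrAC; apply: ler_piMl => //.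
by have := ler_wpM2l y0 x2; lra.
Qed.

End ClenshawCurtis.

(** * Symmetric Laurent polynomials *)

Section SymmetricLaurent.
Local Open Scope complex_scope.
Variable F : fieldType.

(** These are the polynomials of degree at most P in z = (u + 1/u) / 2. The
    variable u is kept because u = exp (i t) gives a cosine sum, and
    u = rho exp (i t) the values on an ellipse. The constant term is 2 a_0. *)
Definition sym_laurent (P : nat) (f : F -> F) : Prop :=
  exists a : nat -> F, forall u, u != 0 ->
    f u = \sum_(0 <= k < P.+1) a k * (u ^+ k + u^-1 ^+ k).

Lemma sym_laurentD P f g : sym_laurent P f -> sym_laurent P g ->
  sym_laurent P (fun u => f u + g u).
Proof.
move=> [a ha] [b hb]; exists (fun k => a k + b k) => u u0.
by rewrite ha // hb // -big_split /=; apply: eq_bigr => k _; rewrite mulrDl.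
Qed.

Lemma sym_laurentZ P f c : sym_laurent P f -> sym_laurent P (fun u => c * f u).
Proof.
move=> [a ha]; exists (fun k => c * a k) => u u0.
by rewrite ha // mulr_sumr; apply: eq_bigr => k _; rewrite mulrA.
Qed.

Lemma sym_laurent_basis P k : (k <= P)%N ->
  sym_laurent P (fun u => u ^+ k + u^-1 ^+ k).
Proof.
move=> kP; exists (fun j => (j == k)%:R) => u u0.
rewrite (bigD1_seq k) ?mem_index_iota ?iota_uniq //= eqxx mul1r.
by rewrite big1 ?addr0 // => j /negbTE ->; rewrite mul0r.
Qed.

Lemma sym_laurent_sum P (I : Type) (s : seq I) (f : I -> F -> F) :
  (forall i, sym_laurent P (f i)) -> sym_laurent P (fun u => \sum_(i <- s) f i u).
Proof.
move=> hf; elim: s => [|i s [a ha]].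
  exists (fun=> 0) => u u0; rewrite big_nil big1 // => k _; exact: mul0r.
have [b hb] := sym_laurentD (hf i) (ex_intro _ a ha).
by exists b => u u0; rewrite big_cons hb.
Qed.

Lemma sym_laurent_ext P f g : (forall u, u != 0 -> f u = g u) ->
  sym_laurent P f -> sym_laurent P g.
Proof. by move=> fg [a ha]; exists a => u u0; rewrite -fg // ha. Qed.

(** From (u + 1/u) (u^k + u^-k) = (u^(k+1) + u^-(k+1)) + (u^(k-1) + u^-(k-1)). *)
Lemma sym_laurentM P f : sym_laurent P f ->
  sym_laurent P.+1 (fun u => (u + u^-1) * f u).
Proof.
(* the clamped exponents only matter for k > P, where the coefficient is 0, so
   that every term is a symmetric Laurent polynomial *)
move=> [a ha]; apply: (@sym_laurent_ext _ (fun u => \sum_(k <- index_iota 0 P.+1)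
    (if (k <= P)%N then a k else 0) * ((u ^+ (minn k P).+1 + u^-1 ^+ (minn k P).+1) +
      (if k is j.+1 then u ^+ (minn j P) + u^-1 ^+ (minn j P) else u ^+ 1 + u^-1 ^+ 1)))).
  move=> u u0; rewrite ha // mulr_sumr; apply: eq_big_nat => k /andP[_]; rewrite ltnS => kP.
  rewrite kP (minn_idPl kP); case: k kP => [|k] kP.
    by rewrite !expr1 !expr0; ring.
  rewrite (minn_idPl (ltnW kP)) !exprS; move: (u ^+ k) (u^-1 ^+ k) => x y; field.
  by [].
apply: sym_laurent_sum => k; apply: sym_laurentZ; apply: sym_laurentD.
  by apply: sym_laurent_basis; rewrite ltnS geq_minr.
case: k => [|k]; first exact: sym_laurent_basis.
by apply: sym_laurent_basis; rewrite leqW // geq_minr.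
Qed.

Lemma sym_laurentS P f : sym_laurent P f -> sym_laurent P.+1 f.
Proof.
move=> [a ha]; exists (fun k => if (k <= P)%N then a k else 0) => u u0.
rewrite big_nat_recr //= ltnn mul0r addr0 ha //.
by apply: eq_big_nat => k /andP[_]; rewrite ltnS => ->.
Qed.

Lemma sym_laurent_pow (two0 : (2 : F) != 0) (w : F) P :
  sym_laurent P (fun u => (1 + w * ((u + u^-1) / 2)) ^+ P).
Proof.
elim: P => [|P IH].
  exists (fun=> 2^-1) => u u0; rewrite big_nat1 !expr0; field.
  by [].
apply: (@sym_laurent_ext _ (fun u => (1 + w * ((u + u^-1) / 2)) ^+ P +
   w / 2 * ((u + u^-1) * (1 + w * ((u + u^-1) / 2)) ^+ P))).
  by move=> u u0; rewrite exprS; field; apply/andP.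
apply: sym_laurentD; first exact: sym_laurentS.
by apply: sym_laurentZ; exact: sym_laurentM.
Qed.

End SymmetricLaurent.

(** * Laurent coefficients by averaging over roots of unity *)

Section RootsOfUnity.
Local Open Scope complex_scope.
Variable R : realType.

Lemma expi_2piz (k : int) : expi (2 * pi * k%:~R) = 1 :> R[i].
Proof. by rewrite /expi -[2 * pi * _]add0r cos_2piz sin_2piz cos0 sin0. Qed.

Lemma expi_neq1 (t : R) : 0 < `|t| -> `|t| < 2 * pi -> expi t != 1.
Proof.
move=> t0 t2; apply/eqP => /(congr1 (@complex.Re R)) /= ct.
have : sin (`|t| / 2) ^+ 2 = 0.
  have e : `|t| / 2 *+ 2 = `|t| by rewrite -[LHS]mulr_natr divfK.
  have := cos_mulr2n (`|t| / 2); rewrite e cos_norm ct cos2sin2 mulr2n; lra.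
move/eqP; rewrite sqrf_eq0 => /eqP s0.
have : 0 < sin (`|t| / 2).
  by apply: sin_gt0_pi; apply/andP; split; [lra|rewrite ltr_pdivrMr // mulrC].
by rewrite s0 ltxx.
Qed.

Lemma sum_roots (q : nat) (d : int) : (0 < q)%N -> (`|d| < q)%N ->
  \sum_(0 <= j < q) expi (2 * pi * (d%:~R * j%:R / q%:R)) =
  (if d == 0 then q%:R else 0 : R[i]).
Proof.
move=> q0 dq; have qR : 0 < q%:R :> R by rewrite ltr0n.
case: eqP => [->|/eqP dn0].
  under eq_bigr do rewrite mul0r mul0r mulr0 expi0.
  by rewrite big_const_nat iter_addr_0 subn0.
set z : R[i] := expi (2 * pi * (d%:~R / q%:R)).
have zj j : expi (2 * pi * (d%:~R * j%:R / q%:R)) = z ^+ j :> R[i].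
  by rewrite -expiMn; congr expi; ring.
under eq_bigr do rewrite zj.
have zq : z ^+ q = 1.
  rewrite -zj -[RHS](expi_2piz d); congr expi; field; by rewrite gt_eqF.
have z1 : z - 1 != 0.
  rewrite subr_eq0; apply: expi_neq1.
    rewrite normr_gt0; apply: mulf_neq0; first by apply: mulf_neq0; [rewrite pnatr_eq0|exact: pi_neq0].
    by apply: mulf_neq0; [rewrite intr_eq0|rewrite invr_eq0 gt_eqF].
  rewrite !normrM normfV (gtr0_norm qR) (gtr0_norm (pi_gt0 R)) (@ger0_norm _ 2) //.
  rewrite -[ltRHS]mulr1 ltr_pM2l ?mulr_gt0 ?pi_gt0 // ltr_pdivrMr // mul1r.
  by rewrite -intr_norm -[q%:R]/(q%:Z%:~R) ltr_int; lia.
apply: (mulfI z1); rewrite mulr0 big_mkord -subrX1 zq subrr //.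
Qed.

(** A discrete form of Cauchy's estimate. Averaging f (rho exp (i theta))
    exp (- i k theta) over the q = 2 P + 1 angles 2 pi j / q gives exactly
    a_k rho^k: for l <= P and 0 < k <= P, the integer - l - k is never divisible
    by q, and l - k only for l = k. *)
Lemma laurent_coef_bound (P : nat) (a : nat -> R[i]) (f : R[i] -> R[i]) (rho B : R) :
  0 < rho ->
  (forall u, u != 0 -> f u = \sum_(0 <= k < P.+1) a k * (u ^+ k + u^-1 ^+ k)) ->
  (forall t : R, cabs (f (rho%:C * expi t)) <= B) ->
  forall k, (0 < k <= P)%N -> cabs (a k) <= B / rho ^+ k.
Proof.
move=> rho0 hf hB k /andP[k0 kP].
pose q := (2 * P).+1; have q0 : (0 < q)%N by [].
have qR : 0 < q%:R :> R by rewrite ltr0n.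
pose th (j : nat) : R := 2 * pi * (j%:R / q%:R).
have rC0 : rho%:C != 0 :> R[i].
  by rewrite -(rmorph0 (real_complex R)) (inj_eq (@complexI _)) gt_eqF.
have avg : \sum_(0 <= j < q) f (rho%:C * expi (th j)) * expi (- (k%:R * th j)) =
   q%:R * (a k * rho%:C ^+ k).
  under eq_bigr => j _ do rewrite hf ?mulf_neq0 ?expi_neq0 // mulr_suml.
  rewrite exchange_big /= (bigD1_seq k) ?mem_index_iota ?iota_uniq //=.
  have inner l : \sum_(0 <= j < q) a l * ((rho%:C * expi (th j)) ^+ l +
       (rho%:C * expi (th j))^-1 ^+ l) * expi (- (k%:R * th j)) =
     a l * (rho%:C ^+ l * \sum_(0 <= j < q) expi (2 * pi * ((l%:Z - k%:Z)%:~R * j%:R / q%:R)) +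
       rho%:C^-1 ^+ l * \sum_(0 <= j < q) expi (2 * pi * ((- l%:Z - k%:Z)%:~R * j%:R / q%:R))).
    rewrite !mulr_sumr -big_split /= mulr_sumr; apply: eq_bigr => j _.
    have -> : expi (2 * pi * ((l%:Z - k%:Z)%:~R * j%:R / q%:R)) =
        expi (th j) ^+ l * expi (- (k%:R * th j)) :> R[i].
      by rewrite -expiMn -expiD intrB -!pmulrn; congr expi; rewrite /th; ring.
    have -> : expi (2 * pi * ((- l%:Z - k%:Z)%:~R * j%:R / q%:R)) =
        (expi (th j))^-1 ^+ l * expi (- (k%:R * th j)) :> R[i].
      rewrite -expiN -expiMn -expiD intrB mulrNz -!pmulrn; congr expi; rewrite /th; ring.
    by rewrite invfM !exprMn; ring.
  rewrite [X in _ + X]big1_seq ?addr0.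
    rewrite inner !sum_roots //; [|lia|lia].
    rewrite subrr eqxx ifF; last by apply/eqP; lia.
    by rewrite mulr0 addr0; ring.
  move=> l /andP[lk]; rewrite mem_index_iota /= => lP.
  rewrite inner !sum_roots //; [|lia|lia].
  rewrite ifF; last by apply/eqP => h; move/eqP: lk; lia.
  by rewrite ifF ?mulr0 ?addr0 ?mulr0 //; apply/eqP; lia.
have : cabs (q%:R * (a k * rho%:C ^+ k)) <= q%:R * B.
  rewrite -avg (le_trans (cabs_sum _ _ _)) //.
  apply: (@le_trans _ _ (\sum_(0 <= j < q) B)).
    by apply: ler_sum => j _; rewrite cabsM cabs_expi mulr1 hB.
  by rewrite big_const_nat iter_addr_0 subn0 mulr_natl.
rewrite !cabsM cabsX cabsR (gtr0_norm rho0).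
have -> : cabs (q%:R : R[i]) = q%:R by rewrite -(rmorph_nat (real_complex R)) cabsR gtr0_norm.
by rewrite ler_pM2l // ler_pdivlMr ?exprn_gt0.
Qed.

End RootsOfUnity.

(** * Powers of a linear function and their means *)

Section PowerOfLinear.
Local Open Scope complex_scope.
Variable R : realType.
Implicit Types (c z : R).

(** For c = x / n this tends to exp (i x z) as n grows. *)
Definition linpow c n z : R[i] := (1 +i* (c * z)) ^+ n.

Lemma linpowS c n z :
  (complex.Re (linpow c n.+1 z) = complex.Re (linpow c n z) - c * z * complex.Im (linpow c n z)) *
  (complex.Im (linpow c n.+1 z) = complex.Im (linpow c n z) + c * z * complex.Re (linpow c n z)).
Proof.
by rewrite /linpow exprS; case: (_ ^+ n) => a b /=; split; rewrite mul1r // addrC.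
Qed.

Lemma is_derive_linpow c n (z : R) :
  is_derive z 1 (fun z => complex.Re (linpow c n.+1 z)) (- (n.+1%:R * c * complex.Im (linpow c n z))) /\
  is_derive z 1 (fun z => complex.Im (linpow c n.+1 z)) (n.+1%:R * c * complex.Re (linpow c n z)).
Proof.
elim: n => [|n [IH1 IH2]].
  split.
    have -> : (fun z => complex.Re (linpow c 1 z)) = cst 1.
      by apply/funext => y; rewrite /linpow expr1.
    by apply: is_derive_eq; rewrite /linpow expr0 /= mulr0 oppr0.
  have -> : (fun z => complex.Im (linpow c 1 z)) = (fun z => c * z).
    by apply/funext => y; rewrite /linpow expr1.
  by apply: is_derive_eq; rewrite /GRing.scale /linpow expr0 /=; ring.
split.
  have -> : (fun z => complex.Re (linpow c n.+2 z)) =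
      (fun z => complex.Re (linpow c n.+1 z) - c * z * complex.Im (linpow c n.+1 z)).
    by apply/funext => y; rewrite linpowS.
  by apply: is_derive_eq; rewrite /GRing.scale /= !(linpowS c n) -(natr1 n.+1); ring.
have -> : (fun z => complex.Im (linpow c n.+2 z)) =
    (fun z => complex.Im (linpow c n.+1 z) + c * z * complex.Re (linpow c n.+1 z)).
  by apply/funext => y; rewrite linpowS.
by apply: is_derive_eq; rewrite /GRing.scale /= !(linpowS c n) -(natr1 n.+1); ring.
Qed.

Lemma linpowN c n z : linpow c n (- z) = (linpow c n z)^*%C.
Proof.
rewrite /linpow rmorphXn /=; congr (_ ^+ n).
by rewrite mulrN.
Qed.

(** An antiderivative of cos (k t) sin t. For k = 1 the first quotient is a
    division by 0, hence 0; this is right, as the sine that it would come from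
    vanishes. *)
Definition cheb_prim (k : nat) (t : R) : R :=
  2^-1 * (cos ((k%:R - 1) * t) / (k%:R - 1) - cos ((k%:R + 1) * t) / (k%:R + 1)).

Lemma is_derive_cheb_prim k (t : R) :
  is_derive t 1 (cheb_prim k) (cos (k%:R * t) * sin t).
Proof.
have dcos (d : R) : is_derive t 1 (fun t => cos (d * t) / d) (- sin (d * t)).
  have [->|d0] := eqVneq d 0.
    have -> : (fun t : R => cos (0 * t) / 0) = cst 0.
      by apply/funext => s; rewrite invr0 mulr0.
    by apply: is_derive_eq; rewrite mul0r sin0 oppr0.
  by apply: is_derive_eq; rewrite /GRing.scale /=; field.
have d1 := dcos (k%:R - 1); have d2 := dcos (k%:R + 1).
rewrite /cheb_prim; apply: is_derive_eq; rewrite /GRing.scale /= mulrBl mulrDl mul1r sinB sinD.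
by field.
Qed.

(** The mean over [-1, 1] of the Chebyshev polynomial T_k. *)
Definition cheb_int (k : nat) : R := if odd k then 0 else (1 - k%:R ^+ 2)^-1.

Lemma cos_npi k : cos (k%:R * pi) = (-1) ^+ k :> R.
Proof.
by rewrite mulr_natl -[_ *+ k]add0r (alternatingn (@cosDpi R)) cos0 mulr1.
Qed.

Lemma cheb_prim_diff k : cheb_prim k pi - cheb_prim k 0 = 2 * cheb_int k.
Proof.
rewrite /cheb_prim /cheb_int !mulr0 cos0.
have -> : cos ((k%:R - 1) * pi) = - (-1) ^+ k :> R.
  by rewrite mulrBl mul1r cosB sinpi mulr0 addr0 cospi mulrN1 cos_npi.
have -> : cos ((k%:R + 1) * pi) = - (-1) ^+ k :> R.
  by rewrite mulrDl mul1r cosD sinpi mulr0 subr0 cospi mulrN1 cos_npi.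
case: ifP => [ko|/negbT ke]; rewrite -signr_odd ?ko ?(negbTE ke) /= ?expr1 ?expr0; first by ring.
have k1 : k%:R - 1 != 0 :> R.
  by rewrite subr_eq0 (eqr_nat _ k 1); apply: contraNneq ke => ->.
have k2 : k%:R + 1 != 0 :> R by rewrite natr1 pnatr_eq0.
have -> : 1 - k%:R ^+ 2 = - ((k%:R - 1) * (k%:R + 1)) :> R by ring.
by field; rewrite k1 k2.
Qed.

Lemma is_derive_sum_nat (m : nat) (f : nat -> R -> R) (f' : nat -> R) (t : R) :
  (forall k, is_derive t 1 (f k) (f' k)) ->
  is_derive t 1 (fun t => \sum_(0 <= k < m) f k t) (\sum_(0 <= k < m) f' k).
Proof.
move=> df; elim: m => [|m IH].
  have -> : (fun t => \sum_(0 <= k < 0) f k t) = cst 0.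
    by apply/funext => s; rewrite big_geq.
  by rewrite big_geq //; exact: is_derive_cst.
have -> : (fun t => \sum_(0 <= k < m.+1) f k t) =
    (fun t => \sum_(0 <= k < m) f k t + f m t).
  by apply/funext => s; rewrite big_nat_recr.
by rewrite big_nat_recr //=; have := df m => dfm; exact: is_deriveD.
Qed.

(** As functions of t, G (cos t) and minus the antiderivatives of the terms
    c_k cos (k t) sin t have the same derivative, so their increments between 0
    and pi agree; this computes the mean of g over [-1, 1]. *)
Lemma cheb_mean (G g : R -> R) (m : nat) (c : nat -> R) :
  (forall z : R, is_derive z 1 G (g z)) ->
  (forall t : R, g (cos t) = \sum_(0 <= k < m) c k * cos (k%:R * t)) ->
  2^-1 * (G 1 - G (- 1)) = \sum_(0 <= k < m) c k * cheb_int k.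
Proof.
move=> dG hg.
pose K (t : R) := G (cos t) + \sum_(0 <= k < m) c k * cheb_prim k t.
have dK (t : R) : is_derive t 1 K 0.
  have d1 : is_derive t 1 (fun t => G (cos t)) (g (cos t) * - sin t).
    by apply: (@is_derive1_comp R G cos t).
  have d2 : is_derive t 1 (fun t => \sum_(0 <= k < m) c k * cheb_prim k t)
     (\sum_(0 <= k < m) c k * (cos (k%:R * t) * sin t)).
    apply: is_derive_sum_nat => k; have := is_derive_cheb_prim k t => dk.
    by apply: is_derive_eq; rewrite /GRing.scale /=; ring.
  rewrite /K; apply: is_derive_eq.
  rewrite hg mulrN mulr_suml addrC; apply/eqP; rewrite subr_eq0; apply/eqP.
  by apply: eq_bigr => k _; rewrite mulrA.
have K0 : K pi = K 0.
  apply/le_anti/andP; split.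
    rewrite -lerN2.
    apply: (@derive_ge0_le R (fun t => - K t) (fun=> 0) 0 pi) => //; first exact: pi_ge0.
    by move=> t _; have := dK t => dKt; apply: is_derive_eq; rewrite oppr0.
  by apply: (@derive_ge0_le R K (fun=> 0) 0 pi) => //; exact: pi_ge0.
move: K0; rewrite /K cos0 cospi => K0.
have : G 1 - G (- 1) = \sum_(0 <= k < m) c k * (cheb_prim k pi - cheb_prim k 0).
  under eq_bigr do rewrite mulrBr.
  rewrite sumrB; move: K0; move: (\sum_(_ <= _ < _) _) (\sum_(_ <= _ < _) _) => s1 s2; lra.
move=> ->; rewrite mulr_sumr; apply: eq_bigr => k _; by rewrite cheb_prim_diff; field.
Qed.

End PowerOfLinear.

(** * Powers of a linear function on an ellipse *)

Section EllipseBound.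
Local Open Scope complex_scope.
Variable R : realType.
Let e : R := expR 1.

Lemma cabs_sqr (z : R[i]) : cabs z ^+ 2 = complex.Re z ^+ 2 + complex.Im z ^+ 2.
Proof. by case: z => a b; rewrite cabs_Complex sqr_sqrtr // addr_ge0 ?sqr_ge0. Qed.

Lemma le_cabs_expR (z : R[i]) (y : R) :
  complex.Re z ^+ 2 + complex.Im z ^+ 2 <= expR (2 * y) -> cabs z <= expR y.
Proof.
rewrite -cabs_sqr mulrC expRM_natr.
by rewrite ler_pXn2r // ?nnegrE ?cabs_ge0 ?expR_ge0.
Qed.

(** The first factor is cosh (|x| sinh 1), a bound for |cos (x z)| on the
    ellipse with half-axes cosh 1 and sinh 1. The second accounts for the P-th
    power in place of the exponential, and tends to 1. *)
Definition ellipse_bound (x : R) (P : nat) : R :=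
  2^-1 * (expR (`|x| * ((e - e^-1) / 2)) + expR (- (`|x| * ((e - e^-1) / 2))))
   * expR (x ^+ 2 * e ^+ 2 / (2 * P%:R)).

Lemma cosh_le (y Y : R) : `|y| <= Y -> expR y + expR (- y) <= expR Y + expR (- Y).
Proof.
rewrite ler_norml => /andP[yY Yy].
have h1 : expR y <= expR Y by rewrite ler_expR.
have h2 : expR (- Y) * expR (- y) <= 1 by rewrite -expRD expR_le1; lra.
have h3 : expR (- Y) * expR Y = 1 by rewrite -expRD addNr expR0.
have h4 : expR (- y) * expR y = 1 by rewrite -expRD addNr expR0.
suff : 0 <= (expR Y - expR y) * (1 - expR (- Y) * expR (- y)).
  have -> : (expR Y - expR y) * (1 - expR (- Y) * expR (- y)) =
    expR Y - expR y - (expR (- Y) * expR Y) * expR (- y) + expR (- Y) * (expR (- y) * expR y) by ring.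
  by rewrite h3 h4; lra.
by rewrite mulr_ge0 // subr_ge0.
Qed.

(** When u runs over the circle of radius e, z = (u + 1/u) / 2 runs over the
    ellipse with foci -1, 1 and half-axes cosh 1, sinh 1, on which |z| <= e. For
    w = i c z one has |1 + w|^2 = 1 + 2 Re w + |w|^2 <= exp (2 Re w + |w|^2). *)
Lemma le_ellipse_bound (x t : R) (P : nat) : (0 < P)%N ->
  cabs (2^-1 * ((1 + (0 +i* (x / P%:R)) * ((e%:C * expi t + (e%:C * expi t)^-1) / 2)) ^+ P +
    (1 + (0 +i* - (x / P%:R)) * ((e%:C * expi t + (e%:C * expi t)^-1) / 2)) ^+ P)) <=
  ellipse_bound x P.
Proof.
move=> P0; have PR : 0 < P%:R :> R by rewrite ltr0n.
have e0 : 0 < e := expR_gt0 1.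
set sh := (e - e^-1) / 2; set ch := (e + e^-1) / 2.
have zE : (e%:C * expi t + (e%:C * expi t)^-1) / 2 = (cos t * ch) +i* (sin t * sh) :> R[i].
  rewrite invfM -expiN -fmorphV /expi cosN sinN.
  have -> : (2 : R[i])^-1 = (2^-1 : R)%:C by rewrite fmorphV rmorph_nat.
  by apply/eqP; rewrite eq_complex /= /ch /sh; apply/andP; split; apply/eqP; ring.
have einv : e^-1 <= 1 by rewrite invf_le1 // -expR0 ler_expR.
have einv0 : 0 < e^-1 by rewrite invr_gt0.
have e1 : 1 <= e by rewrite -expR0 ler_expR.
have sh0 : 0 <= sh by rewrite divr_ge0 // subr_ge0 (le_trans einv).
have shch : sh <= ch by rewrite /sh /ch; lra.
have che : ch <= e by rewrite /ch; lra.
have D : (cos t * ch) ^+ 2 + (sin t * sh) ^+ 2 <= e ^+ 2.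
  have := cos2Dsin2 t; rewrite (exprMn _ _ ch) (exprMn _ _ sh).
  have := sqr_ge0 (cos t); have := sqr_ge0 (sin t) => h1 h2 h3.
  have : sh ^+ 2 <= e ^+ 2 by rewrite ler_pXn2r ?nnegrE //; lra.
  have : ch ^+ 2 <= e ^+ 2 by rewrite ler_pXn2r ?nnegrE //; lra.
  move=> h4 h5; have -> : e ^+ 2 = cos t ^+ 2 * e ^+ 2 + sin t ^+ 2 * e ^+ 2.
    by rewrite -mulrDl h3 mul1r.
  by rewrite lerD // ler_wpM2l.
have one (c : R) : c ^+ 2 = (x / P%:R) ^+ 2 ->
    cabs ((1 + (0 +i* c) * ((cos t * ch) +i* (sin t * sh))) ^+ P) <=
    expR (- (P%:R * c) * (sin t * sh)) * expR (x ^+ 2 * e ^+ 2 / (2 * P%:R)).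
  move=> c2; rewrite cabsX.
  have -> : - (P%:R * c) * (sin t * sh) = (- c * (sin t * sh)) * P%:R by ring.
  have -> : x ^+ 2 * e ^+ 2 / (2 * P%:R) = (c ^+ 2 * e ^+ 2 / 2) * P%:R.
    by rewrite c2; field; rewrite gt_eqF.
  rewrite -expRD -mulrDl expRM_natr //.
  apply: lerXn2r; rewrite ?nnegrE ?cabs_ge0 ?expR_ge0 //.
  apply: le_cabs_expR => /=; rewrite !mul0r.
  set s := sin t * sh in D *; set r := cos t * ch in D *.
  apply: le_trans (expR_ge1Dx _).
  have := sqr_ge0 c => c0; have := ler_wpM2l c0 D.
  by move: (e ^+ 2) => E; lra.
rewrite zE cabsM.
have -> : cabs (2^-1 : R[i]) = 2^-1.
  by rewrite -(rmorph_nat (real_complex R)) -fmorphV cabsR ger0_norm ?invr_ge0.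
rewrite /ellipse_bound -/sh -mulrA ler_wpM2l ?invr_ge0 //.
rewrite (le_trans (cabsD _ _)) //.
have o1 := one (x / P%:R) erefl; have o2 := one (- (x / P%:R)) (sqrrN _).
rewrite (le_trans (lerD o1 o2)) // -mulrDl ler_wpM2r ?expR_ge0 //.
have -> : - (P%:R * (x / P%:R)) * (sin t * sh) = - (x * (sin t * sh)).
  by field; rewrite gt_eqF.
have -> : - (P%:R * - (x / P%:R)) * (sin t * sh) = x * (sin t * sh).
  by field; rewrite gt_eqF.
rewrite addrC; apply: cosh_le; rewrite normrM ler_wpM2l // normrM (ger0_norm sh0).
by rewrite ler_piMl // sin_max.
Qed.

End EllipseBound.

(** * Quadrature error for powers of a linear function *)

Section QuadratureError.
Local Open Scope complex_scope.
Variable R : realType.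
Let e : R := expR 1.

(** With z = (u + 1/u) / 2, the even part of (1 + i x z / P)^P is a symmetric
    Laurent polynomial in u. On |u| = 1 it is the real part on the left; on
    |u| = e it is at most [ellipse_bound], and [laurent_coef_bound] turns this
    into the decay exp (- k). The factor 2 comes from u^k + u^-k = 2 cos (k t). *)
Lemma linpow_expansion (x : R) (P : nat) : (0 < P)%N ->
  exists c : nat -> R,
    (forall t, complex.Re (linpow (x / P%:R) P (cos t)) =
       \sum_(0 <= k < P.+1) c k * cos (k%:R * t)) /\
    (forall k, (0 < k <= P)%N -> `|c k| <= 2 * (ellipse_bound x P / e ^+ k)).
Proof.
move=> P0; set c0 := x / P%:R.
have two0 : (2 : R[i]) != 0 by rewrite pnatr_eq0.
pose f (u : R[i]) : R[i] := 2^-1 * ((1 + (0 +i* c0) * ((u + u^-1) / 2)) ^+ P +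
    (1 + (0 +i* - c0) * ((u + u^-1) / 2)) ^+ P).
have [a ha] : sym_laurent P f.
  apply: sym_laurentZ; apply: sym_laurentD; exact: sym_laurent_pow.
exists (fun k => 2 * complex.Re (a k)); split.
  move=> t; have fE : f (expi t) = (complex.Re (linpow c0 P (cos t)))%:C.
    rewrite /f -expiN /expi cosN sinN.
    have -> : (cos t +i* sin t + cos t -i* sin t) / 2 = (cos t)%:C :> R[i].
      have -> : (2 : R[i])^-1 = (2^-1 : R)%:C by rewrite fmorphV rmorph_nat.
      by apply/eqP; rewrite eq_complex /=; apply/andP; split; apply/eqP; field.
    have -> : 1 + (0 +i* c0) * (cos t)%:C = 1 +i* (c0 * cos t) :> R[i].
      by apply/eqP; rewrite eq_complex /=; apply/andP; split; apply/eqP; ring.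
    have -> : 1 + (0 +i* - c0) * (cos t)%:C = 1 +i* (c0 * - cos t) :> R[i].
      by apply/eqP; rewrite eq_complex /=; apply/andP; split; apply/eqP; ring.
    rewrite -/(linpow c0 P (cos t)) -/(linpow c0 P (- cos t)) linpowN addcJ mulKf //.
  have := ha (expi t) (expi_neq0 t); rewrite fE => /(congr1 (@complex.Re R)) /= ->.
  rewrite Re_sum; apply: eq_bigr => k _.
  rewrite -expiN -!expiMn /expi mulNr cosN sinN.
  have -> : cos (t * k%:R) +i* sin (t * k%:R) + cos (t * k%:R) -i* sin (t * k%:R) =
    (2 * cos (k%:R * t))%:C :> R[i].
    by rewrite (mulrC t); apply/eqP; rewrite eq_complex /=; apply/andP; split; apply/eqP; ring.
  by rewrite mulrC RexM; ring.
move=> k kP; rewrite normrM (@ger0_norm _ 2) // ler_wpM2l //.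
have Re_le (z : R[i]) : `|complex.Re z| <= cabs z.
  by rewrite -lecR -normE; exact: normc_ge_Re.
rewrite (le_trans (Re_le _)) //.
apply: (@laurent_coef_bound R P a f e (ellipse_bound x P) _ ha _ k kP).
  exact: expR_gt0.
by move=> t; exact: le_ellipse_bound.
Qed.

Lemma geom_even_tail (r : R) (h m : nat) : 0 <= r -> r < 1 ->
  \sum_(0 <= k < m) (if ~~ odd k && (2 * h < k)%N then r ^+ k else 0) <=
  r ^+ (2 * h).+2 / (1 - r ^+ 2).
Proof.
move=> r0 r1; have q1 : 0 < 1 - r ^+ 2 by rewrite subr_gt0 expr_lt1.
pose F (k : nat) : R := if ~~ odd k && (2 * h < k)%N then r ^+ k else 0.
rewrite -[leLHS]/(\sum_(0 <= k < m) F k).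
have F0 k : 0 <= F k by rewrite /F; case: ifP => // _; exact: exprn_ge0.
(* geometric sum over the even k with 2 h < k < 2 j, empty for j <= h + 1 *)
have big j : \sum_(0 <= k < 2 * j) F k <= (r ^+ (2 * h).+2 - r ^+ (2 * maxn j h.+1)) / (1 - r ^+ 2).
  elim: j => [|j IH].
    by rewrite big_geq // max0n mulnS add2n subrr mul0r.
  rewrite mulnS add2n 2?big_nat_recr //=.
  have -> : F (2 * j).+1 = 0 by rewrite /F /= oddM.
  rewrite addr0 /F oddM /=; case: ifP => [|/negbT] hj.
    have -> : maxn j.+1 h.+1 = j.+1 by lia.
    have jE : maxn j h.+1 = j by lia.
    rewrite jE in IH; rewrite (le_trans (lerD IH (lexx _))) //.
    rewrite -[X in _ + X](mulfK (lt0r_neq0 q1)) -mulrDl ler_wpM2r ?invr_ge0 ?(ltW q1) //.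
    rewrite mulnS exprD; rewrite le_eqVlt; apply/orP; left; apply/eqP.
    by move: (r ^+ (2 * j)) (r ^+ 2) (r ^+ (2 * h).+2) => A B D; ring.
  rewrite addr0 (le_trans IH) //.
  by have -> : maxn j.+1 h.+1 = maxn j h.+1 by lia.
apply: (@le_trans _ _ (\sum_(0 <= k < 2 * m) F k)).
  rewrite [leRHS](big_cat_nat (n := m)) //=; last by lia.
  by rewrite lerDl; apply: sumr_ge0.
rewrite (le_trans (big m)) // ler_wpM2r ?invr_ge0 ?(ltW q1) //.
by rewrite gerBl exprn_ge0.
Qed.

(** The first term is the mean over [-1, 1], through the explicit antiderivative
    of the odd function Im (linpow). In the cosine expansion only even
    k > 2 h contribute to the error. There k >= 6, so that the exact mean is at
    most 1/35 in absolute value, and the value of the rule is at most 1. This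
    leaves 2 * 36/35 times a geometric series. *)
Lemma quadrature_linpow (x : R) (P h : nat) : x != 0 -> (0 < P)%N -> (1 < h)%N ->
  `|complex.Im (linpow (x / P%:R) P.+1 1) / (P.+1%:R * (x / P%:R)) -
    \sum_(0 <= j < (2 * h).+1) cc_weight R (2 * h) j *
      complex.Re (linpow (x / P%:R) P (cheb R (2 * h) j))|
  <= 72 / 35 * ellipse_bound x P * ((e^-1) ^+ (2 * h).+2 / (1 - (e^-1) ^+ 2)).
Proof.
move=> x0 P0 h1; have h0 : (0 < h)%N by exact: ltnW.
have PR : P%:R != 0 :> R by rewrite pnatr_eq0 -lt0n.
have P1 : P.+1%:R != 0 :> R by rewrite pnatr_eq0.
set c0 := x / P%:R; have c00 : c0 != 0 by rewrite mulf_neq0 ?invr_eq0.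
have [c [hc cb]] := linpow_expansion x P0.
pose G (z : R) := complex.Im (linpow c0 P.+1 z) / (P.+1%:R * c0).
have dG (z : R) : is_derive z 1 G (complex.Re (linpow c0 P z)).
  have [_ d] := is_derive_linpow c0 P z.
  rewrite /G; apply: is_derive_eq; rewrite /GRing.scale /=. by field; rewrite c00 nat1r.
have := cheb_mean dG hc.
have -> : 2^-1 * (G 1 - G (-1)) = G 1.
  rewrite /G linpowN; have -> : complex.Im ((linpow c0 P.+1 1)^*)%C = - complex.Im (linpow c0 P.+1 1).
    by case: (linpow _ _ _).
  by field; rewrite c00 nat1r.
rewrite -/(G 1) => ->.
pose nu (k : nat) : R := \sum_(0 <= j < (2 * h).+1) cc_weight R (2 * h) j * cos (k%:R * (j%:R * pi / (2 * h)%:R)).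
have -> : \sum_(0 <= j < (2 * h).+1) cc_weight R (2 * h) j * complex.Re (linpow c0 P (cheb R (2 * h) j)) =
    \sum_(0 <= k < P.+1) c k * nu k.
  under eq_bigr => j _ do rewrite /cheb hc mulr_sumr.
  rewrite exchange_big /=; apply: eq_bigr => k _; rewrite /nu mulr_sumr.
  by apply: eq_bigr => j _; ring.
rewrite -sumrB (le_trans (ler_norm_sum _ _ _)) //.
have e0 : 0 < e := expR_gt0 1.
have M0 : 0 <= ellipse_bound x P.
  by rewrite /ellipse_bound !mulr_ge0 ?invr_ge0 ?addr_ge0 ?expR_ge0.
have einv1 : e^-1 < 1 by rewrite invf_lt1 // -expR0 ltr_expR.
have einv0 : 0 <= e^-1 by rewrite invr_ge0 ltW.
apply: (@le_trans _ _ (\sum_(0 <= k < P.+1) 72 / 35 * ellipse_bound x P *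
    (if ~~ odd k && (2 * h < k)%N then (e^-1) ^+ k else 0))); last first.
  rewrite -mulr_sumr ler_wpM2l ?mulr_ge0 //.
  exact: geom_even_tail.
apply: ler_sum_nat => k /andP[_]; rewrite ltnS => kP.
rewrite -mulrBr normrM /cheb_int.
case: (boolP (odd k)) => ko /=.
  by rewrite /nu cc_cos_odd // subrr normr0 !mulr0.
have [l kE] : exists l, k = (2 * l)%N by exists k./2; rewrite mul2n even_halfK.
have nuE : nu k = (1 - 4 * (fold_index h l)%:R ^+ 2)^-1 by rewrite /nu kE cc_cos_even.
have kR : k%:R ^+ 2 = 4 * l%:R ^+ 2 :> R by rewrite kE natrM; ring.
rewrite nuE kR; case: ltnP => hk; last first.
  have lh : (l <= h)%N by move: hk; rewrite kE leq_pmul2l.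
  by rewrite fold_index_small ?subrr ?normr0 ?mulr0.
have l3 : (3 <= l)%N by move: hk; rewrite kE ltn_pmul2l //; exact: leq_ltn_trans.
have b1 : `|(1 - 4 * l%:R ^+ 2)^-1| <= 35^-1 :> R.
  have : 3 <= l%:R :> R by rewrite (ler_nat R 3).
  rewrite normfV -normrN opprB => l3R; rewrite lef_pV2 ?posrE ?ger0_norm //; nra.
have b2 : `|(1 - 4 * (fold_index h l)%:R ^+ 2)^-1| <= 1 :> R.
  case: (fold_index h l) => [|f]; first by rewrite expr0n mulr0 subr0 invr1 normr1.
  have : 1 <= f.+1%:R :> R by rewrite (ler_nat R 1).
  rewrite normfV -normrN opprB => f1; rewrite invf_le1 ger0_norm //; nra.
have ck := cb k; have k0 : (0 < k)%N := leq_ltn_trans (leq0n _) hk.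
have := ck; rewrite k0 kP => /(_ isT) {}ck.
rewrite (le_trans (ler_pM _ _ ck (le_trans (ler_normB _ _) (lerD b1 b2)))) //.
rewrite exprVn -[e ^- k]/((e ^+ k)^-1).
have w0 : 0 <= ellipse_bound x P / e ^+ k by rewrite divr_ge0 // exprn_ge0 // ltW.
rewrite -[leRHS]mulrA; move: (ellipse_bound x P / e ^+ k) w0 => E E0; lra.
Qed.

End QuadratureError.

(** * From powers to the exponential *)

Section PowerLimit.
Local Open Scope classical_set_scope.
Local Open Scope complex_scope.
Variable R : realType.
Let e : R := expR 1.

Lemma cvg_harmonic_rate (u : nat -> R) (l C : R) :
  (forall n, `|u n - l| <= C / n.+1%:R) -> u @ \oo --> l.
Proof.
move=> hu; apply/cvgrPdist_le => /= eps eps0; near=> n.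
rewrite distrC (le_trans (hu n)) // ler_pdivrMr //.
have h : C / eps <= n%:R by near: n; exact: nbhs_infty_ger.
move: h; rewrite ler_pdivrMr // -natr1 => h; nra.
Unshelve. all: end_near. Qed.

(** Each of the two terms is at most s^2 / 2. *)
Lemma sin_cos_small (s : R) : `|1 - cos s| + `|s - sin s| <= s ^+ 2.
Proof.
wlog s0 : s / 0 <= s.
  move=> hw; have [/hw //|/ltW sn] := lerP 0 s.
  have := hw (- s); rewrite oppr_ge0 => /(_ sn).
  by rewrite cosN sinN sqrrN -opprD normrN.
have c1 : 0 <= 1 - cos s by rewrite subr_ge0 cos_le1.
have hcos (y : R) : 0 <= y -> 0 <= y - (1 - cos y).
  move=> y0; have := @derive_ge0_le R (fun y => y - (1 - cos y)) (fun y => 1 - sin y) 0 y y0.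
  rewrite cos0 subrr subr0; apply.
    by move=> z _; apply: is_derive_eq; ring.
  by move=> z _; rewrite subr_ge0 sin_le1.
have hs1 (y : R) : 0 <= y -> 0 <= y - sin y.
  move=> y0; have := @derive_ge0_le R (fun y => y - sin y) (fun y => 1 - cos y) 0 y y0.
  rewrite sin0 subrr; apply.
  by move=> z _; rewrite subr_ge0 cos_le1.
have h2 : 0 <= 2^-1 * s ^+ 2 - (s - sin s).
  have := @derive_ge0_le R (fun y => 2^-1 * y ^+ 2 - (y - sin y)) (fun y => y - (1 - cos y)) 0 s s0.
  rewrite sin0 expr0n mulr0 subrr subr0; apply.
    by move=> z _; apply: is_derive_eq; rewrite /GRing.scale /=; field.
  by move=> z /andP[z0 _]; exact: hcos.
have h3 : 0 <= 2^-1 * s ^+ 2 - (1 - cos s).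
  have := @derive_ge0_le R (fun y => 2^-1 * y ^+ 2 - (1 - cos y)) (fun y => y - sin y) 0 s s0.
  rewrite cos0 expr0n mulr0 subrr subr0; apply.
    by move=> z _; apply: is_derive_eq; rewrite /GRing.scale /=; field.
  by move=> z /andP[z0 _]; exact: hs1.
rewrite !ger0_norm ?hs1 //; lra.
Qed.

Lemma cabs_subX (a b : R[i]) (n : nat) : cabs b = 1 -> 1 <= cabs a ->
  cabs (a ^+ n - b ^+ n) <= n%:R * cabs (a - b) * cabs a ^+ n.
Proof.
move=> b1 a1; rewrite subrXX cabsM mulrAC [leRHS]mulrC; apply: ler_wpM2l; first exact: cabs_ge0.
rewrite (le_trans (cabs_sum _ _ _)) //.
apply: (@le_trans _ _ (\sum_(i < n) cabs a ^+ n)).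
  apply: ler_sum => i _; rewrite cabsM !cabsX b1 expr1n mulr1.
  by apply: ler_weXn2l => //; have := ltn_ord i; lia.
by rewrite sumr_const card_ord mulr_natl.
Qed.

(** With s = y / P, compare the P-th powers of 1 + i s and exp (i s): the bases
    differ by at most s^2, and |1 + i s|^P <= exp (y^2 / 2). *)
Lemma linpow_close (y : R) (P : nat) : (0 < P)%N ->
  cabs (linpow (y / P%:R) P 1 - expi y) <= y ^+ 2 * expR (y ^+ 2 / 2) / P%:R.
Proof.
move=> P0; have PR : 0 < P%:R :> R by rewrite ltr0n.
have P1 : 1 <= P%:R :> R by rewrite ler1n.
set s := y / P%:R; rewrite /linpow mulr1.
have -> : expi y = expi s ^+ P :> R[i].
  by rewrite -expiMn /s divfK // gt_eqF.
have a2 : cabs (1 +i* s) ^+ 2 = 1 + s ^+ 2 by rewrite cabs_sqr /= expr1n.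
have a1 : 1 <= cabs (1 +i* s).
  by rewrite -(ler_pXn2r (_ : (0 < 2)%N)) ?nnegrE ?cabs_ge0 // a2 expr1n lerDl sqr_ge0.
apply: (le_trans (cabs_subX _ (cabs_expi _) a1)).
have aP : cabs (1 +i* s) ^+ P <= expR (y ^+ 2 / 2).
  have : cabs (1 +i* s) <= expR (s ^+ 2 / 2).
    apply: le_cabs_expR => /=; rewrite expr1n mulrCA mulfV ?mulr1 ?pnatr_eq0 //.
    exact: expR_ge1Dx.
  move=> h; rewrite (le_trans (lerXn2r P _ _ h)) ?nnegrE ?cabs_ge0 ?expR_ge0 //.
  rewrite -expRM_natr ler_expR /s expr_div_n.
  have -> : y ^+ 2 / P%:R ^+ 2 / 2 * P%:R = y ^+ 2 / 2 * P%:R^-1 by field; rewrite gt_eqF.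
  by rewrite ler_piMr ?invf_le1 // mulr_ge0 ?sqr_ge0.
have ab : cabs (1 +i* s - expi s) <= s ^+ 2.
  by rewrite (le_trans (cabs_le_ReIm _)) //= sin_cos_small.
apply: (@le_trans _ _ (P%:R * s ^+ 2 * expR (y ^+ 2 / 2))).
  by apply: ler_pM => //; rewrite ?mulr_ge0 ?exprn_ge0 ?cabs_ge0 // ler_wpM2l.
by rewrite /s le_eqVlt; apply/orP; left; apply/eqP; field; rewrite gt_eqF.
Qed.

Lemma linpow_scale (c z : R) n : linpow c n z = linpow (c * z) n 1.
Proof. by rewrite /linpow mulr1. Qed.

Lemma cvg_Re_linpow (x z : R) :
  (fun n : nat => complex.Re (linpow (x / n.+1%:R) n.+1 z)) @ \oo --> cos (x * z).
Proof.
apply: (@cvg_harmonic_rate _ _ ((x * z) ^+ 2 * expR ((x * z) ^+ 2 / 2))) => n.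
rewrite linpow_scale mulrAC; apply: le_trans (linpow_close (x * z) (ltn0Sn n)).
rewrite -lecR -normE; apply: le_trans (normc_ge_Re _).
by case: (linpow _ _ _).
Qed.

Lemma cvg_Im_linpow (x z : R) :
  (fun n : nat => complex.Im (linpow (x / n.+1%:R) n.+1 z)) @ \oo --> sin (x * z).
Proof.
apply: (@cvg_harmonic_rate _ _ ((x * z) ^+ 2 * expR ((x * z) ^+ 2 / 2))) => n.
rewrite linpow_scale mulrAC; apply: le_trans (linpow_close (x * z) (ltn0Sn n)).
rewrite -(ImB _ (expi _)) -[complex.Im _]opprK normrN -ReiNIm.
rewrite -lecR -normE; apply: le_trans (normc_ge_Re _) _.
by rewrite normrM [X in _ * X](_ : _ = 1) ?mulr1 // normc_def /= expr0n add0r expr1n sqrtr1.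
Qed.

Lemma cvg_sum_nat (m : nat) (f : nat -> nat -> R) (l : nat -> R) :
  (forall j, (fun n => f n j) @ \oo --> l j) ->
  (fun n => \sum_(0 <= j < m) f n j) @ \oo --> \sum_(0 <= j < m) l j.
Proof.
move=> fl; elim: m => [|m IH].
  rewrite big_geq //; under eq_fun do rewrite big_geq //.
  exact: cvg_cst.
rewrite big_nat_recr //=; under eq_fun do rewrite big_nat_recr //=.
by apply: cvgD.
Qed.

(** The limit P -> oo of [quadrature_linpow]. The mean there is a quotient by x,
    so x = 0 is treated apart. *)
Lemma quadrature_sinc (x : R) (h : nat) : (1 < h)%N ->
  `|sinc x - \sum_(0 <= j < (2 * h).+1) cc_weight R (2 * h) j * cos (x * cheb R (2 * h) j)|
  <= 72 / 35 * (2^-1 * (expR (`|x| * ((e - e^-1) / 2)) + expR (- (`|x| * ((e - e^-1) / 2)))))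
     * ((e^-1) ^+ (2 * h).+2 / (1 - (e^-1) ^+ 2)).
Proof.
move=> h1; have h0 : (0 < h)%N by exact: ltnW.
have e0 : 0 < e := expR_gt0 1.
have einv1 : e^-1 < 1 by rewrite invf_lt1 // -expR0 ltr_expR.
have einv0 : 0 <= e^-1 by rewrite invr_ge0 ltW.
have D0 : 0 <= (e^-1) ^+ (2 * h).+2 / (1 - (e^-1) ^+ 2).
  by rewrite divr_ge0 ?exprn_ge0 // subr_ge0 exprn_ile1 // ltW.
have [->|x0] := eqVneq x 0.
  under eq_bigr do rewrite mul0r cos0 mulr1.
  rewrite cc_weight_sum // /sinc eqxx subrr normr0; apply: mulr_ge0 => //; rewrite mulr_ge0 // ?mulr_ge0 // ?divr_ge0 // ?addr_ge0 ?expR_ge0 ?invr_ge0 //.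
rewrite /sinc (negbTE x0).
have hn (n : nat) := @quadrature_linpow R x n.+1 h x0 (ltn0Sn n) h1.
have cl : (fun n : nat => `|complex.Im (linpow (x / n.+1%:R) n.+2 1) / (n.+2%:R * (x / n.+1%:R)) -
    \sum_(0 <= j < (2 * h).+1) cc_weight R (2 * h) j *
      complex.Re (linpow (x / n.+1%:R) n.+1 (cheb R (2 * h) j))|) @ \oo -->
   `|sin x / x - \sum_(0 <= j < (2 * h).+1) cc_weight R (2 * h) j * cos (x * cheb R (2 * h) j)|.
  apply: cvg_norm; apply: cvgB.
    have ch := @cvg_harmonic R.
    have -> : (fun n : nat => complex.Im (linpow (x / n.+1%:R) n.+2 1) / (n.+2%:R * (x / n.+1%:R))) =
      (fun n : nat => (complex.Im (linpow (x / n.+1%:R) n.+1 1) + x * harmonic n * complex.Re (linpow (x / n.+1%:R) n.+1 1))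
         * (x * (1 + harmonic n))^-1).
      apply/funext => n; rewrite linpowS mulr1; congr (_ / _).
      by rewrite /harmonic /= -(natr1 n.+1); field; rewrite nat1r pnatr_eq0.
    have -> : sin x / x = (sin (x * 1) + x * 0 * cos (x * 1)) * (x * (1 + 0))^-1.
      by rewrite !mulr1 mulr0 mul0r !addr0 mulr1.
    apply: cvgM.
      apply: cvgD; first exact: cvg_Im_linpow.
      apply: cvgM; last exact: cvg_Re_linpow.
      by apply: cvgM => //; exact: cvg_cst.
    apply: cvgV; first by rewrite addr0 mulr1.
    apply: cvgM; first exact: cvg_cst.
    by apply: cvgD => //; exact: cvg_cst.
  apply: cvg_sum_nat => j; apply: cvgM; first exact: cvg_cst.
  exact: cvg_Re_linpow.
have cr : (fun n : nat => 72 / 35 * ellipse_bound x n.+1 * ((e^-1) ^+ (2 * h).+2 / (1 - (e^-1) ^+ 2))) @ \oo -->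
  72 / 35 * (2^-1 * (expR (`|x| * ((e - e^-1) / 2)) + expR (- (`|x| * ((e - e^-1) / 2)))))
     * ((e^-1) ^+ (2 * h).+2 / (1 - (e^-1) ^+ 2)).
  apply: cvgM; last exact: cvg_cst.
  apply: cvgM; first exact: cvg_cst.
  rewrite -[X in _ --> X]mulr1; apply: cvgM; first exact: cvg_cst.
  pose A : R := x ^+ 2 * e ^+ 2 / 2.
  suff : (fun n : nat => expR (A * harmonic n)) @ \oo --> expR (A * 0).
    rewrite mulr0 expR0 (_ : (fun n : nat => expR (A * harmonic n)) =
      (fun n : nat => expR (x ^+ 2 * e ^+ 2 / (2 * n.+1%:R)))) //.
    by apply/funext => n; congr expR; rewrite /A /harmonic /=; field; rewrite nat1r pnatr_eq0.
  apply: continuous_cvg; first exact: continuous_expR.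
  by apply: cvgM; [exact: cvg_cst | exact: cvg_harmonic].
by apply: ler_cvg_to cl cr _; apply: nearW => n; exact: hn.
Qed.

End PowerLimit.

(** * Quadrature of sinc *)

Section SincApproximation.
Variables (R : realType) (N n h : nat).
Hypotheses (N0 : (0 < N)%N) (h1 : (1 < h)%N) (nh : n = (2 * h)%N).
Local Open Scope complex_scope.
Let e : R := expR 1.
Let C : R := pi * (e ^+ 2 - 1) / (2 * e).
Let nu : R := n%:R / N%:R.

(** Since C = pi sinh 1, the factor cosh (|x| sinh 1) is at most cosh (C N), and
    the geometric tail equals exp (- n) / (e^2 - 1). *)
Lemma quadrature_rate (x : R) : `|x| <= N%:R * pi ->
  72 / 35 * (2^-1 * (expR (`|x| * ((e - e^-1) / 2)) + expR (- (`|x| * ((e - e^-1) / 2)))))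
     * ((e^-1) ^+ (2 * h).+2 / (1 - (e^-1) ^+ 2)) <=
  36 * (1 + expR (- (2 * C * N%:R))) / (35 * (e ^+ 2 - 1)) * expR (- (N%:R * (nu - C))).
Proof.
move=> xN; have e0 : 0 < e := expR_gt0 1.
have e1 : 1 < e by rewrite -expR0 ltr_expR.
have e21 : 0 < e ^+ 2 - 1 by rewrite subr_gt0 exprn_egt1.
have NR : 0 < N%:R :> R by rewrite ltr0n.
have sh0 : 0 <= (e - e^-1) / 2.
  have : e^-1 <= 1 by rewrite invf_le1 // ltW.
  by move=> ei; rewrite divr_ge0 // subr_ge0 (le_trans ei) // ltW.
have CN : N%:R * pi * ((e - e^-1) / 2) = C * N%:R.
  by rewrite /C; field; rewrite gt_eqF.
have tailE : (e^-1) ^+ (2 * h).+2 / (1 - (e^-1) ^+ 2) = expR (- n%:R) / (e ^+ 2 - 1).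
  rewrite -(addn2 (2 * h)) exprD -nh.
  have -> : (e^-1) ^+ n = expR (- n%:R).
    by rewrite /e -expRN -expRM_natr mulN1r.
  have ne : e ^+ 2 - 1 != 0 by rewrite gt_eqF.
  have ne' : 1 - e^-1 ^+ 2 != 0.
    have -> : 1 - e^-1 ^+ 2 = (e ^+ 2 - 1) / e ^+ 2 by field; rewrite gt_eqF.
    by rewrite mulf_neq0 // invr_eq0 expf_neq0 // gt_eqF.
  by rewrite -mulrA; congr (_ * _); field; rewrite ne gt_eqF.
rewrite tailE.
have -> : expR (- (N%:R * (nu - C))) = expR (C * N%:R) * expR (- n%:R).
  by rewrite -expRD; congr expR; rewrite /nu; field; rewrite gt_eqF.
have Y : `| `|x| * ((e - e^-1) / 2)| <= C * N%:R.
  by rewrite (ger0_norm (mulr_ge0 (normr_ge0 x) sh0)) -CN ler_wpM2r.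
have hc := cosh_le Y.
have expC : (1 + expR (- (2 * C * N%:R))) * expR (C * N%:R) = expR (C * N%:R) + expR (- (C * N%:R)).
  by rewrite mulrDl mul1r -expRD; congr (_ + expR _); ring.
have -> : 36 * (1 + expR (- (2 * C * N%:R))) / (35 * (e ^+ 2 - 1)) * (expR (C * N%:R) * expR (- n%:R)) =
  36 / 35 * ((1 + expR (- (2 * C * N%:R))) * expR (C * N%:R)) * (expR (- n%:R) / (e ^+ 2 - 1)).
  by field; rewrite gt_eqF.
rewrite expC ler_wpM2r //; first by rewrite divr_ge0 ?expR_ge0 // ltW.
move: hc; move: (expR _ + expR _) (expR _ + expR _) => u v; lra.
Qed.

(** The imaginary part of the rule vanishes because the sine is odd. *)
Lemma sinc_quadrature (x : R) : `|x| <= N%:R * pi ->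
  cabs ((sinc x)%:C - \sum_(0 <= j < n.+1) (cc_weight R n j)%:C * expi (x * cheb R n j)) <=
  36 * (1 + expR (- (2 * C * N%:R))) / (35 * (e ^+ 2 - 1)) * expR (- (N%:R * (nu - C))).
Proof.
move=> xN; have h0 : (0 < h)%N by exact: ltnW.
have -> : \sum_(0 <= j < n.+1) (cc_weight R n j)%:C * expi (x * cheb R n j) =
    (\sum_(0 <= j < n.+1) cc_weight R n j * cos (x * cheb R n j))%:C.
  apply: cplx_eq.
    by rewrite Re_sum [RHS]/=; apply: eq_bigr => j _; rewrite RexM.
  rewrite Im_sum [RHS]/=; under eq_bigr do rewrite ImxM.
  rewrite nh; apply: (cc_odd h0 (g := fun z => sin (x * z))) => z.
  by rewrite mulrN sinN.
rewrite -rmorphB cabsR; apply: le_trans (quadrature_rate xN).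
by rewrite nh; exact: quadrature_sinc.
Qed.

End SincApproximation.

(** * The fast sinc transform *)

Theorem theorem6p2 (R : realType) (N L1 L2 N1 N2 m1 m2 : nat)
  (sigma1 sigma2 : R) (omega1 omega2 : R -> R)
  (pta ptb : int -> R) (c : int -> R[i]) (eps : R) (t : nat) :
  (0 < N)%N -> posEven L1 -> posEven L2 ->
  posEven N1 -> N1%:R = sigma1 * N%:R -> 1 < sigma1 ->
  (1 < m1)%N -> (2 * m1 < N1)%N ->
  posEven N2 -> N2%:R = sigma2 * (N1 + 2 * m1)%:R -> 1 < sigma2 ->
  (1 < m2)%N -> 2 * m2%:R <= (1 - sigma1^-1) * N2%:R ->
  Omega m1 sigma1 omega1 -> Omega m2 sigma2 omega2 ->
  (forall k : int, k \in Iset L1 -> - 2^-1 <= pta k <= 2^-1) ->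
  (forall l : int, l \in Iset L2 -> - 2^-1 <= ptb l <= 2^-1) ->
  0 < eps -> (1 < t)%N ->
  let phi1 := window omega1 m1 N1%:R in
  let phi2 := window omega2 m2 N2%:R in
  let a : R := 1 + 2 * m1%:R / N1%:R in
  let e : R := expR 1 in
  let C : R := pi * (e ^+ 2 - 1) / (2 * e) in
  let n := (2 ^ t)%N in
  let nu : R := n%:R / N%:R in
  36 * (1 + expR (- (2 * C * N%:R))) / (35 * (e ^+ 2 - 1))
    * expR (- (N%:R * (nu - C))) < eps ->
  C < nu ->
  let h := sinc_sum N L1 c pta in
  let ht := fast_sinc N N1 N2 m1 sigma1 phi1 phi2 n L1 c pta ptb in
  (* the transform of phi1 at N/2 is a positive real number *)
  let phi1hat := complex.Re (fourier phi1 (N%:R / 2)) in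
  let E1 := Esigma omega1 m1 sigma1 in
  let E2 := Esigma omega2 m2 sigma2 in
  let maxerr := \big[Num.max/0]_(l <- Iset L2) cabs (h (ptb l) - ht l) in
  let csum := \sum_(k <- Iset L1) cabs (c k) in
  maxerr <= (eps + 2 * (E1 + a / phi1hat * E2)
                 + (E1 + a / phi1hat * E2) ^+ 2) * csum
  /\
  (E1 + a / phi1hat * E2 <= 1 ->
   maxerr <= (eps + 3 * E1 + 3 * a / phi1hat * E2) * csum).
Proof.
move=> N0 _ _ N1e N1E s1 m1_gt1 _ N2e N2E s2 m2_gt1 m2le O1 O2 ptaP ptbP eps0 t1.
move=> phi1 phi2 a e C n nu heps _ h ht phi1hat E1 E2 maxerr csum.
pose E := E1 + a / phi1hat * E2.
have E0 : 0 <= E.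
  apply: addr_ge0; first exact: (E1_ge0 N0 N1e N1E s1 m1_gt1 O1).
  apply: mulr_ge0; last exact: (E2_ge0 N1e N2e N2E s2 m2_gt1 O2).
  apply: divr_ge0; first exact: a_ge0.
  exact: ltW (phi1hat_gt0 N0 N1e N1E s1 m1_gt1 O1).
have csum0 : 0 <= csum by apply: sumr_ge0 => k _; exact: cabs_ge0.
have nnE := @nnfft_error R N N1 N2 m1 m2 sigma1 sigma2 omega1 omega2 N0 N1e N1E s1 m1_gt1
  N2e N2E s2 m2_gt1 m2le O1 O2.
have [hh [hh1 nh]] : exists hh, (1 < hh)%N /\ n = (2 * hh)%N.
  exists (2 ^ t.-1)%N; rewrite /n -expnS prednK ?(ltnW t1) //; split => //.
  by rewrite -[X in (X < _)%N](expn0 2) ltn_exp2l //; case: (t) t1 => [|[]].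
have hh0 : (0 < hh)%N by exact: ltnW.
pose W j : R := cc_weight R n j.
have W0 j : 0 <= W j by rewrite /W nh; exact: cc_weight_ge0.
have W1 : \sum_(0 <= j < n.+1) W j = 1 by rewrite /W nh cc_weight_sum.
have W_mean (y : R) : \sum_(j <- iota 0 n.+1) W j * y = y.
  by rewrite -mulr_suml [X in X * _]W1 mul1r.
have z1 j : `|cheb R n j / 2| <= 2^-1.
  rewrite normrM (@ger0_norm _ 2^-1) ?invr_ge0 // -[leRHS]mul1r ler_wpM2r ?invr_ge0 //.
  exact: cos_max.
pose g j : R[i] := \sum_(k <- Iset L1) c k * expi (- (2 * pi * (N%:R * (cheb R n j / 2)) * pta k)).
pose gt j : R[i] := fsinc_g N N1 N2 m1 sigma1 phi1 phi2 n L1 c pta j.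
have gE j : cabs (g j - gt j) <= E * csum.
  apply: nnE => // k /ptaP; by rewrite ler_norml.
have gle j : cabs (g j) <= csum.
  rewrite (le_trans (cabs_sum _ _ _)) //; apply: ler_sum => k _.
  by rewrite cabsM cabs_expi mulr1.
have gtle j : cabs (gt j) <= (1 + E) * csum.
  have -> : gt j = g j - (g j - gt j) by rewrite opprB addrC subrK.
  rewrite (le_trans (cabsD _ _)) // cabsN mulrDl mul1r; exact: lerD.
pose al j : R[i] := fsinc_alpha N N1 N2 m1 sigma1 phi1 phi2 n L1 c pta j.
have alE j : al j = ((W j)%:C)%C * gt j by [].
have aln j : cabs (al j) <= W j * ((1 + E) * csum).
  by rewrite alE cabsM cabsR ger0_norm // ler_wpM2l.
have alsum : \sum_(j <- iota 0 n.+1) cabs (al j) <= (1 + E) * csum.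
  rewrite -[leRHS](W_mean ((1 + E) * csum)); exact: ler_sum.
have main l : l \in Iset L2 ->
    cabs (h (ptb l) - ht l) <= (eps + 2 * E + E ^+ 2) * csum.
  move=> /ptbP bl; have b1 : `|ptb l| <= 2^-1 by rewrite ler_norml.
  set b := ptb l in bl b1 *.
  pose ex j : R[i] := expi (- (2 * pi * (N%:R * b) * - (cheb R n j / 2))).
  (* second NNFFT *)
  have h3 : cabs (\sum_(j <- iota 0 n.+1) al j * ex j - ht l) <= E * ((1 + E) * csum).
    apply: (@le_trans _ _ (E * \sum_(j <- iota 0 n.+1) cabs (al j))).
      by apply: nnE => // j _; rewrite normrN.
    by rewrite ler_wpM2l.
  (* first NNFFT, averaged by the weights *)
  have h2 : cabs (\sum_(j <- iota 0 n.+1) ((W j)%:C)%C * (g j - gt j) * ex j) <= E * csum.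
    rewrite (le_trans (cabs_sum _ _ _)) // -[leRHS](W_mean (E * csum)).
    apply: ler_sum => j _; rewrite !cabsM cabs_expi mulr1 cabsR ger0_norm //.
    by rewrite ler_wpM2l.
  (* quadrature of sinc (N pi (b - a_k)), for each k *)
  have h1 : cabs (h b - \sum_(j <- iota 0 n.+1) ((W j)%:C)%C * g j * ex j) <= eps * csum.
    have -> : h b - \sum_(j <- iota 0 n.+1) ((W j)%:C)%C * g j * ex j =
      \sum_(k <- Iset L1) c k * ((sinc (N%:R * pi * (b - pta k)))%:C%C -
        \sum_(0 <= j < n.+1) ((W j)%:C)%C * expi (N%:R * pi * (b - pta k) * cheb R n j)).
      rewrite /h /sinc_sum; under [X in _ - X]eq_bigr => j _ do
        rewrite mulrAC mulr_sumr.
      rewrite exchange_big /= -sumrB; apply: eq_bigr => k _.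
      rewrite [RHS]mulrBr; congr (_ - _); rewrite mulr_sumr; apply: eq_bigr => j _.
      have -> : expi (N%:R * pi * (b - pta k) * cheb R n j) =
         ex j * expi (- (2 * pi * (N%:R * (cheb R n j / 2)) * pta k)) :> R[i].
        by rewrite -expiD; congr expi; field.
      by ring.
    rewrite (le_trans (cabs_sum _ _ _)) // mulr_sumr big_seq [leRHS]big_seq.
    apply: ler_sum => k /ptaP ak; rewrite cabsM mulrC ler_wpM2r ?cabs_ge0 //.
    apply: le_trans (ltW heps).
    apply: (sinc_quadrature N0 hh1 nh).
    rewrite normrM ger0_norm ?mulr_ge0 ?pi_ge0 // ler_piMr ?mulr_ge0 ?pi_ge0 //.
    by rewrite ler_norml; move: bl ak => /andP[? ?] /andP[? ?]; apply/andP; split; lra.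
  have -> : h b - ht l = (h b - \sum_(j <- iota 0 n.+1) ((W j)%:C)%C * g j * ex j) +
     \sum_(j <- iota 0 n.+1) ((W j)%:C)%C * (g j - gt j) * ex j +
     (\sum_(j <- iota 0 n.+1) al j * ex j - ht l).
    have -> : \sum_(j <- iota 0 n.+1) ((W j)%:C)%C * (g j - gt j) * ex j =
      \sum_(j <- iota 0 n.+1) ((W j)%:C)%C * g j * ex j - \sum_(j <- iota 0 n.+1) al j * ex j.
      by rewrite -sumrB; apply: eq_bigr => j _; rewrite alE; ring.
    by ring.
  rewrite (le_trans (cabsD _ _)) // (le_trans (lerD (cabsD _ _) (lexx _))) //.
  rewrite (le_trans (lerD (lerD h1 h2) h3)) //.
  by rewrite le_eqVlt; apply/orP; left; apply/eqP; ring.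
have bnd B : (eps + 2 * E + E ^+ 2) <= B -> maxerr <= B * csum.
  move=> hB; rewrite /maxerr big_seq; apply: bigmax_le => [|l lL].
    rewrite mulr_ge0 // (le_trans _ hB) // addr_ge0 ?exprn_ge0 // addr_ge0 ?mulr_ge0 //.
    exact: ltW.
  by rewrite (le_trans (main l lL)) // ler_wpM2r.
split; first by apply: bnd; rewrite -/E.
rewrite -/E => E_le1; apply: bnd.
have -> : eps + 3 * E1 + 3 * a / phi1hat * E2 = eps + 3 * E by rewrite /E; ring.
have : E ^+ 2 <= E by rewrite expr2 ler_piMr.
lra.
Qed.
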